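(* Let $H\colon(\mathbb{C}^2,0)\to(\mathbb{C}^2,0)$ be a local biholomorphism tangent to the identity at $0$, i.e. of the form $H(Z)=Z+O(|Z|^2)$. Suppose that $H$ preserves a germ of a Levi-nonflat real-analytic hypersurface at $0$. Then $H$ fixes each point of a complex hypersurface through $0$.
   Context: A real-analytic hypersurface $M\subset\mathbb{C}^2$, locally given by $\{\rho=0\}$ with $\rho$ real-analytic, real-valued and $d\rho\neq 0$, is called Levi-flat if its Levi form $L(\xi)=\sum_{k,j}\frac{\partial^2\rho}{\partial z_k\partial\bar z_j}\xi_k\bar\xi_j$ vanishes identically on the complex tangent space $T^c_qM=T_qM\cap iT_qM$ for every $q\in M$. A germ $(M,0)$ is Levi-nonflat if no neighborhood of $0$ in $M$ is Levi-flat. $H$ preserves the germ $(M,0)$ if it maps a neighborhood of $0$ in $M$ into $M$. ''A complex hypersurface through $0$'' is understood as a germ at $0$ of a complex hypersurface in $\mathbb{C}^2$. *)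

(* Defs.v *)
From HB Require Import structures.
From mathcomp Require Import all_boot all_order all_algebra finmap.
From mathcomp Require Import complex.
From mathcomp Require Import boolp classical_sets functions reals topology.
From mathcomp Require Import normedtype landau derive showcase.summability.

Set Implicit Arguments.
Unset Strict Implicit.
Unset Printing Implicit Defensive.

Import Order.TTheory GRing.Theory Num.Theory.
Import numFieldNormedType.Exports.

Local Open Scope classical_set_scope.
Local Open Scope ring_scope.
Local Open Scope complex_scope.

(* The library attaches its topology and norm to abstract numFieldTypes and to
   regular algebras only; this transfers them to the concrete R[i]. *)
HB.instance Definition _ (R : realType) := NormedModule.copy R[i] R[i]^o.

(* As a normed module over R[i], so that [differentiable] means
   complex-differentiable. *)
Notation C2 R := 'rV[R[i]]_2.

Section Holomorphic.
Variable R : realType.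

Definition holomorphic_near (W : normedModType R[i]) (f : C2 R -> W)
    (p : C2 R) : Prop :=
  \forall z \near p, differentiable f z.

Definition local_biholomorphism0 (H : C2 R -> C2 R) : Prop :=
  [/\ H 0 = 0, holomorphic_near H 0 &
      exists G : C2 R -> C2 R,
        [/\ holomorphic_near G 0,
            \forall z \near (0 : C2 R), G (H z) = z &
            \forall w \near (0 : C2 R), H (G w) = w]].

Definition tangent_to_identity0 (H : C2 R -> C2 R) : Prop :=
  (fun Z => H Z - Z) =O_ (nbhs (0 : C2 R)) (fun Z => `|Z| ^+ 2 : R[i]).

(* Hypersurfaces are nonsingular here, in the complex as in the real case. *)
Definition complex_hypersurface0 (X : set (C2 R)) : Prop :=
  exists g : C2 R -> R[i],
    [/\ holomorphic_near g 0, g 0 = 0,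
        exists v : C2 R, 'd g 0 v != 0 &
        \forall z \near (0 : C2 R), X z <-> g z = 0].

End Holomorphic.

Section RealAnalytic.
Variable R : realType.
Implicit Types (rho : C2 R -> R) (f : C2 R -> R[i]) (M : set (C2 R)).

(* Multi-exponents of the real and of the imaginary parts of z_1, z_2. *)
Definition real_exponent : Type :=
  ({ffun 'I_2 -> nat} * {ffun 'I_2 -> nat})%type.

Definition real_monomial (a : real_exponent) (h : C2 R) : R :=
  \prod_(k < 2) (complex.Re (h 0 k) ^+ a.1 k * complex.Im (h 0 k) ^+ a.2 k).

(* The power series converges unconditionally, hence absolutely. *)
Definition real_analytic_at rho (q : C2 R) : Prop :=
  exists c : real_exponent -> R,
    \forall h \near (0 : C2 R),
      partial_sum (fun a : real_exponent => c a * real_monomial a h) @ totally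
        --> rho (q + h).

Definition rderive rho (v q : C2 R) : R :=
  derive1 (fun t : R => rho (q + t%:C *: v)) 0.

Definition rderiveC f (v q : C2 R) : R[i] :=
  rderive (fun z => complex.Re (f z)) v q +i*
  rderive (fun z => complex.Im (f z)) v q.

Definition ebasis (k : 'I_2) : C2 R := delta_mx 0 k.

Definition dz (k : 'I_2) f (q : C2 R) : R[i] :=
  2^-1 * (rderiveC f (ebasis k) q - 'i * rderiveC f ('i *: ebasis k) q).

Definition dzbar (j : 'I_2) f (q : C2 R) : R[i] :=
  2^-1 * (rderiveC f (ebasis j) q + 'i * rderiveC f ('i *: ebasis j) q).

Definition levi_form rho (q xi : C2 R) : R[i] :=
  \sum_(k < 2) \sum_(j < 2)
    dz k (dzbar j (fun z => (rho z)%:C)) q * xi 0 k * (xi 0 j)^*.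

Definition local_defining_function rho M (q : C2 R) : Prop :=
  [/\ real_analytic_at rho q,
      exists v : C2 R, rderive rho v q != 0 &
      \forall z \near q, M z <-> rho z = 0].

Definition real_analytic_hypersurface M : Prop :=
  forall q, M q -> exists rho, local_defining_function rho M q.

(* T_q M, when rho is a local defining function of M at q. *)
Definition tangent_space rho (q : C2 R) : set (C2 R) :=
  [set v | rderive rho v q = 0].

Definition complex_tangent_space rho (q : C2 R) : set (C2 R) :=
  tangent_space rho q `&` [set 'i *: v | v in tangent_space rho q].

(* Whether the Levi form vanishes on T^c_q M does not depend on rho. *)
Definition levi_flat M : Prop :=
  forall q, M q -> forall rho, local_defining_function rho M q ->
  forall xi, complex_tangent_space rho q xi -> levi_form rho q xi = 0.

Definition levi_nonflat0 M : Prop :=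
  ~ exists V : set (C2 R), open_nbhs (0 : C2 R) V /\ levi_flat (M `&` V).

Definition preserves_germ0 (H : C2 R -> C2 R) M : Prop :=
  \forall z \near (0 : C2 R), M z -> M (H z).

End RealAnalytic.

(* Main.v *)
Require Import Defs.
From HB Require Import structures.
From mathcomp Require Import all_boot all_order all_algebra finmap.
From mathcomp Require Import complex ring lra constructive_ereal.
From mathcomp Require Import boolp classical_sets functions reals topology.
From mathcomp Require Import normedtype landau derive showcase.summability.
From mathcomp Require Import ereal measure lebesgue_measure lebesgue_integral ftc.
Import Order.TTheory GRing.Theory Num.Theory.
Import numFieldNormedType.Exports.

(**
  Let rho = 0 define M near 0 and let P(z, zeta) be the complexification of rho: it is
  holomorphic on C^2 x C^2 near 0, P(z, conj z) = rho(z), and the conjugate of P(z, zeta) is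
  P(conj zeta, conj z). The hypersurface fixed by H is the Segre variety of the origin,
  X = {z | P(z, 0) = 0}. It is smooth because a nonzero real covector has a nonzero
  complex-linear part (lemma linear_part_neq0).

  Why H fixes X. Since H maps M into M, and the points (z, conj z) with z in M form a totally
  real submanifold of maximal dimension of the complex hypersurface P = 0, the identity
  principle shows that (z, zeta) |-> (H(z), conj H(conj zeta)) preserves P = 0
  (complexified_invariance). So H maps Segre varieties {z | P(z, zeta) = 0} to Segre varieties.
  By the implicit function theorem the Segre varieties are graphs over the first coordinate.
  A change of the second coordinate makes them the graphs z |-> Q(z, x, t) of a family that is
  normalized by Q(0, x, t) = t = Q(z, 0, t); the graph with parameters x = t = 0 is X. In these
  coordinates H = (F, G) and its action (k, l) on the parameters are tangent to the identity
  and satisfy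

    G(z, Q(z, x, t)) = Q(F(z, Q(z, x, t)), k(x, t), l(x, t)).                            (E)

  If Q(z, x, t) = t identically, the Segre varieties are the level sets of one holomorphic
  function u (fixed_or_foliated), and M is a union of such level sets. A holomorphic curve
  gamma inside a real hypersurface kills the Levi form at each of its points: with P now the
  complexification at that point, P(gamma(s), conj gamma(conj e)) vanishes for e = conj s,
  hence identically, and its mixed derivative at s = e = 0 is the Levi form on gamma'(0), which
  spans the complex tangent line (levi_null_of_curve). So M would be Levi-flat near 0.

  Otherwise, expand in lowest order, first in t and then in x:

    Q(z, x, t) - t = t^m (c(z, x) + O(t)),   c(z, x) = x^b (q(z) + O(x)),

  with q not identically zero; the normalization forces q(0) = 0 and b > 0. Put x = e and
  t = e^(b+1) in (E), and compare with the same equation for x = 0 and for z = 0: after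
  division by t^m x^b the limit e -> 0 is q(F(z, 0)) = q(z) (normalized_core). A germ tangent
  to the identity that preserves a nonconstant function is the identity (fixed_of_invariant),
  so F(z, 0) = z. The equation (E) at x = t = 0 gives G(z, 0) = 0. So H fixes every point of X.

  The holomorphic functions of several variables that this requires are built from the complex
  derivative up: Goursat's theorem on rectangles, Cauchy's formula on a square, and from it a
  Taylor expansion in one variable with an explicit remainder (taylor). Restriction to complex
  lines transfers these estimates to functions on any normed space; they give Weierstrass'
  theorem on uniform limits (hol_lim), from which follow the holomorphy of derivatives
  (bhol_dir), the expansion in one of the variables (lowest_order), the implicit function
  theorem (implicit_function) and the complexification of rho (complexification).
*)

Set Implicit Arguments.
Unset Strict Implicit.
Unset Printing Implicit Defensive.
Local Open Scope classical_set_scope.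
Local Open Scope ring_scope.
Local Open Scope complex_scope.

(** * Real-valued norms *)

Section RealNorm.
Variable R : realType.
Local Notation C := (R[i]).

Lemma le_of_eq (x y : R) : x = y -> x <= y.
Proof. by move=> ->. Qed.

(** The norm of a complex normed module has complex values. Its real part is the same
    number in R, where order and linear arithmetic are available. *)
Definition N (V : normedModType C) (v : V) : R := complex.Re `|v|.

Section Any.
Variable V : normedModType C.
Implicit Types u v w : V.

Lemma normE v : `|v| = (N v)%:C.
Proof. by rewrite /N RRe_real // ger0_real. Qed.

Lemma N_ge0 v : 0 <= N v.
Proof. by rewrite -lecR -normE normr_ge0. Qed.

Lemma N0 : N (0 : V) = 0.
Proof. by rewrite /N normr0. Qed.

Lemma N_eq0 v : N v = 0 -> v = 0.
Proof. by move=> h; apply/eqP; rewrite -normr_eq0 normE h. Qed.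

Lemma N_le0 v : N v <= 0 -> v = 0.
Proof. by move=> v0; apply/N_eq0/le_anti; rewrite v0 N_ge0. Qed.

Lemma N_sub_le0 u v : N (u - v) <= 0 -> u = v.
Proof. by move/N_le0/subr0_eq. Qed.

Lemma N_gt0 v : v != 0 -> 0 < N v.
Proof.
move=> v0; rewrite lt_neqAle N_ge0 andbT; apply/eqP => /esym/N_eq0 e.
by rewrite e eqxx in v0.
Qed.

Lemma ND u v : N (u + v) <= N u + N v.
Proof.
by rewrite -lecR rmorphD /= -!normE; exact: ler_normD.
Qed.

Lemma NN v : N (- v) = N v.
Proof. by rewrite /N normrN. Qed.

Lemma NB u v : N (u - v) <= N u + N v.
Proof. by rewrite -(NN v) ND. Qed.

Lemma NBC u v : N (u - v) = N (v - u).
Proof. by rewrite -NN opprB. Qed.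

Lemma NB3 w u v : N (u - v) <= N (u - w) + N (w - v).
Proof. by rewrite (le_trans _ (ND _ _)) // addrA subrK. Qed.

Lemma NleD u v : N u <= N (u - v) + N v.
Proof. by rewrite (le_trans _ (ND _ _)) // subrK. Qed.

Lemma NZ (a : C) v : N (a *: v) = N a * N v.
Proof.
apply: complexI; rewrite rmorphM -[RHS]/((N a)%:C * (N v)%:C).
by rewrite -!normE normrZ.
Qed.

Lemma Nsum (I : Type) (r : seq I) (P : pred I) (F : I -> V) :
  N (\sum_(i <- r | P i) F i) <= \sum_(i <- r | P i) N (F i).
Proof.
elim/big_ind2 : _ => [|x a y b xa yb|//]; first by rewrite N0.
by rewrite (le_trans (ND _ _)) // lerD.
Qed.

End Any.

Implicit Types a b z : C.

Lemma NM a b : N (a * b) = N a * N b.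
Proof. exact: (NZ a b). Qed.

Lemma NC (x : R) : N (x%:C : C) = `|x|.
Proof. by rewrite /N normc_def /= expr0n addr0 sqrtr_sqr. Qed.

Lemma N1 : N (1 : C) = 1.
Proof. by rewrite -[1 : C]/((1 : R)%:C) NC normr1. Qed.

Lemma Ni : N ('i%C : C) = 1.
Proof. by rewrite /N normc_def /= expr0n add0r expr1n sqrtr1. Qed.

Lemma i_neq0 : 'i%C != 0 :> C.
Proof. by rewrite -normr_eq0 normE Ni oner_eq0. Qed.

Lemma mul_ii : 'i%C * 'i%C = -1 :> C.
Proof. by rewrite -expr2 sqr_i. Qed.

Lemma conj_i : conjc ('i%C : C) = - 'i%C.
Proof. by apply/eqP; rewrite eq_complex /= oppr0 !eqxx. Qed.

Lemma NX a n : N (a ^+ n) = N a ^+ n.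
Proof. by elim: n => [|n ih]; rewrite ?expr0 ?N1 // !exprS NM ih. Qed.

Lemma NV a : N (a^-1) = (N a)^-1.
Proof.
have [->|a0] := eqVneq a 0; first by rewrite invr0 N0 invr0.
have Na : N a != 0 by rewrite gt_eqF // N_gt0.
by apply: (mulfI Na); rewrite -NM !divff // N1.
Qed.

Lemma Nconj a : N (a^*) = N a.
Proof. by rewrite /N !normc_def; case: a => x y /=; rewrite sqrrN. Qed.

Lemma Nsqr a : N a ^+ 2 = complex.Re a ^+ 2 + complex.Im a ^+ 2.
Proof. by rewrite /N normc_def /= sqr_sqrtr // addr_ge0 // sqr_ge0. Qed.

Lemma Re_le_N a : `|complex.Re a| <= N a.
Proof.
rewrite -ler_sqr ?nnegrE ?N_ge0 // Nsqr -normrX ger0_norm ?sqr_ge0 //.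
by rewrite lerDl sqr_ge0.
Qed.

Lemma Im_le_N a : `|complex.Im a| <= N a.
Proof.
rewrite -ler_sqr ?nnegrE ?N_ge0 // Nsqr -normrX ger0_norm ?sqr_ge0 //.
by rewrite lerDr sqr_ge0.
Qed.

Lemma N_le_ReIm a : N a <= `|complex.Re a| + `|complex.Im a|.
Proof.
rewrite -ler_sqr ?nnegrE ?N_ge0 ?addr_ge0 // Nsqr.
rewrite -(real_normK (num_real (complex.Re a))) -(real_normK (num_real (complex.Im a))).
by rewrite sqrrD addrAC lerDl mulrn_wge0 // mulr_ge0.
Qed.

Section Pair.
Variables V W : normedModType C.
Implicit Types p : (V * W)%type.

Lemma Npair (v : V) (w : W) : N ((v, w) : (V * W)%type) = Num.max (N v) (N w).
Proof.
have e (p : ((V * W)%type : normedModType C)) : `|p| = Num.max `|p.1| `|p.2|.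
  by [].
by apply: complexI; rewrite -normE e !normE /= /Order.max ltcR; case: ifP.
Qed.

Lemma Nfst p : N p.1 <= N p.
Proof. by case: p => v w; rewrite Npair le_max lexx. Qed.

Lemma Nsnd p : N p.2 <= N p.
Proof. by case: p => v w; rewrite Npair le_max lexx orbT. Qed.

Lemma Npair_le (v : V) (w : W) r : N v <= r -> N w <= r ->
  N ((v, w) : (V * W)%type) <= r.
Proof. by move=> a b; rewrite Npair ge_max a b. Qed.

Lemma Npair_lt (v : V) (w : W) r : N v < r -> N w < r ->
  N ((v, w) : (V * W)%type) < r.
Proof. by move=> a b; rewrite Npair gt_max a b. Qed.

End Pair.

Lemma nearE (V : normedModType C) (x : V) (P : set V) :
  (\forall y \near x, P y) <-> exists2 r : R, 0 < r & forall h, N h < r -> P (x + h).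
Proof.
split.
  move/nbhs_normP => [r /= r0 rP].
  have rr : r = (complex.Re r)%:C by rewrite RRe_real // gtr0_real.
  exists (complex.Re r); first by rewrite -ltcR -rr.
  move=> h hr; apply: rP; rewrite /= opprD addNKr normrN normE rr ltcR //.
move=> [r r0 rP]; apply/nbhs_normP; exists r%:C; first by rewrite /= ltcR.
move=> y /=; rewrite distrC normE ltcR => yr.
by have := rP _ yr; rewrite addrC subrK.
Qed.

Lemma near0E (V : normedModType C) (P : set V) :
  (\forall y \near (0 : V), P y) <-> exists2 r : R, 0 < r & forall h, N h < r -> P h.
Proof.
by rewrite nearE; split=> -[r r0 rP]; exists r => // h /rP; rewrite add0r.
Qed.

End RealNorm.

(** * Complex derivatives *)

Section Hol.
Variable R : realType.
Local Notation C := (R[i]).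

(** The linear map is required to be bounded because V may have infinite dimension. *)
Definition is_der (V W : normedModType C) (f : V -> W) (x : V) (L : V -> W) :=
  [/\ forall (a : C) u v, L (a *: u + v) = a *: L u + L v,
      exists2 K : R, 0 <= K & forall v, N (L v) <= K * N v &
      forall e : R, 0 < e -> exists2 d : R, 0 < d & forall h, N h < d ->
        N (f (x + h) - f x - L h) <= e * N h].

Definition hol (V W : normedModType C) (f : V -> W) (x : V) :=
  exists L, is_der f x L.

Section Linear.
Variables (V W : normedModType C) (L : V -> W).
Hypothesis lin : forall (a : C) u v, L (a *: u + v) = a *: L u + L v.

Lemma lin0 : L 0 = 0.
Proof. by have := lin (-1) 0 0; rewrite addr0 scaler0 scaleN1r addNr. Qed.

Lemma linD u v : L (u + v) = L u + L v.
Proof. by have := lin 1 u v; rewrite !scale1r. Qed.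

Lemma linZ a u : L (a *: u) = a *: L u.
Proof. by have := lin a u 0; rewrite lin0 !addr0. Qed.

Lemma linB u v : L (u - v) = L u - L v.
Proof. by rewrite -scaleN1r linD linZ scaleN1r. Qed.

Lemma lin_is_der x K : (forall v, N (L v) <= K * N v) -> is_der L x L.
Proof.
move=> LK; split=> //.
  exists (Num.max 0 K); first by rewrite le_max lexx.
  move=> v; rewrite (le_trans (LK v)) // ler_wpM2r ?N_ge0 //.
  by rewrite le_max lexx orbT.
move=> e e0; exists 1 => // h _.
by rewrite linD (addrC (L x)) addrK subrr N0 mulr_ge0 ?N_ge0 // ltW.
Qed.

End Linear.

Section Basic.
Variables V W U : normedModType C.
Implicit Types (f g : V -> W) (x : V).

Lemma is_der_cst (c : W) x : is_der (fun=> c) x (fun=> 0).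
Proof.
split=> [a u v||e e0]; first by rewrite scaler0 addr0.
  by exists 0 => // v; rewrite N0 mul0r.
by exists 1 => // h _; rewrite !subrr N0 mulr_ge0 ?N_ge0 // ltW.
Qed.

Lemma hol_cst (c : W) x : hol (fun=> c) x.
Proof. by eexists; exact: is_der_cst. Qed.

Lemma is_der_bound f x L : is_der f x L ->
  exists2 K : R, 0 < K & exists2 d : R, 0 < d & forall h, N h < d ->
    N (f (x + h) - f x) <= K * N h.
Proof.
case=> _ [K K0 LK] /(_ 1 ltr01) [d d0 dP].
exists (K + 1); first by rewrite ltr_wpDl.
exists d => // h /dP; rewrite mul1r => hP.
rewrite (le_trans (NleD _ (L h))) // mulrDl mul1r addrC.
by rewrite lerD.
Qed.

Lemma hol_cont f x : hol f x ->
  forall e : R, 0 < e -> exists2 d : R, 0 < d & forall h, N h < d -> N (f (x + h) - f x) < e.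
Proof.
case=> L /is_der_bound[K K0 [d d0 dP]] e e0.
exists (Num.min d (e / K)); first by rewrite lt_min d0 divr_gt0.
move=> h; rewrite lt_min => /andP[hd he].
by rewrite (le_lt_trans (dP _ hd)) // mulrC -ltr_pdivlMr.
Qed.

(** Compare both linear maps on a small real multiple of a given vector. *)
Lemma is_der_uniq f x L L' : is_der f x L -> is_der f x L' -> L =1 L'.
Proof.
move=> [l1 _ d1] [l2 _ d2] h.
apply/eqP; rewrite -subr_eq0; apply/eqP/N_eq0/eqP.
rewrite eq_le N_ge0 andbT; apply/ler_addgt0Pr => e e0; rewrite add0r.
have [h0|h0] := eqVneq h 0.
  by rewrite h0 (lin0 l1) (lin0 l2) subrr N0 ltW.
have Nh := N_gt0 h0.
pose e' := e / (2 * N h).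
have e'0 : 0 < e' by rewrite divr_gt0 // mulr_gt0.
have [a a0 aP] := d1 _ e'0; have [b b0 bP] := d2 _ e'0.
pose t := Num.min a b / (2 * N h).
have t0 : 0 < t by rewrite divr_gt0 ?mulr_gt0 // lt_min a0.
have Nt : N (t%:C *: h) = t * N h by rewrite NZ NC gtr0_norm.
have th : N (t%:C *: h) = Num.min a b / 2.
  by rewrite Nt /t; field; rewrite gt_eqF.
have ab : 0 < Num.min a b by rewrite lt_min a0.
have ta : N (t%:C *: h) < a.
  rewrite th (lt_le_trans _ (_ : Num.min a b <= a)) ?ge_min ?lexx //; lra.
have tb : N (t%:C *: h) < b.
  rewrite th (lt_le_trans _ (_ : Num.min a b <= b)) ?ge_min ?lexx ?orbT //; lra.
have {aP} A := aP _ ta; have {bP} B := bP _ tb.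
have : N (L (t%:C *: h) - L' (t%:C *: h)) <= 2 * (e' * N (t%:C *: h)).
  rewrite (le_trans (NB3 (f (x + t%:C *: h) - f x) _ _)) // mulrDl !mul1r.
  by rewrite lerD // NBC.
rewrite Nt (linZ l1) (linZ l2) -scalerBr NZ NC gtr0_norm // => H.
rewrite -(ler_pM2l t0) (le_trans H) // /e'.
by apply: le_of_eq; field; rewrite gt_eqF.
Qed.

Lemma is_der_near f g x L : (\forall y \near x, f y = g y) ->
  is_der f x L -> is_der g x L.
Proof.
move=> fg [l1 b1 d1]; split=> // e /d1[d d0 dP].
have [r r0 rP] := (nearE _ _).1 fg.
exists (Num.min d r); first by rewrite lt_min d0.
move=> h; rewrite lt_min => /andP[hd hr].
have := rP 0; rewrite N0 addr0 => <- //.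
by rewrite -rP // dP.
Qed.

Lemma hol_near f g x : (\forall y \near x, f y = g y) -> hol f x -> hol g x.
Proof. by move=> fg [L /(is_der_near fg) ?]; exists L. Qed.

Lemma is_derD f g x L M : is_der f x L -> is_der g x M ->
  is_der (fun y => f y + g y) x (fun h => L h + M h).
Proof.
move=> [l1 [K1 K10 b1] d1] [l2 [K2 K20 b2] d2]; split.
- by move=> a u v; rewrite l1 l2 scalerDr addrACA.
- exists (K1 + K2); first exact: addr_ge0.
  by move=> v; rewrite (le_trans (ND _ _)) // mulrDl lerD.
move=> e e0; have e2 : 0 < e / 2 by rewrite divr_gt0.
have [a a0 aP] := d1 _ e2; have [b b0 bP] := d2 _ e2.
exists (Num.min a b); first by rewrite lt_min a0.
move=> h; rewrite lt_min => /andP[/aP ha /bP hb].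
rewrite (_ : _ - _ = (f (x + h) - f x - L h) + (g (x + h) - g x - M h)).
  rewrite (le_trans (ND _ _)) // (splitr e) mulrDl lerD //.
rewrite !opprD [RHS]addrACA; congr (_ + _); exact: addrACA.
Qed.

End Basic.

Lemma is_der_comp (V W U : normedModType C) (f : V -> W) (g : W -> U) x L M :
  is_der f x L -> is_der g (f x) M -> is_der (fun y => g (f y)) x (fun h => M (L h)).
Proof.
move=> fL [l2 [K2 K20 b2] d2].
have [K K0 [d d0 dP]] := is_der_bound fL.
case: fL => l1 [K1 K10 b1] d1; split.
- by move=> a u v; rewrite l1 l2.
- exists (K2 * K1); first exact: mulr_ge0.
  by move=> v; rewrite (le_trans (b2 _)) // -mulrA ler_wpM2l.
move=> e e0.
have e20 : 0 < e / (2 * K) by rewrite divr_gt0 // mulr_gt0.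
have e10 : 0 < e / (2 * (K2 + 1)) by rewrite divr_gt0 // mulr_gt0 // ltr_wpDl.
have [a a0 aP] := d2 _ e20; have [b b0 bP] := d1 _ e10.
exists (Num.min d (Num.min b (a / K))); first by rewrite !lt_min d0 b0 divr_gt0.
move=> h; rewrite !lt_min => /andP[hd /andP[hb ha]].
set k := f (x + h) - f x.
have Nk : N k <= K * N h by exact: dP.
have ka : N k < a by rewrite (le_lt_trans Nk) // mulrC -ltr_pdivlMr.
have -> : g (f (x + h)) = g (f x + k) by rewrite /k [f x + _]addrC subrK.
have kL : N (k - L h) <= e / (2 * (K2 + 1)) * N h by exact: bP.
clearbody k.
rewrite (_ : _ - _ = (g (f x + k) - g (f x) - M k) + M (k - L h)); last first.
  by rewrite (linB l2) addrA subrK.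
rewrite (le_trans (ND _ _)) // [leRHS](_ : _ = e / (2 * K) * (K * N h) +
   (K2 + 1) * (e / (2 * (K2 + 1)) * N h)); last first.
  by field; rewrite !gt_eqF // ltr_wpDl.
rewrite lerD //.
  by rewrite (le_trans (aP _ ka)) // ler_wpM2l // ltW.
by rewrite (le_trans (b2 _)) // ler_pM ?N_ge0 ?lerDl.
Qed.

Lemma hol_comp (V W U : normedModType C) (f : V -> W) (g : W -> U) x :
  hol f x -> hol g (f x) -> hol (fun y => g (f y)) x.
Proof. by move=> [L fL] [M gM]; eexists; exact: is_der_comp fL gM. Qed.

Lemma is_der_pair (V W U : normedModType C) (f : V -> W) (g : V -> U) x L M :
  is_der f x L -> is_der g x M ->
  is_der (fun y => (f y, g y) : (W * U)%type) x (fun h => (L h, M h)).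
Proof.
move=> [l1 [K1 K10 b1] d1] [l2 [K2 K20 b2] d2]; split.
- by move=> a u v; rewrite l1 l2.
- exists (K1 + K2); first exact: addr_ge0.
  move=> v; rewrite Npair_le //.
    by rewrite (le_trans (b1 _)) // ler_wpM2r ?N_ge0 // lerDl.
  by rewrite (le_trans (b2 _)) // ler_wpM2r ?N_ge0 // lerDr.
move=> e e0; have [a a0 aP] := d1 _ e0; have [b b0 bP] := d2 _ e0.
exists (Num.min a b); first by rewrite lt_min a0.
by move=> h; rewrite lt_min => /andP[/aP ha /bP hb]; exact: Npair_le.
Qed.

Lemma hol_pair (V W U : normedModType C) (f : V -> W) (g : V -> U) x :
  hol f x -> hol g x -> hol (fun y => (f y, g y) : (W * U)%type) x.
Proof. by move=> [L fL] [M gM]; eexists; exact: is_der_pair fL gM. Qed.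

Lemma is_der_id (V : normedModType C) (x : V) : is_der id x id.
Proof. by apply: (@lin_is_der _ _ _ _ x 1) => // v; rewrite mul1r. Qed.

Lemma hol_id (V : normedModType C) (x : V) : hol id x.
Proof. by eexists; exact: is_der_id. Qed.

Lemma is_der_fst (V W : normedModType C) (x : V * W) : is_der fst x fst.
Proof. by apply: (@lin_is_der _ _ _ _ x 1) => // v; rewrite mul1r Nfst. Qed.

Lemma is_der_snd (V W : normedModType C) (x : V * W) : is_der snd x snd.
Proof. by apply: (@lin_is_der _ _ _ _ x 1) => // v; rewrite mul1r Nsnd. Qed.

Lemma hol_fst (V W U : normedModType C) (f : V -> (W * U)%type) x :
  hol f x -> hol (fun y => (f y).1) x.
Proof. by move=> fx; apply: (hol_comp fx); eexists; exact: is_der_fst. Qed.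

Lemma hol_snd (V W U : normedModType C) (f : V -> (W * U)%type) x :
  hol f x -> hol (fun y => (f y).2) x.
Proof. by move=> fx; apply: (hol_comp fx); eexists; exact: is_der_snd. Qed.

Lemma holD (V W : normedModType C) (f g : V -> W) x :
  hol f x -> hol g x -> hol (fun y => f y + g y) x.
Proof. by move=> [L fL] [M gM]; eexists; exact: is_derD fL gM. Qed.

Lemma is_derZ (V W : normedModType C) (a : C) (f : V -> W) x L :
  is_der f x L -> is_der (fun y => a *: f y) x (fun h => a *: L h).
Proof.
move=> fL; apply: (is_der_comp fL (g := fun y => a *: y)).
apply: (@lin_is_der _ _ (fun y => a *: y) _ _ (N a)) => [b u v|v].
  by rewrite scalerDr !scalerA mulrC.
by rewrite NZ.
Qed.

Lemma holZ (V W : normedModType C) (a : C) (f : V -> W) x :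
  hol f x -> hol (fun y => a *: f y) x.
Proof. by move=> [L fL]; eexists; exact: is_derZ fL. Qed.

Lemma holN (V W : normedModType C) (f : V -> W) x :
  hol f x -> hol (fun y => - f y) x.
Proof.
move=> /(holZ (-1)); congr hol; apply/funext => y; exact: scaleN1r.
Qed.

Lemma holB (V W : normedModType C) (f g : V -> W) x :
  hol f x -> hol g x -> hol (fun y => f y - g y) x.
Proof. by move=> fx /holN; exact: holD. Qed.

(** Products are differentiated as compositions with this bilinear map. *)
Lemma is_der_scale_id (V : normedModType C) (p : (C * V)%type) :
  is_der (fun q : (C * V)%type => q.1 *: q.2) p
         (fun h => h.1 *: p.2 + p.1 *: h.2).
Proof.
split.
- move=> a [u1 u2] [v1 v2] /=.
  rewrite scalerDl !scalerDr !scalerA (mulrC a p.1) addrACA; congr (_ + _).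
- exists (N p.2 + N p.1); first by rewrite addr_ge0 ?N_ge0.
  move=> v; rewrite (le_trans (ND _ _)) // mulrDl !NZ lerD //.
    by rewrite mulrC ler_wpM2l ?N_ge0 ?Nfst.
  by rewrite ler_wpM2l ?N_ge0 ?Nsnd.
move=> e e0; exists e => // h he.
rewrite (_ : _ - _ = h.1 *: h.2); last first.
  rewrite /= scalerDl !scalerDr -[_ + _ + (_ + _)]addrA [p.1 *: p.2 + _]addrC.
  rewrite addrK (addrA (p.1 *: h.2)) (addrC (p.1 *: h.2) (h.1 *: p.2)).
  by rewrite [_ + _ + h.1 *: h.2]addrC addrK.
rewrite NZ (le_trans (ler_pM (N_ge0 _) (N_ge0 _) (Nfst _) (Nsnd _))) //.
by rewrite ler_wpM2r ?N_ge0 // ltW.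
Qed.

Lemma holM (V : normedModType C) (f g : V -> C) x :
  hol f x -> hol g x -> hol (fun y => f y * g y) x.
Proof.
move=> fx gx; apply: (hol_comp (hol_pair fx gx) (g := fun q : C * C => q.1 *: q.2)).
by eexists; exact: is_der_scale_id.
Qed.

Lemma is_derV (a : C) : a != 0 -> is_der (fun z : C => z^-1) a (fun h => h * (- a ^- 2)).
Proof.
move=> a0; have Na := N_gt0 a0; split.
- by move=> c u v; rewrite -[c *: u]/(c * u) -[RHS]/(c * (u * - a ^- 2) + v * - a ^- 2); ring.
- by exists (N (- a ^- 2)) => [|v]; rewrite ?N_ge0 // NM mulrC.
move=> e e0; pose d := Num.min (N a / 2) (e * (N a ^+ 3 / 2)).
have d0 : 0 < d by rewrite lt_min divr_gt0 // mulr_gt0 // divr_gt0 // exprn_gt0.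
exists d => // h; rewrite lt_min => /andP[h1 h2].
have Nah : N a / 2 <= N (a + h).
  have := NleD a (- h); rewrite opprK NN; lra.
have ah0 : a + h != 0.
  by apply/eqP => ah0; move: Nah; rewrite ah0 N0; lra.
rewrite (_ : _ - _ = h ^+ 2 / ((a + h) * a ^+ 2)); last by field; rewrite a0 ah0.
have key : N h <= e * (N (a + h) * N a ^+ 2).
  rewrite (le_trans (ltW h2)) // (ler_wpM2l (ltW e0)) //.
  rewrite [leLHS](_ : _ = N a / 2 * N a ^+ 2); last by field.
  by apply: ler_wpM2r Nah; rewrite exprn_ge0 // N_ge0.
rewrite NM NX NV NM NX ler_pdivrMr; last first.
  by rewrite mulr_gt0 ?exprn_gt0 // (lt_le_trans _ Nah) ?divr_gt0.
by rewrite expr2 [leRHS]mulrAC ler_wpM2r ?N_ge0.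
Qed.

Lemma holV (V : normedModType C) (f : V -> C) x :
  hol f x -> f x != 0 -> hol (fun y => (f y)^-1) x.
Proof. by move=> fx f0; apply: (hol_comp fx); eexists; exact: is_derV. Qed.

Lemma holX (V : normedModType C) (f : V -> C) n x :
  hol f x -> hol (fun y => f y ^+ n) x.
Proof.
move=> fx; elim: n => [|n ih].
  by under eq_fun do rewrite expr0; exact: hol_cst.
by under eq_fun do rewrite exprS; exact: holM.
Qed.

Lemma hol_sum (V W : normedModType C) (I : Type) (r : seq I) (f : I -> V -> W) x :
  (forall i, hol (f i) x) -> hol (fun y => \sum_(i <- r) f i y) x.
Proof.
move=> fx; elim: r => [|i r ih].
  by under eq_fun do rewrite big_nil; exact: hol_cst.
by under eq_fun do rewrite big_cons; exact: holD.
Qed.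

Lemma hol_prod (V : normedModType C) (I : Type) (r : seq I) (f : I -> V -> C) x :
  (forall i, hol (f i) x) -> hol (fun y => \prod_(i <- r) f i y) x.
Proof.
move=> fx; elim: r => [|i r ih].
  by under eq_fun do rewrite big_nil; exact: hol_cst.
by under eq_fun do rewrite big_cons; exact: holM.
Qed.

Lemma is_der_line (V W : normedModType C) (f : V -> W) (x v : V) (s : C) L :
  is_der f (x + s *: v) L -> is_der (fun t : C => f (x + t *: v)) s (fun h => h *: L v).
Proof.
move=> fL; have := fL; case=> l1 _ _.
rewrite (_ : (fun h => h *: L v) = fun h => L (h *: v)); last first.
  by apply/funext => h; rewrite (linZ l1).
apply: (is_der_comp (f := fun t : C => x + t *: v) (L := fun h => h *: v)) => //.
rewrite (_ : (fun h => h *: v) = fun h => 0 + h *: v); last first.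
  by apply/funext => h; rewrite add0r.
apply: is_derD; first exact: is_der_cst.
apply: (@lin_is_der _ _ (fun t : C => t *: v) _ _ (N v)) => [a s1 s2|s1].
  by rewrite scalerDl scalerA.
by rewrite NZ mulrC.
Qed.

Lemma hol_line (V W : normedModType C) (f : V -> W) (x v : V) (s : C) :
  hol f (x + s *: v) -> hol (fun t : C => f (x + t *: v)) s.
Proof. by move=> [L /is_der_line ?]; eexists; eauto. Qed.

Lemma hol1_der (f : C -> C) a : hol f a -> exists d, is_der f a (fun h => h * d).
Proof.
move=> [L fL]; exists (L 1); suff <- : L = (fun h => h * L 1) by [].
case: fL => l1 _ _; apply/funext => h.
by rewrite -{1}[h]mulr1 -[h * 1]/(h *: (1 : C)) (linZ l1).
Qed.

(** The antilinear maps on the source and on the target compensate each other, so the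
    derivative stays complex-linear. With d the conjugation of C and c a conjugation of V this
    gives the reflected function. *)
Lemma is_der_conj (V W : normedModType C) (c : V -> V) (d : W -> W) (f : V -> W) x L :
  (forall u v, c (u + v) = c u + c v) -> (forall (a : C) v, c (a *: v) = conjc a *: c v) ->
  (forall v, N (c v) = N v) ->
  (forall u v, d (u + v) = d u + d v) -> (forall (a : C) v, d (a *: v) = conjc a *: d v) ->
  (forall v, N (d v) = N v) ->
  is_der f (c x) L -> is_der (fun y => d (f (c y))) x (fun h => d (L (c h))).
Proof.
move=> cD cZ cN dD dZ dN [l1 [K K0 b1] d1]; split.
- by move=> a u v; rewrite cD cZ l1 dD dZ conjcK.
- by exists K => // v; rewrite dN (le_trans (b1 _)) // cN.
have dB u v : d (u - v) = d u - d v by rewrite dD -scaleN1r dZ rmorphN rmorph1 scaleN1r.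
by move=> e /d1[r r0 rP]; exists r => // h hr; rewrite -!dB dN cD -[N h]cN rP // cN.
Qed.

Lemma near_hol0 (V W : normedModType C) (f : V -> W) :
  (\forall p \near (0 : V), hol f p) -> hol f 0.
Proof. by move=> /near0E[d d0 dP]; apply: dP; rewrite N0. Qed.

End Hol.

(** * Integrals of complex functions on a segment *)

Section Primitive.
Variable R : realType.
Local Notation C := (R[i]).

Definition rcont (f : R -> C) (x : R) := forall e : R, 0 < e ->
  exists2 d : R, 0 < d & forall h, `|h| < d -> N (f (x + h) - f x) < e.

Definition rder (F : R -> C) (x : R) (l : C) := forall e : R, 0 < e ->
  exists2 d : R, 0 < d & forall h, `|h| < d -> N (F (x + h) - F x - h%:C * l) <= e * `|h|.

Lemma real_is_derive (f : R -> R) (x l : R) :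
  (forall e : R, 0 < e -> exists2 d : R, 0 < d &
     forall h, `|h| < d -> `|f (x + h) - f x - h * l| <= e * `|h|) ->
  is_derive x 1 f l.
Proof.
move=> fl; suff H : h^-1 *: ((f \o shift x) (h *: 1) - f x) @[h --> 0^'] --> l.
  split; first by apply/cvg_ex; exists l.
  by apply/cvg_lim; [exact: Rhausdorff|exact: H].
apply/cvgrPdist_le => e e0; have [d d0 dP] := fl _ e0.
near=> h.
have h0 : h != 0 by near: h; exact: nbhs_dnbhs_neq.
have hd : `|h| < d by near: h; apply: dnbhs0_lt.
have := dP _ hd; rewrite /= [h *: 1]mulr1 [h + x]addrC => H.
rewrite distrC -[X in _ - X](mulKf h0) -[_ *: _]/(h^-1 * _) -mulrBr normrM normfV.
by rewrite ler_pdivrMl ?normr_gt0 // [leRHS]mulrC.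
Unshelve. all: by end_near. Qed.

Lemma is_derive_real (f : R -> R) (x l : R) : is_derive x 1 f l ->
  forall e : R, 0 < e -> exists2 d : R, 0 < d &
     forall h, `|h| < d -> `|f (x + h) - f x - h * l| <= e * `|h|.
Proof.
move=> [fx fl] e e0.
have H : h^-1 *: ((f \o shift x) (h *: 1) - f x) @[h --> 0^'] --> l.
  by rewrite -fl; exact: fx.
move/cvgrPdist_le : H => /(_ e e0) /nbhs_normP[d /= d0 dP].
exists d => // h hd; have [->|h0] := eqVneq h 0.
  by rewrite addr0 subrr mul0r subrr normr0 mulr0.
have := dP h; rewrite /= sub0r normrN => /(_ hd h0).
rewrite [h *: 1]mulr1 [h + x]addrC distrC -[X in _ - X](mulKf h0).
rewrite -[_ *: _]/(h^-1 * _) -mulrBr normrM normfV.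
by rewrite ler_pdivrMl ?normr_gt0 // [_ * e]mulrC.
Qed.

(** The only place where the Lebesgue integral enters: all later integrals are increments of
    antiderivatives. *)
Lemma antiderivative_real (f : R -> R) (a b : R) : a <= b -> continuous f ->
  exists F : R -> R, forall x, a <= x <= b -> is_derive x 1 F (f x).
Proof.
move=> ab cf; pose mu := @lebesgue_measure R.
(* the fundamental theorem of calculus is used at interior points: enlarge [a, b] by 1 *)
exists (fun x => (\int[mu]_(t in `[(a - 1)%R, x]) f t)%R) => x /andP[ax xb].
have xu : x < b + 1 by rewrite (le_lt_trans xb) // ltrDl.
have int : mu.-integrable `[a - 1, b + 1] (EFin \o f).
  apply: continuous_compact_integrable; first exact: segment_compact.
  exact: continuous_subspaceT.
have a1x : a - 1 < x by rewrite (lt_le_trans _ ax) // ltrBlDr ltrDl.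
have [] := continuous_FTC1_closed xu int a1x (cf x).
move=> D DE; rewrite -DE derive1E; exact: derivableP.
Qed.

Lemma rcontRe f x : rcont f x -> {for x, continuous (fun y => complex.Re (f y))}.
Proof.
move=> fx; apply/cvgrPdist_lt => e /fx[d d0 dP]; apply/nbhs_normP.
exists d => // y /=; rewrite distrC => /dP; rewrite [x + _]addrC subrK => H.
by rewrite distrC (le_lt_trans _ H) // -raddfB /= Re_le_N.
Qed.

Lemma rcontIm f x : rcont f x -> {for x, continuous (fun y => complex.Im (f y))}.
Proof.
move=> fx; apply/cvgrPdist_lt => e /fx[d d0 dP]; apply/nbhs_normP.
exists d => // y /=; rewrite distrC => /dP; rewrite [x + _]addrC subrK => H.
by rewrite distrC (le_lt_trans _ H) // -raddfB /= Im_le_N.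
Qed.

Lemma antiderivative (f : R -> C) a b : a <= b -> (forall x, rcont f x) ->
  exists F : R -> C, forall x, a <= x <= b -> rder F x (f x).
Proof.
move=> ab cf.
have [F1 F1P] := antiderivative_real ab (fun x => rcontRe (cf x)).
have [F2 F2P] := antiderivative_real ab (fun x => rcontIm (cf x)).
exists (fun x => F1 x +i* F2 x) => x xab e e0.
have e2 : 0 < e / 2 by rewrite divr_gt0.
have [d1 d10 d1P] := is_derive_real (F1P x xab) e2.
have [d2 d20 d2P] := is_derive_real (F2P x xab) e2.
exists (Num.min d1 d2) => [|h]; first by rewrite lt_min d10.
rewrite lt_min => /andP[/d1P h1 /d2P h2].
rewrite (le_trans (N_le_ReIm _)) // (splitr e) mulrDl lerD //.
  by case: (f x) h1 => u v /=; rewrite mul0r subr0.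
by case: (f x) h2 => u v /=; rewrite mul0r addr0.
Qed.

Lemma rderM (F : R -> C) x l c : rder F x l -> rder (fun y => c * F y) x (c * l).
Proof.
move=> Fl e e0; have c1 : 0 < N c + 1 by rewrite ltr_wpDl ?N_ge0.
have [d d0 dP] := Fl (e / (N c + 1)) (divr_gt0 e0 c1).
exists d => // h /dP H.
rewrite (_ : _ - _ = c * (F (x + h) - F x - h%:C * l)); last by ring.
rewrite NM (le_trans (ler_wpM2l (N_ge0 _) H)) // mulrA ler_wpM2r //.
by rewrite mulrCA (ler_piMr (ltW e0)) // ler_pdivrMr // mul1r lerDl.
Qed.

Lemma rderD (F G : R -> C) x k l : rder F x k -> rder G x l ->
  rder (fun y => F y + G y) x (k + l).
Proof.
move=> Fk Gl e e0; have e2 : 0 < e / 2 by rewrite divr_gt0.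
have [d1 d10 d1P] := Fk _ e2; have [d2 d20 d2P] := Gl _ e2.
exists (Num.min d1 d2) => [|h]; first by rewrite lt_min d10.
rewrite lt_min => /andP[/d1P h1 /d2P h2].
rewrite (_ : _ - _ = (F (x + h) - F x - h%:C * k) + (G (x + h) - G x - h%:C * l)).
  by rewrite (le_trans (ND _ _)) // (splitr e) mulrDl lerD.
by ring.
Qed.

(** Rotate F so that its increment is a positive real number, and apply the real mean value
    theorem to the real part. *)
Lemma rder_le (F : R -> C) (f : R -> C) a b M : a <= b ->
  (forall x, a <= x <= b -> rder F x (f x)) ->
  (forall x, a <= x <= b -> N (f x) <= M) -> N (F b - F a) <= M * (b - a).
Proof.
move=> ab Ff fM; pose D := F b - F a.
have [D0|D0] := eqVneq D 0.
  rewrite -/D D0 N0 mulr_ge0 ?subr_ge0 // (le_trans (N_ge0 (f a))) // fM //.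
  by rewrite lexx.
have ND0 := N_gt0 D0.
pose u : C := (N D)^-1%:C * D^*.
have Nu : N u = 1.
  by rewrite /u NM NC Nconj ger0_norm ?invr_ge0 ?N_ge0 // mulVf // gt_eqF.
have uD : complex.Re (u * D) = N D.
  have := Nsqr D; rewrite /u; case: D ND0 {D0 Nu u} => x y ND0 xy /=.
  rewrite !mul0r subr0 addr0 -[LHS]/((N (x +i* y))^-1 * x * x - (N (x +i* y))^-1 * - y * y).
  rewrite mulrN mulNr opprK -!mulrA -mulrDr -!expr2 -xy expr2 mulKf //.
  by rewrite gt_eqF.
pose phi y := complex.Re (u * F y).
have phiD x : a <= x <= b -> is_derive x 1 phi (complex.Re (u * f x)).
  move=> xab; apply: real_is_derive => e /(rderM u (Ff x xab))[d d0 dP].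
  exists d => // h /dP H; rewrite (le_trans _ H) // (le_trans _ (Re_le_N _)) //.
  rewrite /phi -[h * _](_ : complex.Re (h%:C * (u * f x)) = _); last first.
    by case: (u * f x) => ? ? /=; rewrite mul0r subr0.
  by rewrite !raddfB.
have [| |c cab] := MVT_segment ab (f := phi) (df := fun x => complex.Re (u * f x)).
- by move=> x /[!in_itv]/= /andP[ax xb]; apply: phiD; rewrite !ltW.
- apply: derivable_within_continuous => x /[!in_itv]/= xab.
  by have [] := phiD x xab.
have -> : phi b - phi a = N D by rewrite -uD /D mulrBr raddfB.
move=> ->.
rewrite ler_wpM2r ?subr_ge0 // (le_trans (ler_norm _)) // (le_trans (Re_le_N _)) //.
by rewrite NM Nu mul1r fM //; move: cab; rewrite in_itv.
Qed.

(** The increment of any antiderivative of f. The mean value inequality makes it independent of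
    the choice (lemma line_intE). *)
Definition line_int (a b : R) (f : R -> C) : C := xget 0
  [set v | exists2 F : R -> C, (forall x, a <= x <= b -> rder F x (f x)) & v = F b - F a].

Lemma line_intE a b (F f : R -> C) : a <= b ->
  (forall x, a <= x <= b -> rder F x (f x)) -> line_int a b f = F b - F a.
Proof.
move=> ab Ff; rewrite /line_int.
case: xgetP => [v -> [G Gf ->]|/(_ (F b - F a)) []]; last by exists F.
apply: N_sub_le0.
have H x : a <= x <= b -> rder (fun y => G y + -1 * F y) x ((fun=> 0) x).
  move=> xab; have := rderD (Gf x xab) (rderM (-1) (Ff x xab)).
  by rewrite mulN1r subrr.
have := rder_le (M := 0) ab H (fun x _ => _); rewrite mul0r => H'.
rewrite (_ : _ - _ = (G b + -1 * F b) - (G a + -1 * F a)); last by ring.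
by apply: H' => x; rewrite N0.
Qed.

Lemma eq_line_int a b f g : (forall x, a <= x <= b -> f x = g x) -> line_int a b f = line_int a b g.
Proof.
move=> fg; rewrite /line_int; congr xget; apply/seteqP; split=> v [F Ff ->]; exists F => // x xab.
  by rewrite -fg //; exact: Ff.
by rewrite fg //; exact: Ff.
Qed.

Lemma line_int_lin a b c f g : a <= b -> (forall x, rcont f x) -> (forall x, rcont g x) ->
  line_int a b (fun x => c * f x + g x) = c * line_int a b f + line_int a b g.
Proof.
move=> ab cf cg.
have [F Ff] := antiderivative ab cf; have [G Gg] := antiderivative ab cg.
rewrite (line_intE ab Ff) (line_intE ab Gg).
rewrite (@line_intE a b (fun x => c * F x + G x)) //; first by ring.
by move=> x xab; apply: rderD (Gg x xab); apply: rderM (Ff x xab).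
Qed.

Lemma line_int_cat a b c f : a <= b -> b <= c -> (forall x, rcont f x) ->
  line_int a c f = line_int a b f + line_int b c f.
Proof.
move=> ab bc cf; have ac := le_trans ab bc.
have [F Ff] := antiderivative ac cf.
rewrite (line_intE ac Ff) (@line_intE a b F) ?(@line_intE b c F) //; first by ring.
  by move=> x /andP[bx xc]; apply: Ff; rewrite xc (le_trans ab).
by move=> x /andP[ax xb]; apply: Ff; rewrite ax (le_trans xb).
Qed.

Lemma line_int_le a b f M : a <= b -> (forall x, rcont f x) ->
  (forall x, a <= x <= b -> N (f x) <= M) -> N (line_int a b f) <= M * (b - a).
Proof.
move=> ab cf fM; have [F Ff] := antiderivative ab cf.
by rewrite (line_intE ab Ff); exact: rder_le Ff fM.
Qed.

End Primitive.

(** * Goursat's theorem on rectangles *)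

Section Goursat.
Variable R : realType.
Local Notation C := (R[i]).

Definition ccont (F : C -> C) := forall z (e : R), 0 < e ->
  exists2 d : R, 0 < d & forall h, N h < d -> N (F (z + h) - F z) < e.

(** The integral of F(z) dz along the boundary of a rectangle, counterclockwise; on vertical
    sides dz is 'i times dy. *)
Definition rect_int (F : C -> C) (x0 x1 y0 y1 : R) : C :=
  line_int x0 x1 (fun x => F (x +i* y0)) - line_int x0 x1 (fun x => F (x +i* y1)) +
  'i%C * (line_int y0 y1 (fun y => F (x1 +i* y)) - line_int y0 y1 (fun y => F (x0 +i* y))).

(** Continuity along the whole lines that carry the sides, so that no one-sided limits occur at
    the corners. *)
Definition bcont (F : C -> C) (x0 x1 y0 y1 : R) :=
  [/\ forall x, rcont (fun x => F (x +i* y0)) x, forall x, rcont (fun x => F (x +i* y1)) x,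
      forall y, rcont (fun y => F (x1 +i* y)) y & forall y, rcont (fun y => F (x0 +i* y)) y].

Lemma addC_re (x y h : R) : (x + h) +i* y = (x +i* y) + (h%:C : C).
Proof. by rewrite /=; apply/eqP; rewrite eq_complex /= addr0 !eqxx. Qed.

Lemma addC_im (x y h : R) : x +i* (y + h) = (x +i* y) + ('i%C * h%:C : C).
Proof.
by apply/eqP; rewrite eq_complex /= !mul0r !mulr0 subr0 addr0 mul1r add0r !eqxx.
Qed.

Lemma Nih (h : R) : N ('i%C * h%:C : C) = `|h|.
Proof. by rewrite NM Ni mul1r NC. Qed.

Lemma cont_rcont_re (F : C -> C) (x y : R) :
  (forall e : R, 0 < e -> exists2 d : R, 0 < d & forall h, N h < d ->
     N (F (x +i* y + h) - F (x +i* y)) < e) -> rcont (fun x => F (x +i* y)) x.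
Proof.
move=> cF e /cF[d d0 dP]; exists d => // h hd; rewrite addC_re; apply: dP.
by rewrite NC.
Qed.

Lemma cont_rcont_im (F : C -> C) (x y : R) :
  (forall e : R, 0 < e -> exists2 d : R, 0 < d & forall h, N h < d ->
     N (F (x +i* y + h) - F (x +i* y)) < e) -> rcont (fun y => F (x +i* y)) y.
Proof.
move=> cF e /cF[d d0 dP]; exists d => // h hd; rewrite addC_im; apply: dP.
by rewrite Nih.
Qed.

Lemma ccont_bcont F x0 x1 y0 y1 : ccont F -> bcont F x0 x1 y0 y1.
Proof.
by move=> cF; split=> x; by [apply: cont_rcont_re; apply: cF|apply: cont_rcont_im; apply: cF].
Qed.

Lemma eq_rect_int F G x0 x1 y0 y1 : x0 <= x1 -> y0 <= y1 ->
  (forall x, x0 <= x <= x1 -> F (x +i* y0) = G (x +i* y0) /\ F (x +i* y1) = G (x +i* y1)) ->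
  (forall y, y0 <= y <= y1 -> F (x0 +i* y) = G (x0 +i* y) /\ F (x1 +i* y) = G (x1 +i* y)) ->
  rect_int F x0 x1 y0 y1 = rect_int G x0 x1 y0 y1.
Proof.
move=> xx yy H V; rewrite /rect_int.
by congr (_ - _ + _ * (_ - _)); apply: eq_line_int => t tP;
  [case: (H t tP)|case: (H t tP)|case: (V t tP)|case: (V t tP)].
Qed.

Lemma rect_int_lin F G c x0 x1 y0 y1 : x0 <= x1 -> y0 <= y1 ->
  bcont F x0 x1 y0 y1 -> bcont G x0 x1 y0 y1 ->
  rect_int (fun z => c * F z + G z) x0 x1 y0 y1 = c * rect_int F x0 x1 y0 y1 + rect_int G x0 x1 y0 y1.
Proof.
move=> xx yy [f1 f2 f3 f4] [g1 g2 g3 g4]; rewrite /rect_int.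
by rewrite !line_int_lin //; ring.
Qed.

Lemma rect_int_le F M x0 x1 y0 y1 : x0 <= x1 -> y0 <= y1 -> bcont F x0 x1 y0 y1 ->
  (forall x, x0 <= x <= x1 -> N (F (x +i* y0)) <= M /\ N (F (x +i* y1)) <= M) ->
  (forall y, y0 <= y <= y1 -> N (F (x0 +i* y)) <= M /\ N (F (x1 +i* y)) <= M) ->
  N (rect_int F x0 x1 y0 y1) <= M * (2 * ((x1 - x0) + (y1 - y0))).
Proof.
move=> xx yy [f1 f2 f3 f4] H V; rewrite /rect_int.
have I1 : N (line_int x0 x1 (fun x => F (x +i* y0))) <= M * (x1 - x0).
  by apply: line_int_le => // x /H[].
have I2 : N (line_int x0 x1 (fun x => F (x +i* y1))) <= M * (x1 - x0).
  by apply: line_int_le => // x /H[].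
have I3 : N (line_int y0 y1 (fun y => F (x1 +i* y))) <= M * (y1 - y0).
  by apply: line_int_le => // x /V[].
have I4 : N (line_int y0 y1 (fun y => F (x0 +i* y))) <= M * (y1 - y0).
  by apply: line_int_le => // x /V[].
rewrite (le_trans (ND _ _)) // NM Ni mul1r.
have := NB (line_int x0 x1 (fun x => F (x +i* y0))) (line_int x0 x1 (fun x => F (x +i* y1))).
have := NB (line_int y0 y1 (fun y => F (x1 +i* y))) (line_int y0 y1 (fun y => F (x0 +i* y))).
lra.
Qed.

Lemma rect_int_catx F x0 x1 x2 y0 y1 : x0 <= x1 -> x1 <= x2 -> ccont F ->
  rect_int F x0 x2 y0 y1 = rect_int F x0 x1 y0 y1 + rect_int F x1 x2 y0 y1.
Proof.
move=> a b cF; rewrite /rect_int.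
have c y x : rcont (fun x => F (x +i* y)) x by apply: cont_rcont_re; apply: cF.
by rewrite !(line_int_cat a b) //; ring.
Qed.

Lemma rect_int_caty F x0 x1 y0 y1 y2 : y0 <= y1 -> y1 <= y2 -> ccont F ->
  rect_int F x0 x1 y0 y2 = rect_int F x0 x1 y0 y1 + rect_int F x0 x1 y1 y2.
Proof.
move=> a b cF; rewrite /rect_int.
have c x y : rcont (fun y => F (x +i* y)) y by apply: cont_rcont_im; apply: cF.
by rewrite !(line_int_cat a b) //; ring.
Qed.

(** The increments of a complex primitive along the four sides cancel at the corners. *)
Lemma rect_int_primitive (P p : C -> C) x0 x1 y0 y1 : x0 <= x1 -> y0 <= y1 ->
  (forall x y, x0 <= x <= x1 -> y0 <= y <= y1 ->
     [|| x == x0, x == x1, y == y0 | y == y1] ->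
     is_der P (x +i* y) (fun h => h * p (x +i* y))) ->
  rect_int p x0 x1 y0 y1 = 0.
Proof.
move=> xx yy Pp.
have H y x : y0 <= y <= y1 -> (y == y0) || (y == y1) -> x0 <= x <= x1 ->
    rder (fun x => P (x +i* y)) x (p (x +i* y)).
  move=> yb yE xb e e0; have [_ _] := Pp x y xb yb ltac:(by rewrite yE !orbT).
  move=> /(_ e e0)[d d0 dP]; exists d => // h hd.
  by have := dP h%:C; rewrite NC -addC_re; apply.
have V x y : x0 <= x <= x1 -> (x == x0) || (x == x1) -> y0 <= y <= y1 ->
    rder (fun y => - 'i%C * P (x +i* y)) y (p (x +i* y)).
  move=> xb xE yb.
  rewrite (_ : p (x +i* y) = - 'i%C * ('i%C * p (x +i* y))); last first.
    by rewrite mulrA mulNr mul_ii opprK mul1r.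
  apply: (@rderM _ (fun y => P (x +i* y))) => e e0.
  have [_ _] := Pp x y xb yb ltac:(by rewrite orbA xE).
  move=> /(_ e e0)[d d0 dP]; exists d => // h hd.
  have := dP ('i%C * h%:C); rewrite Nih -addC_im => /(_ hd).
  by rewrite mulrCA mulrA.
rewrite /rect_int (line_intE xx (fun x => H y0 x _ _)) ?lexx ?eqxx ?orbT ?xx ?yy //.
rewrite (line_intE xx (fun x => H y1 x _ _)) ?lexx ?eqxx ?orbT ?xx ?yy //.
rewrite (line_intE yy (fun y => V x1 y _ _)) ?lexx ?eqxx ?orbT ?xx ?yy //.
rewrite (line_intE yy (fun y => V x0 y _ _)) ?lexx ?eqxx ?orbT ?xx ?yy //.
rewrite (_ : _ + _ = (1 + 'i%C * 'i%C) * (P (x1 +i* y0) - P (x0 +i* y0) - P (x1 +i* y1)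
  + P (x0 +i* y1))); last by ring.
by rewrite mul_ii addrN mul0r.
Qed.

Lemma nested_intervals (x w : nat -> R) : (forall n, x n <= x n.+1) ->
  (forall n, x n.+1 + w n.+1 <= x n + w n) -> (forall n, 0 <= w n) ->
  exists X, forall n, x n <= X <= x n + w n.
Proof.
move=> xi xw w0.
have inc m n : (m <= n)%N -> x m <= x n.
  by move=> /subnK <-; elim: (n - m)%N => [|k ih] //; rewrite (le_trans ih) // addSn.
have dec m n : (m <= n)%N -> x n + w n <= x m + w m.
  move=> /subnK <-; elim: (n - m)%N => [|k ih] //.
  by rewrite addSn (le_trans (xw _)).
have ub n : ubound (range x) (x n + w n).
  move=> _ [m _ <-]; case: (leqP m n) => [mn|/ltnW nm].
    by rewrite (le_trans (inc _ _ mn)) // lerDl.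
  by rewrite (le_trans _ (dec _ _ nm)) // lerDl.
exists (sup (range x)) => n; apply/andP; split.
  by apply: ub_le_sup; [exists (x 0%N + w 0%N); exact: ub|exists n].
by apply: ge_sup; [exists (x 0%N); exists 0%N|exact: ub].
Qed.

End Goursat.

Section Goursat2.
Variable R : realType.
Local Notation C := (R[i]).

(** One of the four quarters carries at least a quarter of the integral. *)
Lemma rect_int_quarter (F : C -> C) (x a y b : R) : ccont F -> 0 <= a -> 0 <= b ->
  exists x' y', [/\ x <= x', x' + a <= x + (a + a), y <= y', y' + b <= y + (b + b) &
    N (rect_int F x (x + (a + a)) y (y + (b + b))) <= 4 * N (rect_int F x' (x' + a) y' (y' + b))].
Proof.
move=> cF a0 b0.
have xa : x <= x + a by rewrite lerDl.
have xa' : x + a <= x + (a + a) by rewrite addrA lerDl.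
have yb : y <= y + b by rewrite lerDl.
have yb' : y + b <= y + (b + b) by rewrite addrA lerDl.
pose I1 := rect_int F x (x + a) y (y + b); pose I2 := rect_int F x (x + a) (y + b) (y + b + b).
pose I3 := rect_int F (x + a) (x + a + a) y (y + b).
pose I4 := rect_int F (x + a) (x + a + a) (y + b) (y + b + b).
have E : rect_int F x (x + (a + a)) y (y + (b + b)) = I1 + I2 + (I3 + I4).
  by rewrite (rect_int_catx _ _ xa xa') // !(rect_int_caty _ _ yb yb') // !addrA.
have [h1|h1] := leP (N (rect_int F x (x + (a + a)) y (y + (b + b)))) (4 * N I1).
  by exists x, y; split=> //; rewrite lerD2l lerDl.
have [h2|h2] := leP (N (rect_int F x (x + (a + a)) y (y + (b + b)))) (4 * N I2).
  by exists x, (y + b); split=> //; rewrite ?lerD2l ?lerDl // !addrA.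
have [h3|h3] := leP (N (rect_int F x (x + (a + a)) y (y + (b + b)))) (4 * N I3).
  by exists (x + a), y; split=> //; rewrite ?lerD2l ?lerDl // !addrA.
exists (x + a), (y + b); split=> //; rewrite ?addrA //.
rewrite -/I4; have := ND (I1 + I2) (I3 + I4); rewrite -E.
have := ND I1 I2; have := ND I3 I4; rewrite !addrA in h1 h2 h3 *; lra.
Qed.

Lemma rect_int_affine (c d z0 : C) x0 x1 y0 y1 : x0 <= x1 -> y0 <= y1 ->
  rect_int (fun z => c + (z - z0) * d) x0 x1 y0 y1 = 0.
Proof.
move=> xx yy; apply: (@rect_int_primitive _ (fun z => c * z + 2^-1 * d * (z - z0) ^+ 2)) => //.
move=> x y _ _ _; set z := x +i* y; split.
- move=> a u v; rewrite -[a *: u]/(a * u) -[a *: (u * _)]/(a * (u * _)); ring.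
- by exists (N (c + (z - z0) * d)) => [|v]; rewrite ?N_ge0 // NM mulrC.
move=> e e0; pose K := N (2^-1 * d) + 1.
have K0 : 0 < K by rewrite ltr_wpDl ?N_ge0.
exists (e / K) => [|h hd]; first by rewrite divr_gt0.
rewrite (_ : _ - _ = 2^-1 * d * h * h); last first.
  have : (2 : C) != 0 by rewrite pnatr_eq0.
  by move=> two; field.
rewrite NM ler_wpM2r ?N_ge0 // NM.
have : N h * K <= e by rewrite -ler_pdivlMr // ltW.
by apply: le_trans; rewrite mulrC ler_wpM2l ?N_ge0 // lerDl.
Qed.

Lemma rect_int_sub_null (F A : C -> C) x0 x1 y0 y1 : x0 <= x1 -> y0 <= y1 ->
  ccont F -> ccont A -> rect_int A x0 x1 y0 y1 = 0 ->
  rect_int F x0 x1 y0 y1 = rect_int (fun z => F z + -1 * A z) x0 x1 y0 y1.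
Proof.
move=> xx yy cF cA A0.
have -> : (fun z => F z + -1 * A z) = (fun z => -1 * A z + F z).
  by apply/funext => z; rewrite addrC.
have := rect_int_lin (-1) xx yy (ccont_bcont x0 x1 y0 y1 cA) (ccont_bcont x0 x1 y0 y1 cF).
by move=> ->; rewrite A0 mulr0 add0r.
Qed.

(** Bisect towards a point c, always keeping a quarter with a large integral. Near c the function
    F is affine up to e * |z - c|. The affine part integrates to 0, and the error is at most e
    times the square of the perimeter, which compensates the factor 4^n lost in n bisections. *)
Lemma goursat (F : C -> C) x0 x1 y0 y1 : x0 <= x1 -> y0 <= y1 -> ccont F ->
  (forall x y, x0 <= x <= x1 -> y0 <= y <= y1 -> hol F (x +i* y)) ->
  rect_int F x0 x1 y0 y1 = 0.
Proof.
move=> xx yy cF hF.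
pose w n : R := (x1 - x0) / 2 ^+ n; pose t n : R := (y1 - y0) / 2 ^+ n.
have w0 n : 0 <= w n by rewrite divr_ge0 ?subr_ge0 // exprn_ge0.
have t0 n : 0 <= t n by rewrite divr_ge0 ?subr_ge0 // exprn_ge0.
have half (s : R) n : s / 2 ^+ n = s / 2 ^+ n.+1 + s / 2 ^+ n.+1.
  by rewrite exprS; field; rewrite gt_eqF // exprn_gt0.
have /choice[g gP] : forall nq : nat * (R * R), exists q' : R * R,
  [/\ nq.2.1 <= q'.1, q'.1 + w nq.1.+1 <= nq.2.1 + w nq.1,
      nq.2.2 <= q'.2, q'.2 + t nq.1.+1 <= nq.2.2 + t nq.1 &
    N (rect_int F nq.2.1 (nq.2.1 + w nq.1) nq.2.2 (nq.2.2 + t nq.1)) <=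
      4 * N (rect_int F q'.1 (q'.1 + w nq.1.+1) q'.2 (q'.2 + t nq.1.+1))].
  move=> [n [x y]] /=; have [x' [y' [? ? ? ? H]]] := rect_int_quarter x y cF (w0 n.+1) (t0 n.+1).
  exists (x', y'); rewrite /w /t (half (x1 - x0) n) (half (y1 - y0) n).
  by split.
(* lower left corners of the nested rectangles, with sides w n and t n *)
pose q := fix q n := if n is m.+1 then g (m, q m) else (x0, y0).
have qS n : q n.+1 = g (n, q n) by [].
have [X XP] : exists X, forall n, (q n).1 <= X <= (q n).1 + w n.
  by apply: nested_intervals => // n; rewrite qS; case: (gP (n, q n)).
have [Y YP] : exists Y, forall n, (q n).2 <= Y <= (q n).2 + t n.
  by apply: nested_intervals => // n; rewrite qS; case: (gP (n, q n)).
have XI : x0 <= X <= x1 by have := XP 0%N; rewrite /w expr0 divr1 addrC subrK.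
have YI : y0 <= Y <= y1 by have := YP 0%N; rewrite /t expr0 divr1 addrC subrK.
have [d [_ _ dP]] := hol1_der (hF X Y XI YI).
set c := X +i* Y in dP.
pose S n := rect_int F (q n).1 ((q n).1 + w n) (q n).2 ((q n).2 + t n).
have SN n : N (rect_int F x0 x1 y0 y1) <= 4 ^+ n * N (S n).
  elim: n => [|n ih].
    by rewrite expr0 mul1r /S /w /t /= expr0 !divr1 ![_ + (_ - _)]addrC !subrK.
  rewrite (le_trans ih) // exprSr -mulrA ler_wpM2l ?exprn_ge0 //.
  by rewrite /S qS; case: (gP (n, q n)).
apply: N_le0.
pose L := (x1 - x0) + (y1 - y0).
have L0 : 0 <= L by rewrite addr_ge0 ?subr_ge0.
suff key (e : R) : 0 < e -> N (rect_int F x0 x1 y0 y1) <= e * (2 * L ^+ 2).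
  apply/ler_addgt0Pr => e e0; rewrite add0r.
  have M0 : 0 < 2 * L ^+ 2 + 1 by rewrite ltr_wpDl // mulr_ge0 // sqr_ge0.
  rewrite (le_trans (key (e / (2 * L ^+ 2 + 1)) _)) ?divr_gt0 //.
  by rewrite mulrAC ler_pdivrMr // (ler_wpM2l (ltW e0)) // lerDl.
move=> e0; have [dl dl0 dlP] := dP e e0.
have [n nL] : exists n, L / 2 ^+ n < dl.
  exists (Num.truncn (L / dl)).+1; rewrite ltr_pdivrMr ?exprn_gt0 //.
  rewrite mulrC -ltr_pdivrMr //; apply: lt_trans (truncnS_gt _) _.
  by rewrite -natrX ltr_nat ltn_expl.
have wt : w n + t n = L / 2 ^+ n by rewrite /L mulrDl.
have /andP[X1 X2] := XP n; have /andP[Y1 Y2] := YP n.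
pose A z := F c + (z - c) * d.
have close x y : (q n).1 <= x <= (q n).1 + w n -> (q n).2 <= y <= (q n).2 + t n ->
    N (F (x +i* y) + -1 * A (x +i* y)) <= e * (L / 2 ^+ n).
  move=> /andP[xa xb] /andP[ya yb]; set z := x +i* y.
  have Nzc : N (z - c) <= L / 2 ^+ n.
    rewrite (le_trans (N_le_ReIm _)) // -wt lerD //= ler_norml; apply/andP; split; lra.
  have := dlP (z - c) (le_lt_trans Nzc nL); rewrite [c + _]addrC subrK => H.
  rewrite (_ : _ + _ = F z - F c - (z - c) * d); last by rewrite /A; ring.
  by rewrite (le_trans H) // (ler_wpM2l (ltW e0)).
have cA : ccont A.
  move=> z e' e'0; apply: hol_cont e'0; rewrite /A.
  apply: holD; first exact: hol_cst.
  apply: holM; last exact: hol_cst.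
  by apply: holB; [exact: hol_id|exact: hol_cst].
have wn : (q n).1 <= (q n).1 + w n by rewrite lerDl.
have tn : (q n).2 <= (q n).2 + t n by rewrite lerDl.
have A0 : rect_int A (q n).1 ((q n).1 + w n) (q n).2 ((q n).2 + t n) = 0.
  exact: rect_int_affine.
clearbody A.
have cFA : ccont (fun z => F z + -1 * A z).
  move=> z e' e'0; have e2 : 0 < e' / 2 by rewrite divr_gt0.
  have [d1 d10 d1P] := cF z _ e2; have [d2 d20 d2P] := cA z _ e2.
  exists (Num.min d1 d2) => [|h]; first by rewrite lt_min d10.
  rewrite lt_min => /andP[/d1P h1 /d2P h2].
  rewrite (_ : _ - _ = (F (z + h) - F z) - (A (z + h) - A z)); last by ring.
  rewrite (le_lt_trans (NB _ _)) //; lra.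
have SE : S n = rect_int (fun z => F z + -1 * A z) (q n).1 ((q n).1 + w n) (q n).2 ((q n).2 + t n).
  exact: (rect_int_sub_null wn tn cF cA A0).
have := rect_int_le (M := e * (L / 2 ^+ n)) wn tn (ccont_bcont _ _ _ _ cFA) _ _.
rewrite -SE => H.
have {H} : N (S n) <= e * (L / 2 ^+ n) *
   (2 * ((q n).1 + w n - (q n).1 + ((q n).2 + t n - (q n).2))).
  by apply: H => z zP; split; apply: close; rewrite ?lexx ?wn ?tn.
rewrite ![_ + _ - _]addrAC !subrr !add0r wt => H.
rewrite (le_trans (SN n)) //.
rewrite (le_trans (ler_wpM2l _ H)) ?exprn_ge0 //.
have -> : (4 : R) ^+ n = 2 ^+ n * 2 ^+ n by rewrite -exprMn -natrM.
apply: le_of_eq; field.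
by rewrite gt_eqF // exprn_gt0.
Qed.

(** Cut out a square of side 2 e around the exceptional point. The four other pieces integrate
    to 0, and the square contributes O(e) since F is bounded near the point. *)
Lemma goursat_except (F : C -> C) (r : R) (a : C) : ccont F ->
  `|complex.Re a| < r -> `|complex.Im a| < r ->
  (forall x y, -r <= x <= r -> -r <= y <= r -> x +i* y != a -> hol F (x +i* y)) ->
  rect_int F (- r) r (- r) r = 0.
Proof.
case: a => a b /= cF; rewrite !ltr_norml => /andP[a1 a2] /andP[b1 b2] hF.
have [d d0 dP] := cF (a +i* b) 1 ltr01.
pose M := N (F (a +i* b)) + 1.
have M0 : 0 < M by rewrite ltr_wpDl ?N_ge0.
pose m := Num.min (d / 2) (Num.min (Num.min (a + r) (r - a)) (Num.min (b + r) (r - b))).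
have m0 : 0 < m by rewrite !lt_min divr_gt0 //=; lra.
suff small (e : R) : 0 < e -> e < m -> N (rect_int F (- r) r (- r) r) <= M * (8 * e).
  apply: N_le0.
  apply/ler_addgt0Pr => e e0; rewrite add0r.
  (* the contribution of the square is at most M times its perimeter 8 e' *)
pose e' := Num.min (m / 2) (e / (M * 8)).
  have e'0 : 0 < e' by rewrite lt_min !divr_gt0 // mulr_gt0.
  have e'm : e' < m.
    rewrite (le_lt_trans (_ : _ <= m / 2)) ?ge_min ?lexx //; lra.
  rewrite (le_trans (small _ e'0 e'm)) // mulrA mulrC -ler_pdivlMr ?mulr_gt0 //.
  by rewrite ge_min lexx orbT.
move=> e0; rewrite !lt_min => /and3P[ed /andP[e1 e2] /andP[e3 e4]].
have l1 : - r <= a - e by lra.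
have l2 : a - e <= a + e by lra.
have l3 : a + e <= r by lra.
have k1 : - r <= b - e by lra.
have k2 : b - e <= b + e by lra.
have k3 : b + e <= r by lra.
rewrite (rect_int_catx _ _ l1 (le_trans l2 l3)) // (rect_int_catx _ _ l2 l3) //.
have rr : - r <= r by lra.
have ne x y : (x != a) || (y != b) -> x +i* y != a +i* b.
  by rewrite eq_complex /= negb_and.
rewrite (@goursat F (- r) (a - e)) //; last first.
  move=> x y /andP[? ?] ?; apply: hF => //; first by apply/andP; split; lra.
  by apply: ne; rewrite lt_eqF //; lra.
rewrite (@goursat F (a + e) r) //; last first.
  move=> x y /andP[? ?] ?; apply: hF => //; first by apply/andP; split; lra.
  by apply: ne; rewrite gt_eqF //; lra.
rewrite addr0 add0r.
rewrite (rect_int_caty _ _ k1 (le_trans k2 k3)) // (rect_int_caty _ _ k2 k3) //.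
rewrite (@goursat F (a - e) (a + e) (- r) (b - e)) //; last first.
  move=> x y /andP[? ?] /andP[? ?]; apply: hF; try by apply/andP; split; lra.
  by apply: ne; rewrite [y == b]lt_eqF ?orbT //; lra.
rewrite (@goursat F (a - e) (a + e) (b + e) r) //; last first.
  move=> x y /andP[? ?] /andP[? ?]; apply: hF; try by apply/andP; split; lra.
  by apply: ne; rewrite [y == b]gt_eqF ?orbT //; lra.
rewrite addr0 add0r.
have near x y : a - e <= x <= a + e -> b - e <= y <= b + e -> N (F (x +i* y)) <= M.
  move=> /andP[? ?] /andP[? ?].
  have zd : N (x +i* y - (a +i* b)) < d.
    rewrite (le_lt_trans (N_le_ReIm _)) //=.
    have : `|x - a| <= e by rewrite ler_norml; apply/andP; split; lra.
    have : `|y - b| <= e by rewrite ler_norml; apply/andP; split; lra.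
    lra.
  have := dP _ zd; rewrite [_ + (_ - _)]addrC subrK => H.
  by rewrite (le_trans (NleD _ (F (a +i* b)))) // addrC lerD2l ltW.
have := rect_int_le (M := M) l2 k2 (ccont_bcont _ _ _ _ cF) _ _ => H.
rewrite (_ : 8 * e = 2 * ((a + e - (a - e)) + (b + e - (b - e)))); last by ring.
by apply: H => z zP; split; apply: near; rewrite ?lexx ?l2 ?k2.
Qed.

End Goursat2.

(** * Cauchy's formula on a square *)

Section Cauchy.
Variable R : realType.
Local Notation C := (R[i]).

Definition contat (F : C -> C) (z : C) := forall e : R, 0 < e ->
  exists2 d : R, 0 < d & forall h, N h < d -> N (F (z + h) - F z) < e.

Lemma contatM F G z : contat F z -> contat G z -> contat (fun y => F y * G y) z.
Proof.
move=> cF cG e e0.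
pose M := N (F z) + N (G z) + 1.
have M0 : 0 < M by rewrite ltr_wpDl // addr_ge0 ?N_ge0.
pose e' := Num.min 1 (e / (2 * M)).
have e'0 : 0 < e' by rewrite lt_min ltr01 divr_gt0 // mulr_gt0.
have [d1 d10 d1P] := cF _ e'0; have [d2 d20 d2P] := cG _ e'0.
exists (Num.min d1 d2) => [|h]; first by rewrite lt_min d10.
rewrite lt_min => /andP[/d1P h1 /d2P h2].
rewrite (_ : _ - _ = (F (z + h) - F z) * (G (z + h) - G z) +
  (F z * (G (z + h) - G z) + (F (z + h) - F z) * G z)); last by ring.
rewrite (le_lt_trans (ND _ _)) //.
have H := ND (F z * (G (z + h) - G z)) ((F (z + h) - F z) * G z).
rewrite !NM in H *; set x := N (F (z + h) - _) in h1 H *; set y := N (G (z + h) - _) in h2 H *.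
have e1 : e' <= 1 by rewrite ge_min lexx.
have e2 : e' * M <= e / 2.
  apply: (@le_trans _ _ (e / (2 * M) * M)).
    by apply: ler_wpM2r; [exact: ltW|rewrite ge_min lexx orbT].
  by apply: le_of_eq; field; rewrite gt_eqF.
have y0 : 0 <= y := N_ge0 _; have x0 : 0 <= x := N_ge0 _.
have xy : x * y <= e' * 1 by apply: ler_pM => //; rewrite ltW // (lt_le_trans h2).
have yF : N (F z) * y <= N (F z) * e' by rewrite ler_wpM2l ?N_ge0 // ltW.
have xG : x * N (G z) <= e' * N (G z) by rewrite ler_wpM2r ?N_ge0 // ltW.
rewrite /M in e2; lra.
Qed.

Lemma contatB F G z : contat F z -> contat G z -> contat (fun y => F y - G y) z.
Proof.
move=> cF cG e e0; have e2 : 0 < e / 2 by rewrite divr_gt0.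
have [d1 d10 d1P] := cF _ e2; have [d2 d20 d2P] := cG _ e2.
exists (Num.min d1 d2) => [|h]; first by rewrite lt_min d10.
rewrite lt_min => /andP[/d1P h1 /d2P h2].
rewrite (_ : _ - _ = (F (z + h) - F z) - (G (z + h) - G z)); last by ring.
rewrite (le_lt_trans (NB _ _)) //; lra.
Qed.

Lemma contat_hol F z : hol F z -> contat F z.
Proof. exact: hol_cont. Qed.

Lemma is_derM (f g : C -> C) a l m : is_der f a (fun h => h * l) ->
  is_der g a (fun h => h * m) ->
  is_der (fun y => f y * g y) a (fun h => h * (l * g a + f a * m)).
Proof.
move=> fl gm.
rewrite (_ : (fun h => h * _) = fun h => (h * l) *: g a + f a *: (h * m)); last first.
  by apply/funext => h; rewrite -[_ *: g a]/(_ * _) -[_ *: (h * m)]/(_ * _); ring.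
exact: (is_der_comp (is_der_pair fl gm) (is_der_scale_id _)).
Qed.

(** Stated for positive exponents, so that the exponent n of the derivative is not truncated. *)
Lemma is_derX (f : C -> C) a l n : is_der f a (fun h => h * l) ->
  is_der (fun y => f y ^+ n.+1) a (fun h => h * (n.+1%:R * f a ^+ n * l)).
Proof.
move=> fl; elim: n => [|n ih].
  by rewrite (_ : (fun h => h * _) = fun h => h * l) //; apply/funext => h; rewrite expr0 !mul1r.
under eq_fun do rewrite exprSr.
have := is_derM ih fl; congr is_der.
by apply/funext => h; rewrite -[n.+2]addn1 natrD exprSr; ring.
Qed.

Section Square.
Variable r : R.
Hypothesis r0 : 0 < r.

(** The four lines that carry the sides of the square with half side r. *)
Definition onlines (z : C) := (`|complex.Re z| == r) || (`|complex.Im z| == r).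
Local Notation I F := (rect_int F (- r) r (- r) r).
Local Notation cline F := (forall z, onlines z -> contat F z).

Lemma online_re (x : R) : onlines (x +i* r) /\ onlines (x +i* - r).
Proof. by rewrite /onlines /= normrN (gtr0_norm r0) eqxx orbT. Qed.

Lemma online_im (y : R) : onlines (r +i* y) /\ onlines (- r +i* y).
Proof. by rewrite /onlines /= normrN (gtr0_norm r0) eqxx. Qed.

Lemma cline_bcont F : cline F -> bcont F (- r) r (- r) r.
Proof.
move=> cF; split=> t.
- by apply: cont_rcont_re; apply: cF; case: (online_re t).
- by apply: cont_rcont_re; apply: cF; case: (online_re t).
- by apply: cont_rcont_im; apply: cF; case: (online_im t).
- by apply: cont_rcont_im; apply: cF; case: (online_im t).
Qed.

Lemma onlines_N z : onlines z -> r <= N z.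
Proof.
by case/orP => /eqP <-; [exact: Re_le_N|exact: Im_le_N].
Qed.

Lemma onlines_NB a z : N a <= r / 2 -> onlines z -> r / 2 <= N (z - a).
Proof. by move=> Na /onlines_N rz; have := NleD z a; lra. Qed.

Lemma opp_r_le : - r <= r. Proof. by rewrite ge0_cp // ltW. Qed.

Lemma square_int_eq F G : (forall z, onlines z -> F z = G z) -> I F = I G.
Proof.
move=> FG; apply: eq_rect_int; rewrite ?opp_r_le // => t _; split; apply: FG;
  by [case: (online_re t)|case: (online_im t)].
Qed.

Lemma square_int_lin F G c : cline F -> cline G -> I (fun z => c * F z + G z) = c * I F + I G.
Proof. by move=> cF cG; rewrite rect_int_lin ?opp_r_le //; exact: cline_bcont. Qed.

Lemma square_int_le F M : cline F ->
  (forall x y : R, `|x| <= r -> `|y| <= r -> onlines (x +i* y) -> N (F (x +i* y)) <= M) ->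
  N (I F) <= M * (8 * r).
Proof.
move=> cF FM; have := rect_int_le (M := M) opp_r_le opp_r_le (cline_bcont cF) => H.
rewrite (_ : 8 * r = 2 * (r - - r + (r - - r))); last by ring.
have rN : `|r| <= r by rewrite gtr0_norm.
by apply: H => t; rewrite -ler_norml => tr; split; apply: FM; rewrite ?normrN //;
  by [case: (online_re t)|case: (online_im t)].
Qed.

Lemma hol_inv_line a z : N a <= r / 2 -> onlines z -> z - a != 0 /\ hol (fun y => (y - a)^-1) z.
Proof.
move=> Na zl; have : 0 < N (z - a).
  by rewrite (lt_le_trans _ (onlines_NB Na zl)) // divr_gt0.
move=> p; have nz : z - a != 0 by apply: contraTneq p => ->; rewrite N0 ltxx.
by split=> //; apply: holV => //; apply: holB; [exact: hol_id|exact: hol_cst].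
Qed.

Lemma zero_small : N (0 : C) <= r / 2. Proof. by rewrite N0 divr_ge0 // ltW. Qed.

Lemma onlines_neq0 z : onlines z -> z != 0.
Proof. by case/(hol_inv_line zero_small); rewrite subr0. Qed.

Lemma cline_pow n : cline (fun z => z^-1 ^+ n).
Proof.
move=> z zl; apply/contat_hol/holX/holV; first exact: hol_id.
exact: onlines_neq0.
Qed.

(** The coefficient of a^k when the Cauchy kernel (z - a)^-1 is expanded in powers of a / z. *)
Definition moment phi k := I (fun z => phi z * z^-1 ^+ k.+1).
(** The rest of the expansion of the Cauchy kernel after n terms, divided by a^n. *)
Definition remain phi n a := I (fun z => phi z * z^-1 ^+ n * (z - a)^-1).

Lemma cline_moment phi k : cline phi -> cline (fun z => phi z * z^-1 ^+ k).
Proof. by move=> c z zl; apply: contatM; [exact: c|exact: cline_pow]. Qed.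

Lemma cline_remain phi n a : N a <= r / 2 -> cline phi ->
  cline (fun z => phi z * z^-1 ^+ n * (z - a)^-1).
Proof.
move=> Na c z zl; apply: contatM; first exact: cline_moment.
by apply: contat_hol; case: (hol_inv_line Na zl).
Qed.

Lemma remainS phi n a : N a <= r / 2 -> cline phi ->
  remain phi n a = moment phi n + a * remain phi n.+1 a.
Proof.
move=> Na c; rewrite addrC -square_int_lin; [|exact: cline_remain|exact: cline_moment].
apply: square_int_eq => z zl; have z0 := onlines_neq0 zl.
have [za _] := hol_inv_line Na zl.
by rewrite !exprSr; field; rewrite za z0.
Qed.

Lemma remain_expand phi n a : N a <= r / 2 -> cline phi ->
  remain phi 0 a = \sum_(k < n) a ^+ k * moment phi k + a ^+ n * remain phi n a.
Proof.
move=> Na c; elim: n => [|n ->]; first by rewrite big_ord0 expr0 mul1r add0r.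
by rewrite big_ord_recr /= (remainS _ Na c) exprSr; ring.
Qed.

Lemma moment_le phi k (B : R) : cline phi -> 0 <= B ->
  (forall x y : R, `|x| <= r -> `|y| <= r -> N (phi (x +i* y)) <= B) ->
  N (moment phi k) <= 8 * B / r ^+ k.
Proof.
move=> c B0 phiB; rewrite [leRHS](_ : _ = (B / r ^+ k.+1) * (8 * r)); last first.
  by rewrite exprSr; field; rewrite expf_neq0 ?gt_eqF.
apply: square_int_le => [|x y xr yr zl]; first exact: cline_moment.
rewrite NM NX NV ler_pM ?N_ge0 ?exprn_ge0 ?invr_ge0 ?N_ge0 ?phiB //.
rewrite -exprVn lerXn2r ?nnegrE ?invr_ge0 ?N_ge0 ?(ltW r0) //.
by rewrite lef_pV2 ?posrE ?onlines_N // (lt_le_trans r0) // onlines_N.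
Qed.

Lemma remain_le phi n (B : R) (a : C) : N a <= r / 2 -> cline phi -> 0 <= B ->
  (forall x y : R, `|x| <= r -> `|y| <= r -> N (phi (x +i* y)) <= B) ->
  N (a ^+ n * remain phi n a) <= 16 * B * (N a / r) ^+ n.
Proof.
move=> Na c B0 phiB; rewrite NM NX.
have : N (remain phi n a) <= (B * r^-1 ^+ n * (r / 2)^-1) * (8 * r).
  apply: square_int_le => [|x y xr yr zl]; first exact: cline_remain.
  rewrite !NM NX !NV !ler_pM ?mulr_ge0 ?N_ge0 ?exprn_ge0 ?invr_ge0 ?N_ge0 ?phiB //.
    rewrite lerXn2r ?nnegrE ?invr_ge0 ?N_ge0 ?(ltW r0) //.
    by rewrite lef_pV2 ?posrE ?onlines_N // (lt_le_trans r0) // onlines_N.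
  have r2 : 0 < r / 2 by rewrite divr_gt0.
  by rewrite lef_pV2 ?posrE ?onlines_NB // (lt_le_trans r2) // onlines_NB.
move=> H; rewrite (le_trans (ler_wpM2l _ H)) ?exprn_ge0 ?N_ge0 //.
rewrite exprMn; apply: le_of_eq; field.
by rewrite gt_eqF.
Qed.

(** The integral of dz / z. Its value is 2 pi 'i, but Taylor coefficients only need a lower
    bound for its modulus, so no transcendental constant appears. *)
Definition inv_contour : C := moment (fun=> 1) 0.

(** The powers z^-k with k > 1 have a primitive off the origin. *)
Lemma moment_cst k : moment (fun=> 1) k.+1 = 0.
Proof.
rewrite /moment (@rect_int_primitive _ (fun z => - (k.+1%:R : C)^-1 * z^-1 ^+ k.+1)) ?opp_r_le //.
move=> x y _ _ zb.
set z := x +i* y; have z0 : z != 0.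
  apply: onlines_neq0; rewrite /onlines /z /=.
  by case/or4P: zb => /eqP ->; rewrite ?normrN (gtr0_norm r0) eqxx ?orbT.
have := is_derZ (- (k.+1%:R : C)^-1) (is_derX k (is_derV z0)).
congr is_der; apply/funext => h; rewrite -[_ *: _]/(_ * _) mul1r.
have : (k.+1%:R : C) != 0 by rewrite pnatr_eq0.
move: (k.+1%:R : C) => K k0; rewrite -exprVn !exprS.
by move: (z^-1) => w; move: (w ^+ k) => W; rewrite expr0; field.
Qed.

(** Cauchy's formula for the constant 1: in the expansion of the kernel only the first moment
    is nonzero, and the rest tends to 0. *)
Lemma remain_cst a : N a <= r / 2 -> remain (fun=> 1) 0 a = inv_contour.
Proof.
move=> Na; have c : cline (fun=> 1 : C) by move=> z _; apply/contat_hol/hol_cst.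
apply: N_sub_le0.
apply/ler_addgt0Pr => e e0; rewrite add0r.
(* the rest is at most 16 / 2^n, as |a| <= r / 2 *)
pose n := (Num.truncn (16 / e)).+1.
rewrite (remain_expand n.+1 Na c) big_ord_recl expr0 mul1r big1 => [|k _]; last first.
  by rewrite /bump /= moment_cst mulr0.
rewrite addr0 -/inv_contour addrC addKr (le_trans (remain_le _ Na c ler01 _)) // => [x y _ _|].
  by rewrite N1.
have ar : N a / r <= 2^-1 by rewrite ler_pdivrMr // mulrC.
rewrite mulr1 (le_trans (ler_wpM2l _ (_ : _ <= 2^-1 ^+ n.+1))) //.
  by rewrite lerXn2r ?nnegrE ?divr_ge0 ?N_ge0 // ltW.
rewrite exprVn ler_pdivrMr ?exprn_gt0 // mulrC -ler_pdivrMr // ltW //.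
apply: lt_trans (truncnS_gt _) _.
by rewrite -natrX ltr_nat (ltn_trans (ltnSn _)) // ltn_expl.
Qed.

(** Adding the contributions of opposite sides gives 2 'i times the integral over [-r, r] of
    q(x) = 2 r / (x^2 + r^2). The values of q lie between 1 / r and 2 / r, so on this segment
    of length 2 r the integral differs by at most 1 from that of the constant 3 / (2 r),
    which is 3. *)
Lemma inv_contour_ge : 4 <= N inv_contour.
Proof.
pose q (x : R) : C := (2 * r / (x ^+ 2 + r ^+ 2))%:C.
have sq_gt0 x : 0 < x ^+ 2 + r ^+ 2 by rewrite ltr_wpDl ?sqr_ge0 ?exprn_gt0.
have qC x : q x = 2%:R * r%:C / (x%:C ^+ 2 + r%:C ^+ 2).
  by rewrite /q fmorph_div rmorphM rmorph_nat rmorphD !rmorphXn.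
have sC x : x%:C ^+ 2 + r%:C ^+ 2 != 0 :> C.
  have -> : x%:C ^+ 2 + r%:C ^+ 2 = (x ^+ 2 + r ^+ 2)%:C :> C.
    by rewrite rmorphD !rmorphXn.
  by rewrite fmorph_eq0 gt_eqF.
have ii := mul_ii R.
have cE (x y : R) : x +i* y = x%:C + 'i%C * y%:C by rewrite [LHS]complexE.
have cinv x : rcont (fun x => (x +i* - r)^-1) x /\ rcont (fun x => (x +i* r)^-1) x.
  have cl z : onlines z -> contat (fun z => z^-1) z.
    by move/(cline_pow 1) => H e /H.
  by split; apply: cont_rcont_re => e e0; apply: cl e0; case: (online_re x).
have cinv' y : rcont (fun y => (r +i* y)^-1) y /\ rcont (fun y => (- r +i* y)^-1) y.
  have cl z : onlines z -> contat (fun z => z^-1) z.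
    by move/(cline_pow 1) => H e /H.
  by split; apply: cont_rcont_im => e e0; apply: cl e0; case: (online_im y).
have nz1 x : x%:C + 'i%C * r%:C != 0 :> C by rewrite -cE; apply: onlines_neq0; case: (online_re x).
have nz2 x : x%:C - 'i%C * r%:C != 0 :> C.
  by rewrite -mulrN -rmorphN -cE; apply: onlines_neq0; case: (online_re x).
have nz3 x : r%:C + 'i%C * x%:C != 0 :> C by rewrite -cE; apply: onlines_neq0; case: (online_im x).
have nz4 x : - r%:C + 'i%C * x%:C != 0 :> C.
  by rewrite -rmorphN -cE; apply: onlines_neq0; case: (online_im x).
have q1 x : -1 * (x +i* r)^-1 + (x +i* - r)^-1 = 'i%C * q x.
  rewrite qC (cE x r) (cE x (- r)) rmorphN mulrN.
  transitivity ((2 * 'i%C * r%:C) / ((x%:C + 'i%C * r%:C) * (x%:C - 'i%C * r%:C)) : C).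
    by field; rewrite nz1 nz2.
  have -> : (x%:C + 'i%C * r%:C) * (x%:C - 'i%C * r%:C) = x%:C ^+ 2 + r%:C ^+ 2 :> C.
    by transitivity (x%:C ^+ 2 - ('i%C * 'i%C) * r%:C ^+ 2 : C); [ring|rewrite ii; ring].
  by ring.
have q2 x : -1 * (- r +i* x)^-1 + (r +i* x)^-1 = q x.
  rewrite qC (cE r x) (cE (- r) x) rmorphN.
  transitivity (- (2 * r%:C) / ((r%:C + 'i%C * x%:C) * (- r%:C + 'i%C * x%:C)) : C).
    by field; rewrite nz3 nz4.
  have -> : (r%:C + 'i%C * x%:C) * (- r%:C + 'i%C * x%:C) = - (x%:C ^+ 2 + r%:C ^+ 2) :> C.
    by transitivity (- r%:C ^+ 2 + ('i%C * 'i%C) * x%:C ^+ 2 : C); [ring|rewrite ii; ring].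
  by rewrite invrN mulrNN.
have cq x : rcont q x.
  have : hol (fun z : C => 2%:R * r%:C / (z ^+ 2 + r%:C ^+ 2) : C) (x%:C : C).
    apply: holM; first exact: hol_cst.
    apply: (holV (f := fun z : C => z ^+ 2 + r%:C ^+ 2) _ (sC x)); apply: holD; last exact: hol_cst.
    by apply: holX; exact: hol_id.
  move=> /contat_hol H e /H[d d0 dP]; exists d => // h hd.
  by have := dP h%:C; rewrite NC !qC rmorphD; apply.
have c0 x : rcont (fun=> 0) x.
  by move=> e e0; exists 1 => // h _; rewrite subrr N0.
have ci0 : line_int (- r) r (fun=> 0) = 0.
  rewrite (@line_intE _ _ _ (fun=> 0)) ?opp_r_le ?subrr // => x _ e e0; exists 1 => // h _.
  by rewrite mulr0 !subrr N0 mulr_ge0 // ltW.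
have E : inv_contour = 2 * 'i%C * line_int (- r) r q.
  rewrite /inv_contour /moment; under square_int_eq => z _ do rewrite mul1r expr1.
  rewrite /rect_int.
  have := line_int_lin (-1) opp_r_le (fun x => (cinv x).2) (fun x => (cinv x).1).
  rewrite (eq_line_int (g := fun x => 'i%C * q x + 0)) => [|x _]; last by rewrite q1 addr0.
  rewrite line_int_lin ?opp_r_le // ci0 addr0 => E1.
  have := line_int_lin (-1) opp_r_le (fun x => (cinv' x).2) (fun x => (cinv' x).1).
  rewrite (eq_line_int (g := q)) => [E2|x _]; last exact: q2.
  rewrite (_ : line_int _ _ _ - line_int _ _ _ = 'i%C * line_int (- r) r q); last by rewrite E1; ring.
  rewrite (_ : line_int _ _ _ - line_int _ _ _ = line_int (- r) r q); last by rewrite E2; ring.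
  by ring.
pose k : R := 3 / (2 * r).
have ck x : rcont (fun=> k%:C : C) x.
  by move=> e e0; exists 1 => // h _; rewrite subrr N0.
have cik : line_int (- r) r (fun=> k%:C) = 3.
  rewrite (@line_intE _ _ _ (fun x => x%:C * k%:C)) ?opp_r_le // => [|x _ e e0].
    rewrite -mulrBl -rmorphB -rmorphM (_ : _ * _ = 3) ?rmorph_nat //.
    by rewrite /k; field; rewrite gt_eqF.
  exists 1 => // h _; rewrite rmorphD (_ : _ - _ = 0) ?N0 ?mulr_ge0 ?(ltW e0) //.
  by ring.
have H : N (-1 * line_int (- r) r (fun=> k%:C) + line_int (- r) r q) <= 1 / (2 * r) * (r - - r).
  rewrite -line_int_lin ?opp_r_le //; apply: line_int_le; rewrite ?opp_r_le //.
    move=> x e e0; have [d d0 dP] := cq x e e0; exists d => // h /dP.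
    by congr (N _ < _); ring.
  move=> x; rewrite -ler_norml => xr.
  rewrite mulN1r addrC /q -rmorphB NC ler_norml.
  have x2 : x ^+ 2 <= r ^+ 2.
    by rewrite -(real_normK (num_real x)) lerXn2r ?nnegrE // ltW.
  have x0 := sqr_ge0 x; have r20 : 0 < r ^+ 2 by rewrite exprn_gt0.
  have L : 1 / r <= 2 * r / (x ^+ 2 + r ^+ 2).
    rewrite ler_pdivrMr // mulrAC ler_pdivlMr // mul1r; rewrite !expr2 in x2 *; lra.
  have U : 2 * r / (x ^+ 2 + r ^+ 2) <= 2 / r.
    rewrite ler_pdivrMr // mulrAC ler_pdivlMr //; rewrite !expr2 in x2 x0 *; lra.
  have -> : k = 3 * (1 / r) / 2 by rewrite /k; field; rewrite gt_eqF.
  have -> : 1 / (2 * r) = (1 / r) / 2 by field; rewrite gt_eqF.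
  have E2 : 2 / r = 2 * (1 / r) by rewrite mulrA mulr1.
  rewrite E2 in U; apply/andP; split; lra.
have {H} : N (3 - line_int (- r) r q) <= 1.
  rewrite (le_trans _ (le_trans H _)) //; last first.
    by apply: le_of_eq; field; rewrite gt_eqF.
  by rewrite cik NBC mulN1r addrC.
have N3 : N (3 : C) = 3.
  by rewrite -[3 : C]/(3%:R) -(rmorph_nat (real_complex R)) NC ger0_norm.
have N2 : N (2 : C) = 2.
  by rewrite -[2 : C]/(2%:R) -(rmorph_nat (real_complex R)) NC ger0_norm.
have := NleD (3 : C) (line_int (- r) r q); rewrite N3 E !NM N2 Ni; lra.
Qed.

End Square.

End Cauchy.

(** * Taylor expansion with an explicit remainder *)

Section Taylor.
Variable R : realType.
Local Notation C := (R[i]).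

Definition clamp (c x : R) : R := Num.max (- c) (Num.min c x).

Lemma clamp_id c x : `|x| <= c -> clamp c x = x.
Proof.
rewrite ler_norml => /andP[a b]; rewrite /clamp.
by rewrite min_r // max_r.
Qed.

Lemma clamp_le c x : 0 <= c -> `|clamp c x| <= c.
Proof.
move=> c0; rewrite ler_norml /clamp le_max lexx /= ge_max ge_min lexx andbT /=.
by rewrite ge0_cp.
Qed.

Lemma clamp_lip c x y : `|clamp c x - clamp c y| <= `|x - y|.
Proof.
have mx (a u v : R) : `|Num.max a u - Num.max a v| <= `|u - v|.
  have h1 := ler_norm (u - v); have h2 := ler_norm (v - u); rewrite distrC in h2.
  by rewrite ler_norml; case: (leP a u) => ?; case: (leP a v) => ?; apply/andP; split; lra.
have mn (a u v : R) : `|Num.min a u - Num.min a v| <= `|u - v|.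
  have h1 := ler_norm (u - v); have h2 := ler_norm (v - u); rewrite distrC in h2.
  by rewrite ler_norml; case: (leP a u) => ?; case: (leP a v) => ?; apply/andP; split; lra.
exact: le_trans (mx _ _ _) (mn _ _ _).
Qed.

(** The nearest-point retraction of C onto a square. Composition with it extends a function to a
    continuous function on all of C without changing it on the square. *)
Definition clampC (c : R) (z : C) : C :=
  clamp c (complex.Re z) +i* clamp c (complex.Im z).

Lemma clampC_le c z : 0 <= c -> N (clampC c z) <= 2 * c.
Proof.
move=> c0; rewrite (le_trans (N_le_ReIm _)) //= mulrDl mul1r.
by rewrite lerD // clamp_le.
Qed.

Lemma clampC_lip c z w : N (clampC c z - clampC c w) <= 2 * N (z - w).
Proof.
rewrite (le_trans (N_le_ReIm _)) // mulrDl mul1r.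
case: z w => [a b] [a' b'] /=; rewrite lerD // (le_trans (clamp_lip _ _ _)) //.
  exact: (Re_le_N ((a - a') +i* (b - b'))).
exact: (Im_le_N ((a - a') +i* (b - b'))).
Qed.

Lemma clampC_id c z : `|complex.Re z| <= c -> `|complex.Im z| <= c -> clampC c z = z.
Proof. by case: z => a b /= ac bc; rewrite /clampC /= !clamp_id. Qed.

(** Cauchy's formula on the square of half side rho / 4 comes from goursat_except for the
    difference quotient at a; then the kernel is expanded in powers of a. *)
Theorem taylor (f : C -> C) (rho B : R) : 0 < rho ->
  (forall z, N z < rho -> hol f z) -> (forall z, N z < rho -> N (f z) <= B) ->
  exists2 c : nat -> C, forall k, N (c k) <= 2 * B / (rho / 4) ^+ k &
    forall n a, N a <= rho / 8 ->
      N (f a - \sum_(k < n) a ^+ k * c k) <= 4 * B * (N a / (rho / 4)) ^+ n.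
Proof.
move=> rho0 hf fB; pose r := rho / 4; pose s := rho / 3.
have r0 : 0 < r by rewrite divr_gt0.
have rs : r < s by rewrite /r /s; lra.
have s0 : 0 < s := lt_trans r0 rs.
have s2 z : N (clampC s z) < rho.
  rewrite (le_lt_trans (clampC_le _ (ltW s0))) // /s; lra.
have B0 : 0 <= B by rewrite (le_trans (N_ge0 _) (fB 0 _)) // N0.
pose F z := f (clampC s z).
have cF : ccont F.
  move=> z e e0; have [d d0 dP] := hol_cont (hf _ (s2 z)) e0.
  exists (d / 2) => [|h hd]; first by rewrite divr_gt0.
  have := dP (clampC s (z + h) - clampC s z).
  rewrite [_ + (_ - _)]addrC subrK; apply.
  rewrite (le_lt_trans (clampC_lip _ _ _)) // addrC addKr; lra.
have FB z : N (F z) <= B by exact: fB.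
have Ff z : `|complex.Re z| <= s -> `|complex.Im z| <= s -> F z = f z.
  by move=> a b; rewrite /F clampC_id.
have hF z : `|complex.Re z| < s -> `|complex.Im z| < s -> hol F z.
  move=> a b; apply: (@hol_near _ _ _ f).
    apply/nearE; exists (Num.min (s - `|complex.Re z|) (s - `|complex.Im z|)).
      by rewrite lt_min !subr_gt0 a b.
    move=> h; rewrite lt_min => /andP[h1 h2]; rewrite Ff // raddfD /=.
      rewrite (le_trans (ler_normD _ _)) //; have := Re_le_N h; lra.
    rewrite (le_trans (ler_normD _ _)) //; have := Im_le_N h; lra.
  by have := hf _ (s2 z); rewrite clampC_id // ltW.
have cl : forall z, onlines r z -> contat F z by move=> z _; exact: cF.
have cl1 : forall z, onlines r z -> contat (fun=> 1 : C) z.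
  by move=> z _; apply/contat_hol/hol_cst.
have K4 := inv_contour_ge r0.
have K0' : inv_contour r != 0.
  by apply: contraTneq K4 => ->; rewrite N0 -ltNge.
have cauchy a : N a <= r / 2 -> remain r F 0 a = f a * inv_contour r.
  move=> Na.
  have ar1 : `|complex.Re a| < r by rewrite (le_lt_trans (Re_le_N _)) // (le_lt_trans Na); lra.
  have ar2 : `|complex.Im a| < r by rewrite (le_lt_trans (Im_le_N _)) // (le_lt_trans Na); lra.
  have Fa : F a = f a by apply: Ff; rewrite ltW // (lt_trans _ rs).
  have [l lP] := hol1_der (hF a (lt_trans ar1 rs) (lt_trans ar2 rs)).
  (* the difference quotient, continued to a by the derivative *)
  pose g z := if z == a then l else (F z - F a) * (z - a)^-1.
  have hg z : z != a -> hol (fun z => (z - a)^-1) z.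
    by move=> za; apply: holV; rewrite ?subr_eq0 //; apply: holB; [exact: hol_id|exact: hol_cst].
  have nearg z : z != a -> \forall y \near z, (F y - F a) * (y - a)^-1 = g y.
    move=> za; apply/nearE; exists (N (z - a)); first by rewrite N_gt0 // subr_eq0.
    move=> h hz; rewrite /g ifN //; apply: contraTneq hz => <-.
    by rewrite opprD addNKr NN ltxx.
  have cg : ccont g.
    move=> z; have [->|za] := eqVneq z a.
      move=> e e0; have [_ _ /(_ (e / 2))] := lP.
      move=> []; first by rewrite divr_gt0.
      move=> d d0 dP; exists d => // h hd; rewrite /g eqxx.
      have [->|h0] := eqVneq h 0; first by rewrite addr0 eqxx subrr N0.
      rewrite ifN; last by rewrite -subr_eq0 addrAC subrr add0r.
      rewrite (_ : _ - l = (F (a + h) - F a - h * l) * h^-1); last first.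
        by rewrite (_ : a + h - a = h); [field|ring].
      rewrite NM NV ltr_pdivrMr ?N_gt0 // (le_lt_trans (dP _ hd)) // ltr_pM2r ?N_gt0 //; lra.
    have H : contat (fun y => (F y - F a) * (y - a)^-1) z.
      apply: contatM; last exact/contat_hol/hg.
      by apply: contatB; [exact: cF|exact/contat_hol/hol_cst].
    move=> e /H[d d0 dP]; have [e' e'0 eP] := (nearE _ _).1 (nearg z za).
    exists (Num.min d e'); first by rewrite lt_min d0.
    move=> h; rewrite lt_min => /andP[/dP + /eP <-].
    by have := eP 0; rewrite addr0 N0 => <-.
  have := @goursat_except _ g r a cg ar1 ar2.
  have key : rect_int g (- r) r (- r) r = remain r F 0 a + - F a * remain r (fun=> 1) 0 a.
    rewrite addrC /remain -(square_int_lin r0); try exact: cline_remain.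
    apply: (square_int_eq r0) => z zl; rewrite /g ifN; first by rewrite !expr0; ring.
    have [za _] := hol_inv_line r0 Na zl.
    by rewrite -subr_eq0.
  rewrite key (remain_cst r0 Na) Fa => H.
  apply/eqP; rewrite -subr_eq0 -mulNr; apply/eqP; apply: H => x y.
  rewrite -!ler_norml => xr yr za.
  apply: (hol_near (nearg _ za)); apply: holM (hg _ za).
  apply: holB; last exact: hol_cst.
  by apply: hF => /=; apply: le_lt_trans rs.
exists (fun k => (inv_contour r)^-1 * moment r F k) => [k|n a Na].
  rewrite NM NV mulrC ler_pdivrMr ?(lt_le_trans _ K4) //.
  apply: (le_trans (moment_le r0 k cl B0 _)) => //.
  rewrite -/r [leLHS](_ : _ = 2 * B / r ^+ k * 4); last by ring.
  by rewrite ler_wpM2l // divr_ge0 ?exprn_ge0 ?mulr_ge0 // ltW.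
have Na' : N a <= r / 2 by rewrite /r; lra.
rewrite (_ : _ - _ = (inv_contour r)^-1 * (a ^+ n * remain r F n a)); last first.
  have := remain_expand r0 n Na' cl; rewrite cauchy // => E.
  rewrite (_ : a ^+ n * _ = f a * inv_contour r - \sum_(k < n) a ^+ k * moment r F k); last first.
    by rewrite E addrC addKr.
  rewrite mulrBr mulrCA mulVf // mulr1 mulr_sumr; congr (_ - _).
  by apply: eq_bigr => k _; rewrite mulrCA.
rewrite NM NV mulrC ler_pdivrMr ?(lt_le_trans _ K4) //.
apply: (le_trans (remain_le r0 n Na' cl B0 _)) => //.
rewrite -/r [leLHS](_ : _ = 4 * B * (N a / r) ^+ n * 4); last by ring.
by rewrite ler_wpM2l // !mulr_ge0 ?exprn_ge0 ?divr_ge0 ?N_ge0 // ltW.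
Qed.

End Taylor.

(** * Estimates and limits in several variables *)

Section Limits.
Variable R : realType.
Local Notation C := (R[i]).

Definition seqlim (u : nat -> C) (l : C) :=
  forall e : R, 0 < e -> exists n, forall k, (n <= k)%N -> N (u k - l) <= e.

Lemma seqlim_lin (a : C) u v k l : seqlim u k -> seqlim v l ->
  seqlim (fun n => a * u n + v n) (a * k + l).
Proof.
move=> uk vl e e0; have a0 : 0 < N a + 1 by rewrite ltr_wpDl ?N_ge0.
have a1 : 0 < 2 * (N a + 1) by rewrite mulr_gt0 // ltr_wpDl ?N_ge0.
have [n1 h1] := uk (e / (2 * (N a + 1))) (divr_gt0 e0 a1).
have [n2 h2] := vl (e / 2) (divr_gt0 e0 (ltr0Sn _ 1)).
exists (maxn n1 n2) => m; rewrite geq_max => /andP[/h1 m1 /h2 m2].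
rewrite (_ : _ - _ = a * (u m - k) + (v m - l)); last by ring.
rewrite (le_trans (ND _ _)) // (splitr e) lerD // NM.
rewrite (le_trans (ler_wpM2l (N_ge0 _) m1)) //.
rewrite [leLHS](_ : _ = e / 2 * (N a / (N a + 1))); last first.
  by field; rewrite gt_eqF.
by rewrite ler_piMr ?divr_ge0 ?(ltW e0) // ler_pdivrMr ?mul1r ?lerDl.
Qed.

Lemma seqlim_le u l M : seqlim u l -> (forall k, N (u k) <= M) -> N l <= M.
Proof.
move=> ul uM; apply/ler_addgt0Pr => e /ul[n /(_ n (leqnn n)) h].
rewrite (le_trans (NleD _ (u n))) // addrC lerD // NBC //.
Qed.

Lemma seqlim_uniq u k l : seqlim u k -> seqlim u l -> k = l.
Proof.
move=> uk ul; apply/eqP; rewrite -subr_eq0; apply/eqP/N_eq0/eqP.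
rewrite eq_le N_ge0 andbT.
apply: (@seqlim_le (fun n => -1 * u n + u n)) => [|n]; last first.
  by rewrite mulN1r addNr N0.
rewrite (_ : k - l = -1 * l + k); last by ring.
exact: seqlim_lin ul uk.
Qed.

Lemma real_cauchy (u : nat -> R) :
  (forall e : R, 0 < e -> exists n, forall k, (n <= k)%N -> `|u k - u n| <= e) ->
  exists l, forall e : R, 0 < e -> exists n, forall k, (n <= k)%N -> `|u k - l| <= e.
Proof.
move=> cu; pose S := [set x | exists n, forall k, (n <= k)%N -> x <= u k].
have bnd e n : (forall k, (n <= k)%N -> `|u k - u n| <= e) ->
    S (u n - e) /\ ubound S (u n + e).
  move=> h; split.
    by exists n => k /h; rewrite ler_norml => /andP[a _]; lra.
  move=> x [m hm]; have := hm _ (leq_maxr n m).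
  have := h _ (leq_maxl n m); rewrite ler_norml => /andP[_]; lra.
have [n1 /bnd[s1 b1]] := cu 1 ltr01.
exists (sup S) => e e0; have e2 : 0 < e / 2 by rewrite divr_gt0.
have [n h] := cu _ e2; have [sn bn] := bnd _ _ h.
exists n => k /h; rewrite !ler_norml => /andP[a b].
have : u n - e / 2 <= sup S by apply: ub_le_sup => //; eexists; exact: b1.
have : sup S <= u n + e / 2 by apply: ge_sup => //; eexists; exact: s1.
by move=> *; apply/andP; split; lra.
Qed.

Lemma complex_cauchy (u : nat -> C) :
  (forall e : R, 0 < e -> exists n, forall k, (n <= k)%N -> N (u k - u n) <= e) ->
  exists l, seqlim u l.
Proof.
move=> cu.
have [x xP] : exists l, forall e : R, 0 < e -> exists n, forall k, (n <= k)%N ->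
    `|complex.Re (u k) - l| <= e.
  apply: real_cauchy => e /cu[n h]; exists n => k /h; apply: le_trans.
  by rewrite -raddfB; exact: Re_le_N.
have [y yP] : exists l, forall e : R, 0 < e -> exists n, forall k, (n <= k)%N ->
    `|complex.Im (u k) - l| <= e.
  apply: real_cauchy => e /cu[n h]; exists n => k /h; apply: le_trans.
  by rewrite -raddfB; exact: Im_le_N.
exists (x +i* y) => e e0; have e2 : 0 < e / 2 by rewrite divr_gt0.
have [n1 h1] := xP _ e2; have [n2 h2] := yP _ e2.
exists (maxn n1 n2) => m; rewrite geq_max => /andP[/h1 m1 /h2 m2].
rewrite (le_trans (N_le_ReIm _)) //.
by case: (u m) m1 m2 => a b /= m1 m2; rewrite (splitr e) lerD.
Qed.

End Limits.

Section Several.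
Variables (R : realType) (V : normedModType R[i]).
Local Notation C := (R[i]).
Implicit Types (f : V -> C) (x h v : V).

Definition bhol f x (r B : R) := (forall h, N h < r -> hol f (x + h)) /\
  (forall h, N h < r -> N (f (x + h)) <= B).

Lemma bhol_sub f x r B h : bhol f x r B -> bhol f (x + h) (r - N h) B.
Proof.
move=> [fh fB]; split=> k kr; rewrite -addrA.
  by apply: fh; rewrite (le_lt_trans (ND _ _)) // -ltrBrDl.
by apply: fB; rewrite (le_lt_trans (ND _ _)) // -ltrBrDl.
Qed.

Lemma bhol_shrink f x r r' B : r' <= r -> bhol f x r B -> bhol f x r' B.
Proof. by move=> rr [a b]; split=> h hr; [apply: a|apply: b]; exact: lt_le_trans rr. Qed.

Lemma bhol_ge0 f x r B : 0 < r -> bhol f x r B -> 0 <= B.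
Proof. by move=> r0 [_ /(_ 0)]; rewrite N0 => /(_ r0); apply: le_trans; exact: N_ge0. Qed.

(** Restrict f to the complex line through x and x + h, and use the expansion in one variable
    to orders one and two. *)
Lemma bhol_expand f x r B L h : 0 < r -> bhol f x r B -> is_der f x L -> N h <= r / 8 ->
  [/\ N (f (x + h) - f x) <= 16 * B / r * N h,
      N (f (x + h) - f x - L h) <= 64 * B / r ^+ 2 * N h ^+ 2 &
      N (L h) <= 8 * B / r * N h].
Proof.
move=> r0 fb fL hr; have B0 := bhol_ge0 r0 fb; case: fb => fh fB.
have [l1 _ _] := fL.
have [->|h0] := eqVneq h 0.
  by rewrite addr0 subrr (lin0 l1) subrr !N0 expr0n /= !mulr0; split.
have Nh := N_gt0 h0.
(* rescale h to norm r, so that the line is parametrized by the unit disc *)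
pose u := (r / N h)%:C *: h.
have Nu : N u = r.
  by rewrite NZ NC gtr0_norm ?divr_gt0 // divfK // gt_eqF.
pose phi (s : C) := f (x + s *: u).
have hphi z : N z < 1 -> hol phi z.
  by move=> z1; apply/hol_line/fh; rewrite NZ Nu gtr_pMl.
have phiB z : N z < 1 -> N (phi z) <= B.
  by move=> z1; apply/fB; rewrite NZ Nu gtr_pMl.
have [c cB cE] := taylor ltr01 hphi phiB.
have phi0 : phi 0 = f x by rewrite /phi scale0r addr0.
have c0 : c 0%N = f x.
  have := cE 1%N 0; rewrite N0 mul0r expr1 mulr0 big_ord1 expr0 mul1r phi0.
  move=> H; apply/esym/eqP; rewrite -subr_eq0; apply/eqP/N_eq0/eqP.
  by rewrite eq_le N_ge0 andbT H // divr_ge0.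
have c1 : c 1%N = L u.
  have d1 : is_der phi 0 (fun h : C => h * L u).
    have H : is_der f (x + (0 : C) *: u) L by rewrite scale0r addr0.
    exact: is_der_line H.
  have d2 : is_der phi 0 (fun h : C => h * c 1%N).
    split=> [a s t||e e0].
    - by rewrite -[a *: s]/(a * s) -[a *: (s * _)]/(a * (s * _)); ring.
    - by exists (N (c 1%N)) => [|v]; rewrite ?N_ge0 // NM mulrC.
    pose K := 64 * B + 1; have K0 : 0 < K by rewrite ltr_wpDl // mulr_ge0.
    exists (Num.min (1 / 8) (e / K)) => [|t]; first by rewrite lt_min !divr_gt0.
    rewrite lt_min => /andP[t1 t2]; have := cE 2%N t (ltW t1).
    rewrite 2!big_ord_recl big_ord0 expr0 mul1r expr1 addr0 /= c0.
    rewrite add0r phi0 opprD addrA => H; apply: (le_trans H).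
    have t3 : N t * K <= e by rewrite -ler_pdivlMr // ltW.
    rewrite [leLHS](_ : _ = (N t * (64 * B)) * N t); last by field.
    rewrite ler_wpM2r ?N_ge0 // (le_trans _ t3) // ler_wpM2l ?N_ge0 // lerDl //.
  by have := is_der_uniq d2 d1 1; rewrite !mul1r.
pose a : C := (N h / r)%:C.
have Na : N a = N h / r by rewrite NC ger0_norm // divr_ge0 ?N_ge0 ?ltW.
have au : a *: u = h.
  rewrite scalerA -rmorphM (_ : _ * _ = 1) ?scale1r //.
  by field; rewrite !gt_eqF.
have a8 : N a <= 1 / 8 by rewrite Na ler_pdivrMr // [leRHS](_ : _ = r / 8) //; field.
have pa : phi a = f (x + h) by rewrite /phi au.
have La : a * c 1%N = L h by rewrite c1 -[LHS]/(a *: L u) -(linZ l1) au.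
split.
- have := cE 1%N a a8; rewrite big_ord1 expr0 mul1r c0 pa Na => H.
  by apply: (le_trans H); apply: le_of_eq; field; rewrite gt_eqF.
- have := cE 2%N a a8; rewrite 2!big_ord_recl big_ord0 expr0 mul1r expr1 addr0 /= c0 La pa Na.
  rewrite opprD addrA => H; apply: (le_trans H).
  by apply: le_of_eq; field; rewrite gt_eqF.
have := cB 1%N => H; rewrite -La NM Na mulrC.
apply: (le_trans (ler_wpM2r _ H)); first by rewrite divr_ge0 ?N_ge0 // ltW.
by apply: le_of_eq; field; rewrite gt_eqF.
Qed.

(** Cauchy's estimate for the gradient. By homogeneity it suffices to treat a short vector. *)
Lemma bhol_grad f x r B L v : 0 < r -> bhol f x r B -> is_der f x L ->
  N (L v) <= 8 * B / r * N v.
Proof.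
move=> r0 fb fL; have [l1 _ _] := fL.
have v1 : 0 < N v + 1 by rewrite ltr_wpDl ?N_ge0.
pose t := r / (8 * (N v + 1)); have t0 : 0 < t by rewrite divr_gt0 // mulr_gt0.
have Nt : N (t%:C *: v) = t * N v by rewrite NZ NC gtr0_norm.
have tr : N (t%:C *: v) <= r / 8.
  rewrite Nt [leLHS](_ : _ = r / 8 * (N v / (N v + 1))); last first.
    by rewrite /t; field; rewrite gt_eqF.
  by rewrite ler_piMr ?divr_ge0 ?(ltW r0) // ler_pdivrMr // mul1r lerDl.
have [_ _] := bhol_expand r0 fb fL tr.
by rewrite (linZ l1) Nt NZ NC gtr0_norm // mulrCA ler_pM2l.
Qed.

Lemma hol_bhol f x : hol f x -> (\forall y \near x, hol f y) ->
  exists r B : R, 0 < r /\ bhol f x r B.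
Proof.
move=> fx /nearE[r1 r10 h1]; have [r2 r20 h2] := hol_cont fx ltr01.
exists (Num.min r1 r2), (1 + N (f x)); split; first by rewrite lt_min r10.
split=> h; rewrite lt_min => /andP[a b]; first exact: h1.
by rewrite (le_trans (NleD _ (f x))) // lerD2r ltW // h2.
Qed.

End Several.

Section Weierstrass.
Variables (R : realType) (V : normedModType R[i]).
Local Notation C := (R[i]).

(** Weierstrass' theorem. By bhol_grad, applied to differences, the derivatives at a point
    form a Cauchy sequence. The bound of bhol_expand on the second-order remainder is the same
    for all members of the sequence and therefore passes to the limit. *)
Theorem hol_lim (fk : nat -> V -> C) (f : V -> C) x (r B : R) :
  (forall k, bhol (fk k) x r B) ->
  (forall e : R, 0 < e -> exists n, forall k, (n <= k)%N ->
     forall h, N h < r -> N (fk k (x + h) - f (x + h)) <= e) ->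
  bhol f x r B.
Proof.
move=> fb cv; have pt h : N h < r -> seqlim (fun k => fk k (x + h)) (f (x + h)).
  by move=> hr e /cv[n nP]; exists n => k /nP; exact.
split=> [h0 h0r|h hr]; last first.
  by apply: seqlim_le (pt h hr) _ => k; case: (fb k) => _; exact.
pose y := x + h0; pose s := r - N h0; have s0 : 0 < s by rewrite subr_gt0.
have fs k : bhol (fk k) y s B by exact: bhol_sub.
have yE h : N h < s -> N (h0 + h) < r.
  by rewrite /s => hs; rewrite (le_lt_trans (ND _ _)) // -ltrBrDl.
have [L Ld] : {L : nat -> V -> C & forall k, is_der (fk k) y (L k)}.
  apply: (choice (P := fun k l => is_der (fk k) y l)) => k.
  by have [+ _] := fs k; move=> /(_ 0); rewrite N0 addr0; apply.
have llin k : forall a u v, L k (a *: u + v) = a *: L k u + L k v by case: (Ld k).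
have /choice[l lP] : forall v, exists l, seqlim (fun k => L k v) l.
  move=> v; apply: complex_cauchy => e e0.
  have v1 : 0 < N v + 1 by rewrite ltr_wpDl ?N_ge0.
  pose e' := e / (16 * (N v + 1)) * s.
  have e'0 : 0 < e' by rewrite mulr_gt0 // divr_gt0 // mulr_gt0.
  have [n nP] := cv _ e'0; exists n => k nk.
  have bd : bhol (fun z => fk k z + -1 *: fk n z) y s (2 * e').
    split=> h hs.
      by apply: holD; [case: (fs k) => + _; apply|apply: holZ; case: (fs n) => + _; apply].
    rewrite /y -addrA -[_ *: _]/(-1 * _) mulN1r.
    rewrite (le_trans (NB3 (f (x + (h0 + h))) _ _)) // mulrDl mul1r lerD //.
      by apply: nP => //; exact: yE.
    by rewrite NBC; apply: nP => //; exact: yE.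
  have dd := is_derD (Ld k) (is_derZ (-1) (Ld n)).
  have := bhol_grad v s0 bd dd.
  rewrite -[_ *: _]/(-1 * _) mulN1r => /le_trans; apply.
  rewrite [leLHS](_ : _ = e * (N v / (N v + 1))); last first.
    by rewrite /e'; field; rewrite !gt_eqF.
  by rewrite ler_piMr ?(ltW e0) // ler_pdivrMr // mul1r lerDl.
exists l; have B0 : 0 <= B := bhol_ge0 s0 (fs 0%N); split.
- move=> a u v; apply: (seqlim_uniq (lP _)).
  rewrite (_ : (fun k => _) = fun k => a * L k u + L k v); first exact: seqlim_lin.
  by apply/funext => k; rewrite llin.
- exists (8 * B / s) => [|v]; first by rewrite divr_ge0 ?mulr_ge0 // ltW.
  by apply: seqlim_le (lP v) _ => k; exact: bhol_grad (fs k) (Ld k).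
move=> e e0; pose K := 64 * B / s ^+ 2 + 1.
have K0 : 0 < K by rewrite ltr_wpDl // divr_ge0 ?mulr_ge0 // ltW.
exists (Num.min (s / 8) (e / K)) => [|h]; first by rewrite lt_min !divr_gt0.
rewrite lt_min => /andP[hs he].
have hs' : N h < s by rewrite (lt_trans hs) // ltr_pdivrMr // ltr_pMr // ltr1n.
apply: (@le_trans _ _ (64 * B / s ^+ 2 * N h ^+ 2)).
  have sl : seqlim (fun k => -1 * L k h + (-1 * fk k y + fk k (y + h)))
      (-1 * l h + (-1 * f y + f (y + h))).
    apply: seqlim_lin; first exact: lP.
    apply: seqlim_lin; first exact: pt.
    by rewrite /y -addrA; apply/pt/yE.
  rewrite (_ : _ - _ = -1 * l h + (-1 * f y + f (y + h))); last by ring.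
  apply: seqlim_le sl _ => k.
  rewrite (_ : _ + _ = fk k (y + h) - fk k y - L k h); last by ring.
  by case: (bhol_expand s0 (fs k) (Ld k) (ltW hs)).
rewrite expr2 mulrA ler_wpM2r ?N_ge0 //.
have : N h * K <= e by rewrite -ler_pdivlMr // ltW.
by apply: le_trans; rewrite mulrC ler_wpM2l ?N_ge0 // lerDl.
Qed.

End Weierstrass.

(** * Identity principle and directional derivatives *)

Section Identity.
Variable R : realType.
Local Notation C := (R[i]).

Lemma small_quotient (K e : R) : 0 <= K -> 0 < e -> exists n, forall k, (n <= k)%N ->
  K / k.+1%:R <= e.
Proof.
move=> K0 e0; exists (Num.truncn (K / e)) => k nk.
rewrite ler_pdivrMr ?ltr0Sn // mulrC -ler_pdivrMr // ltW //.
by rewrite (lt_le_trans (truncnS_gt _)) // ler_nat ltnS.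
Qed.

(** The form in which lowest-order coefficients are identified: a bound that is proportional to
    every small positive s is at most 0. *)
Lemma le_of_scale (x K d : R) : 0 < d -> (forall s, 0 < s -> s < d -> x <= K * s) -> x <= 0.
Proof.
move=> d0 xK; rewrite leNgt; apply/negP => x0.
have K0 : 0 < K + 1.
  have := xK (d / 2); rewrite divr_gt0 // => /(_ isT); rewrite ltr_pdivrMr // ltr_pMr // ltr1n.
  move=> /(_ isT) H; rewrite ltr_wpDl // leNgt; apply/negP => K0.
  have : K * (d / 2) < 0 by rewrite nmulr_rlt0 // divr_gt0.
  lra.
pose s := Num.min (d / 2) (x / (2 * (K + 1))).
have s0 : 0 < s by rewrite lt_min !divr_gt0 // mulr_gt0.
have sd : s < d by rewrite (@le_lt_trans _ _ (d / 2)) ?ge_min ?lexx //; lra.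
have := xK s s0 sd.
have : s * (2 * (K + 1)) <= x by rewrite -ler_pdivlMr ?mulr_gt0 // ge_min lexx orbT.
have : 0 < s * (K + 1) by rewrite mulr_gt0.
lra.
Qed.

Lemma geo_null (x K : R) : (forall n, x <= K * 2^-1 ^+ n) -> x <= 0.
Proof.
move=> xK; rewrite leNgt; apply/negP => x0.
have K0 : 0 < K by have := xK 0%N; rewrite expr0 mulr1; exact: lt_le_trans.
have := xK (Num.truncn (K / x)).+1; rewrite exprVn leNgt => /negP; apply.
rewrite ltr_pdivrMr ?exprn_gt0 // mulrC -ltr_pdivrMr //.
apply: lt_trans (truncnS_gt _) _.
by rewrite -natrX ltr_nat ltn_expl.
Qed.

(** If c k is the first nonzero Taylor coefficient, then at real points s the expansion gives
    |c k| s^k = O(s^(k+1)). *)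
Lemma taylor_null (f : C -> C) (rho B d : R) : 0 < rho -> 0 < d ->
  (forall z, N z < rho -> hol f z) -> (forall z, N z < rho -> N (f z) <= B) ->
  (forall s : R, 0 < s -> s < d -> f s%:C = 0) ->
  forall z, N z <= rho / 8 -> f z = 0.
Proof.
move=> rho0 d0 fh fB f0 z zr.
have [c cB cE] := taylor rho0 fh fB.
pose r := rho / 4; have r0 : 0 < r by rewrite divr_gt0.
have ck k : c k = 0.
  have [n] := ubnP k; elim: n k => // n ih k; rewrite ltnS => kn.
  apply: N_le0.
  pose e := Num.min d (rho / 8); have e0 : 0 < e by rewrite lt_min d0 divr_gt0.
  apply: (@le_of_scale _ (4 * B / r ^+ k.+1) e) => // s s0.
  rewrite lt_min => /andP[sd sr].
  have Ns : N (s%:C : C) = s by rewrite NC gtr0_norm.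
  have := cE k.+1 s%:C; rewrite Ns => /(_ (ltW sr)).
  rewrite f0 // big_ord_recr /= big1 => [|j _]; last first.
    by rewrite ih ?mulr0 // (leq_trans (ltn_ord j)).
  rewrite !add0r NN NM NX Ns expr_div_n exprSr mulrA => H.
  rewrite -(ler_pM2l (exprn_gt0 k s0)) (le_trans H) //.
  by rewrite -/r; apply: le_of_eq; ring.
apply: N_le0.
apply: (@geo_null _ (4 * B)) => n.
have := cE n z zr; rewrite big1 => [|j _]; last by rewrite ck mulr0.
rewrite subr0 => H; rewrite (le_trans H) // ler_wpM2l //.
  by rewrite mulr_ge0 // (le_trans (N_ge0 _) (fB 0 _)) // N0.
rewrite lerXn2r ?nnegrE ?divr_ge0 ?N_ge0 ?(ltW rho0) //.
by rewrite -/r ler_pdivrMr // (le_trans zr) // /r; lra.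
Qed.

Variable V : normedModType C.
Implicit Types (f : V -> C) (x h v : V).

(** On each complex line through 0 this is taylor_null. *)
Lemma bhol_null_near f (r B : R) : 0 < r -> bhol f 0 r B ->
  (\forall x \near (0 : V), f x = 0) -> forall h, N h < r / 8 -> f h = 0.
Proof.
move=> r0 [fh fB] /near0E[d d0 f0] h hr.
have [->|h0] := eqVneq h 0; first by apply: f0; rewrite N0.
have Nh := N_gt0 h0.
have lt (z : C) : N z < 8 -> N (z *: h) < r.
  move=> z8; rewrite NZ (lt_trans (_ : _ < 8 * N h)) ?ltr_pM2r //; lra.
have := @taylor_null (fun z => f (0 + z *: h)) 8 B (d / N h) _ _ _ _ _ 1.
rewrite add0r scale1r N1 divff //; apply=> //; first by rewrite divr_gt0.
- by move=> z /lt zr; apply/hol_line/fh.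
- by move=> z /lt zr; apply: fB.
move=> s s0 sd; apply: f0; rewrite add0r NZ NC gtr0_norm //.
by rewrite -ltr_pdivlMr.
Qed.

End Identity.

Section Derivative.
Variables (R : realType) (V : normedModType R[i]).
Local Notation C := (R[i]).
Implicit Types (f : V -> C) (x h v : V).

(** The derivative in a fixed direction is a uniform limit of difference quotients, hence
    holomorphic by Weierstrass' theorem. *)
Lemma bhol_dir f x (r B : R) v : 0 < r -> bhol f x r B ->
  exists g : V -> C, (exists B', bhol g x (r / 2) B') /\
    forall h, N h < r / 2 -> forall L, is_der f (x + h) L -> L v = g (x + h).
Proof.
move=> r0 fb; have B0 := bhol_ge0 r0 fb.
pose s := r / 2; have s0 : 0 < s by rewrite divr_gt0.
have fs h : N h < s -> bhol f (x + h) s B.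
  move=> hs; apply: bhol_shrink (bhol_sub h fb); rewrite /s in hs *; lra.
have v1 : 0 < N v + 1 by rewrite ltr_wpDl ?N_ge0.
pose d0 := s / (8 * (N v + 1)); have d00 : 0 < d0 by rewrite divr_gt0 // mulr_gt0.
(* the steps of the difference quotients *)
pose t (k : nat) : R := d0 / k.+1%:R.
have t0 k : 0 < t k by rewrite divr_gt0.
have td k : t k <= d0 by rewrite /t ler_pdivrMr // (ler_peMr (ltW d00)) // ler1n.
have Nt k : N ((t k)%:C : C) = t k by rewrite NC gtr0_norm.
have tv k : N ((t k)%:C *: v) <= s / 8.
  rewrite NZ Nt (le_trans (ler_wpM2r (N_ge0 _) (td k))) //.
  rewrite [leLHS](_ : _ = s / 8 * (N v / (N v + 1))); last first.
    by rewrite /d0; field; rewrite gt_eqF.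
  by apply: ler_piMr; [rewrite ltW // divr_gt0|rewrite ler_pdivrMr // mul1r lerDl].
have tE k : t k = d0 / k.+1%:R by [].
clearbody t.
have [L LP] : {L : V -> V -> C & forall y, N (y - x) < s -> is_der f y (L y)}.
  apply: (choice (P := fun y l => N (y - x) < s -> is_der f y l)) => y.
  have [ys|ys] := ltP (N (y - x)) s; last by exists (fun=> 0).
  have [+ _] := fs _ ys; move=> /(_ 0); rewrite N0 addr0 [x + _]addrC subrK.
  by move=> /(_ s0)[l lP]; exists l.
have LPx h : N h < s -> is_der f (x + h) (L (x + h)).
  by move=> hs; apply: LP; rewrite addrAC subrr add0r.
pose q k y := (t k)^-1%:C * (f (y + (t k)%:C *: v) - f y).
have qL k h : N h < s -> N (q k (x + h) - L (x + h) v) <= 64 * B / s ^+ 2 * N v ^+ 2 * t k.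
  move=> hs; have := bhol_expand s0 (fs h hs) (LPx h hs) (tv k).
  move=> [_ H _]; have [l1 _ _] := LPx h hs.
  have tn : (t k)%:C != 0 :> C by rewrite fmorph_eq0 gt_eqF.
  rewrite (_ : _ - _ = (t k)^-1%:C * (f (x + h + (t k)%:C *: v) - f (x + h) -
      L (x + h) ((t k)%:C *: v))); last first.
    by rewrite /q (linZ l1) -[_ *: L _ _]/(_ * _) [RHS]mulrBr fmorphV mulKf.
  rewrite NM fmorphV NV Nt ler_pdivrMl // (le_trans H) // NZ Nt.
  by apply: le_of_eq; ring.
have qB k h : N h < s -> N (q k (x + h)) <= 16 * B / s * N v.
  move=> hs; have := bhol_expand s0 (fs h hs) (LPx h hs) (tv k).
  move=> [H _ _]; rewrite /q NM fmorphV NV Nt ler_pdivrMl // (le_trans H) // NZ Nt.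
  by apply: le_of_eq; ring.
exists (fun y => L y v); split.
  exists (16 * B / s * N v); apply: (@hol_lim _ _ q).
    move=> k; split=> h hs; last exact: qB.
    apply: holM; first exact: hol_cst.
    apply: holB; last by case: fb => fh _; apply: fh; rewrite (lt_trans hs) // /s; lra.
    apply: (hol_comp (f := fun y => y + (t k)%:C *: v)).
      by apply: holD; [exact: hol_id|exact: hol_cst].
    case: fb => fh _; rewrite -addrA; apply: fh.
    rewrite (le_lt_trans (ND _ _)) //; have := tv k; rewrite /s in hs *; lra.
  move=> e e0; pose K := 64 * B / s ^+ 2 * N v ^+ 2 * d0.
  have K0 : 0 <= K.
    apply: mulr_ge0 (ltW d00); apply: mulr_ge0 (exprn_ge0 _ (N_ge0 _)).
    by apply: divr_ge0 (exprn_ge0 _ (ltW s0)); exact: mulr_ge0.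
  have [n nP] := small_quotient K0 e0; exists n => k nk h hs.
  by rewrite (le_trans (qL k h hs)) // tE mulrA nP.
move=> h hs L' LP'; exact: is_der_uniq LP' (LPx h hs) v.
Qed.

End Derivative.

(** * Expansion in the last variable and implicit functions *)

Section Param.
Variables (R : realType) (V : normedModType R[i]).
Local Notation C := (R[i]).
Implicit Types (f : (V * C)%type -> C) (x h v : V).

Lemma bhol_slice f (r B : R) : bhol f 0 r B -> forall x, N x < r ->
  (forall t : C, N t < r -> hol (fun t => f (x, t)) t) /\
  (forall t : C, N t < r -> N (f (x, t)) <= B).
Proof.
move=> [fh fB] x xr; split=> t tr; have xt := Npair_lt xr tr.
  apply: (hol_comp (f := fun t : C => (x, t) : (V * C)%type)).
    by apply: hol_pair; [exact: hol_cst|exact: hol_id].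
  by have := fh _ xt; rewrite add0r.
by have := fB _ xt; rewrite add0r.
Qed.

(** The coefficient of t^k is the uniform limit in x, as t -> 0, of the rest of order k divided
    by t^k, hence holomorphic in x by induction on k. *)
Lemma bhol_coef f (r B : R) : 0 < r -> bhol f 0 r B ->
  exists2 c : nat -> V -> C, forall k, exists B', bhol (c k) 0 r B' &
    forall n x t, N x < r -> N t <= r / 8 ->
      N (f (x, t) - \sum_(k < n) t ^+ k * c k x) <= 4 * B * (N t / (r / 4)) ^+ n.
Proof.
move=> r0 fb; have B0 := bhol_ge0 r0 fb; pose s := r / 4.
have s0 : 0 < s by rewrite divr_gt0.
have /choice[c cP] : forall x, exists c : nat -> C, N x < r ->
    (forall k, N (c k) <= 2 * B / s ^+ k) /\
    forall n t, N t <= r / 8 ->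
      N (f (x, t) - \sum_(k < n) t ^+ k * c k) <= 4 * B * (N t / s) ^+ n.
  move=> x; have [xr|xr] := ltP (N x) r; last by exists (fun=> 0).
  have [fh fB] := bhol_slice fb xr.
  by have [c c1 c2] := taylor r0 fh fB; exists c.
exists (fun k x => c x k); last by move=> n x t /cP[_]; exact.
move=> k; have [n] := ubnP k; elim: n k => // n ih k; rewrite ltnS => kn.
(* the values of t along which the limit is taken *)
pose t (l : nat) : R := r / 8 / l.+1%:R.
have t0 l : 0 < t l by rewrite !divr_gt0.
have t8 l : t l <= r / 8.
  by rewrite /t ler_pdivrMr //; apply: ler_peMr; [rewrite ltW // divr_gt0|rewrite ler1n].
have tE l : t l = r / 8 / l.+1%:R by [].
clearbody t.
have Nt l : N ((t l)%:C : C) = t l by rewrite NC gtr0_norm.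
pose q l x := (t l)^-1%:C ^+ k * (f (x, (t l)%:C) - \sum_(j < k) (t l)%:C ^+ j * c x j).
have qc l x : N x < r -> N (q l x - c x k) <= 4 * B / s ^+ k.+1 * t l.
  move=> xr; have [_ /(_ k.+1 (t l)%:C)] := cP x xr.
  rewrite Nt => /(_ (t8 l)) H.
  have tn : (t l)%:C != 0 :> C by rewrite fmorph_eq0 gt_eqF.
  rewrite (_ : q l x - c x k = (t l)^-1%:C ^+ k *
    (f (x, (t l)%:C) - \sum_(j < k.+1) (t l)%:C ^+ j * c x j)); last first.
    rewrite big_ord_recr /= opprD addrA [RHS]mulrBr /q fmorphV exprVn mulKf //.
    by rewrite expf_neq0.
  rewrite NM NX fmorphV NV Nt exprVn ler_pdivrMl ?exprn_gt0 // (le_trans H) //.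
  rewrite expr_div_n exprSr; apply: le_of_eq; ring.
exists (4 * B / s ^+ k.+1 * (r / 8) + 2 * B / s ^+ k); apply: (@hol_lim _ _ q).
  move=> l; split=> x xr.
    rewrite add0r; apply: holM; first exact: hol_cst.
    apply: holB.
      apply: (hol_comp (f := fun y : V => (y, (t l)%:C) : (V * C)%type)).
        by apply: hol_pair; [exact: hol_id|exact: hol_cst].
      case: fb => fh _; have := fh (x, (t l)%:C); rewrite add0r; apply.
      by apply: Npair_lt => //; rewrite Nt (le_lt_trans (t8 l)) //; lra.
    apply: hol_sum => j; apply: holM; first exact: hol_cst.
    have [B' [ch _]] := ih j (leq_trans (ltn_ord j) kn).
    by have := ch x xr; rewrite add0r.
  rewrite add0r (le_trans (NleD _ (c x k))) // lerD //.
    rewrite (le_trans (qc l x xr)) // ler_wpM2l // divr_ge0 ?mulr_ge0 //.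
    by rewrite exprn_ge0 // ltW.
  by case: (cP x xr).
move=> e e0; pose K := 4 * B / s ^+ k.+1 * (r / 8).
have K0 : 0 <= K.
  apply: mulr_ge0; last by rewrite ltW // divr_gt0.
  by apply: divr_ge0 (exprn_ge0 _ (ltW s0)); exact: mulr_ge0.
have [m mP] := small_quotient K0 e0; exists m => l lm x xr.
by rewrite add0r (le_trans (qc l x xr)) // tE mulrA mP.
Qed.

(** Either all coefficients of the powers of t vanish near 0, or the first one that does not is
    the leading coefficient. *)
Lemma lowest_order f : hol f 0 -> (\forall p \near (0 : (V * C)%type), hol f p) ->
  (\forall p \near (0 : (V * C)%type), f p = 0) \/
  exists m (c : V -> C), [/\ \forall x \near (0 : V), hol c x,
    ~ (\forall x \near (0 : V), c x = 0) &
    exists K d : R, [/\ 0 < K, 0 < d & forall x t, N x < d -> N t < d ->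
      N (f (x, t) - t ^+ m * c x) <= K * N t ^+ m.+1]].
Proof.
move=> f0 fn; have [r [B [r0 fb]]] := hol_bhol f0 fn.
have B0 := bhol_ge0 r0 fb.
have [c cb cE] := bhol_coef r0 fb.
have [all0|] := pselect (forall k, \forall x \near (0 : V), c k x = 0).
  left; apply/near0E; exists (r / 8); first by rewrite divr_gt0.
  move=> [x t] xt; have xr : N x < r / 8 := le_lt_trans (Nfst (x, t)) xt.
  have tr : N t < r / 8 := le_lt_trans (Nsnd (x, t)) xt.
  have ck k : c k x = 0.
    by have [B' cb'] := cb k; exact: bhol_null_near r0 cb' (all0 k) _ xr.
  apply: N_le0; apply: (@geo_null _ _ (4 * B)) => n.
  have := cE n x t; rewrite big1 => [|j _]; last by rewrite ck mulr0.
  rewrite subr0 => H; rewrite (le_trans (H _ _)) ?(ltW tr) //; first lra.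
  rewrite ler_wpM2l ?mulr_ge0 // lerXn2r ?nnegrE ?divr_ge0 ?N_ge0 ?(ltW r0) //.
  rewrite ler_pdivrMr ?divr_gt0 //; lra.
move=> /existsNP ex.
have exb : exists k, `[< ~ \forall x \near (0 : V), c k x = 0 >].
  by case: ex => k kP; exists k; apply/asboolP.
right; have [m /asboolP mP mmin] := ex_minnP exb.
have low n : (n <= m)%N -> exists2 d : R, 0 < d & forall j x, (j < n)%N -> N x < d -> c j x = 0.
  elim: n => [_|n ih nm]; first by exists 1.
  have [d d0 dP] := ih (ltnW nm).
  have : \forall x \near (0 : V), c n x = 0.
    by apply: contrapT => /asboolP /mmin; rewrite leqNgt nm.
  move=> /near0E[d' d'0 d'P]; exists (Num.min d d'); first by rewrite lt_min d0.
  move=> j x; rewrite ltnS leq_eqVlt lt_min => /orP[/eqP ->|jn] /andP[xd xd'].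
    exact: d'P.
  exact: dP.
have [d d0 dP] := low m (leqnn m).
exists m, (c m); split=> //.
  have [B' [ch _]] := cb m; apply/near0E; exists r => // x /ch.
  by rewrite add0r.
exists (4 * B / (r / 4) ^+ m.+1 + 1), (Num.min d (r / 8)); split.
- rewrite ltr_wpDl // divr_ge0 ?mulr_ge0 // exprn_ge0 // divr_ge0 // ltW //.
- by rewrite lt_min d0 divr_gt0.
move=> x t; rewrite !lt_min => /andP[xd xr] /andP[td tr].
have := cE m.+1 x t; rewrite big_ord_recr /= big1 => [|j _]; last first.
  by rewrite dP ?mulr0.
rewrite add0r => H; rewrite (le_trans (H _ _)) ?(ltW tr) //; first lra.
rewrite [leLHS](_ : _ = 4 * B / (r / 4) ^+ m.+1 * N t ^+ m.+1); last first.
  by rewrite [in LHS]expr_div_n; ring.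
by apply: ler_wpM2r; [rewrite exprn_ge0 // N_ge0|rewrite lerDl].
Qed.

End Param.

Section ImplicitFunction.
Variables (R : realType) (V : normedModType R[i]).
Local Notation C := (R[i]).

(** Near 0 the map y |-> y - c^-1 F(x, y), where c is the derivative of F in the last
    variable, contracts distances by the factor 1/2. Its iterates from 0 are holomorphic in x
    and converge uniformly, so Weierstrass' theorem applies to the fixed point. *)
Theorem implicit_function (F : (V * C)%type -> C) L : F 0 = 0 ->
  (\forall p \near (0 : (V * C)%type), hol F p) -> is_der F 0 L -> L (0, 1) != 0 ->
  exists phi : V -> C, [/\ phi 0 = 0, \forall x \near (0 : V), hol phi x &
    \forall p \near (0 : (V * C)%type), F p = 0 <-> p.2 = phi p.1].
Proof.
move=> F0 Fn FL; set c := L (0, 1) => c0; have Nc := N_gt0 c0.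
have [l1 [KL KL0 LK] _] := FL.
have Fh0 : hol F 0 by exists L.
have [r [B [r0 Fb]]] := hol_bhol Fh0 Fn; have B0 := bhol_ge0 r0 Fb.
(* E is the nonlinear part of F; it is contracting on small balls *)
pose E p := F p + -1 * L p.
pose K := 64 * B / r ^+ 2 + 1.
have K0 : 0 < K by rewrite ltr_wpDl // divr_ge0 ?exprn_ge0 ?mulr_ge0 // ltW.
have EK p : N p <= r / 8 -> N (E p) <= K * N p ^+ 2.
  move=> pr; have [_ + _] := bhol_expand r0 Fb FL pr.
  rewrite add0r F0 subr0 /E mulN1r => H; rewrite (le_trans H) //.
  by rewrite ler_wpM2r ?sqr_ge0 // lerDl.
have Eh p : N p < r -> hol E p.
  move=> pr; apply: holD; first by case: Fb => Fh _; have := Fh p pr; rewrite add0r.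
  by apply: holM; [exact: hol_cst|exists L; exact: (lin_is_der l1 _ LK)].
pose s := Num.min (r / 16) (N c / (2 * (64 * K))).
have s0 : 0 < s by rewrite lt_min !divr_gt0 // !mulr_gt0.
have sr : s <= r / 16 by rewrite ge_min lexx.
have sK : 64 * K * s <= N c / 2.
  have : s <= N c / (2 * (64 * K)) by rewrite ge_min lexx orbT.
  rewrite ler_pdivlMr ?mulr_gt0 //; lra.
pose d := s / 16; have d0 : 0 < d by rewrite divr_gt0.
have lipE p p' : N p < d -> N p' < d -> N (E p' - E p) <= N c / 2 * N (p' - p).
  move=> pd pd'; have bE : bhol E p s (4 * K * s ^+ 2).
    have lt h : N h < s -> N (p + h) < 2 * s.
      have ps : N p < s / 16 := pd.
      move=> hs; rewrite (le_lt_trans (ND _ _)) //; lra.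
    split=> h /lt hs; first by apply: Eh; lra.
    rewrite (le_trans (EK _ _)) //; first lra.
    rewrite [leRHS](_ : _ = K * (2 * s) ^+ 2); last by ring.
    by rewrite ler_wpM2l ?(ltW K0) // lerXn2r ?nnegrE ?N_ge0 ?mulr_ge0 // ltW.
  have [l lP] : hol E p by have ps : N p < s / 16 := pd; apply: Eh; lra.
  have pp : N (p' - p) <= s / 8.
    have ps : N p < s / 16 := pd; have ps' : N p' < s / 16 := pd'.
    rewrite (le_trans (NB _ _)) //; lra.
  have [+ _ _] := bhol_expand s0 bE lP pp.
  rewrite [p + _]addrC subrK => H; rewrite (le_trans H) // ler_wpM2r ?N_ge0 //.
  rewrite (le_trans _ sK) //; apply: le_of_eq; field.
  by rewrite gt_eqF.
pose T x y := y - c^-1 * F (x, y).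
have Ldiff x y y' : L (x, y) - L (x, y') = (y - y') * c.
  rewrite -(linB l1) (_ : (x, y) - (x, y') = (y - y') *: ((0, 1) : V * C)%type).
    by rewrite (linZ l1).
  by rewrite /= -[LHS]/(x - x, y - y') subrr; congr pair; rewrite ?scaler0 // /= [RHS]mulr1.
have Tc x y y' : N x < d -> N y < d -> N y' < d -> N (T x y - T x y') <= 2^-1 * N (y - y').
  move=> xd yd yd'.
  rewrite (_ : _ - _ = - c^-1 * (E (x, y) - E (x, y'))); last first.
    rewrite /T /E (_ : _ - _ = y - y' - c^-1 * (F (x, y) - F (x, y'))); last by ring.
    rewrite (_ : (F (x, y) + _) - _ = F (x, y) - F (x, y') - (L (x, y) - L (x, y'))); last by ring.
    by rewrite Ldiff; field.
  have := lipE _ _ (Npair_lt xd yd') (Npair_lt xd yd).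
  rewrite (_ : (x, y) - (x, y') = (0, y - y')); last by rewrite -[LHS]/(x - x, y - y') subrr.
  rewrite Npair N0 max_r ?N_ge0 // => H.
  rewrite NM NN NV ler_pdivrMl // (le_trans H) //.
  by apply: le_of_eq; ring.
have [K1 K10 [d1 d10 FK]] := is_der_bound FL.
pose dl := Num.min (Num.min d d1) (d / (4 * (K1 / N c))).
have dl0 : 0 < dl by rewrite !lt_min d0 d10 divr_gt0 // mulr_gt0 // divr_gt0.
have T0 x : N x < dl -> N (T x 0) <= d / 4.
  rewrite !lt_min => /andP[/andP[xd xd1] x4].
  have x0 : N ((x, 0) : (V * C)%type) = N x by rewrite Npair N0 max_l ?N_ge0.
  have := FK (x, 0); rewrite x0 add0r F0 subr0 => /(_ xd1) H.
  rewrite /T sub0r NN NM NV ler_pdivrMl // (le_trans H) //.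
  have q0 : 0 < 4 * (K1 / N c) by rewrite mulr_gt0 // divr_gt0.
  move: x4; rewrite (ltr_pdivlMr _ _ q0) => x4.
  have : N x * (4 * (K1 / N c)) * N c < d * N c by rewrite ltr_pM2r.
  rewrite (_ : _ * N c = 4 * (K1 * N x)); last by field; rewrite gt_eqF.
  lra.
pose y := fix y n (x : V) : C := if n is m.+1 then T x (y m x) else 0.
have yS n x : y n.+1 x = T x (y n x) by [].
have yd n x : N x < dl -> N (y n x) <= d / 2 /\ N (y n.+1 x - y n x) <= d / 4 * 2^-1 ^+ n.
  move=> xdl; have xd : N x < d by move: xdl; rewrite !lt_min => /andP[/andP[]].
  have : N (y n x) <= d / 2 * (1 - 2^-1 ^+ n) /\ N (y n.+1 x - y n x) <= d / 4 * 2^-1 ^+ n.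
    elim: n => [|n [ih1 ih2]].
      by rewrite expr0 subrr mulr0 mulr1 /= N0 subr0; split=> //; exact: T0.
    have p0 : 0 < (2^-1 : R) ^+ n by rewrite exprn_gt0 // invr_gt0.
    have a1 : N (y n.+1 x) <= d / 2 * (1 - 2^-1 ^+ n.+1).
      rewrite (le_trans (NleD _ (y n x))) // exprSr.
      rewrite (le_trans (lerD ih2 ih1)) //.
by apply: le_of_eq; field.
    have p1 : 0 < (2^-1 : R) ^+ n.+1 by rewrite exprn_gt0 // invr_gt0.
    have lt q : 0 < q -> d / 2 * (1 - q) < d.
      move=> q0; have : 0 < d / 2 * q by rewrite mulr_gt0 // divr_gt0.
      lra.
    split=> //; rewrite yS [y n.+1 x in X in _ - X]yS exprSr.
    rewrite (le_trans (Tc _ _ _ xd _ _)) //.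
    + by apply: (le_lt_trans a1); exact: lt.
    + by apply: (le_lt_trans ih1); exact: lt.
    by rewrite mulrC mulrA ler_wpM2r ?invr_ge0.
  move=> [a b]; split=> //; rewrite (le_trans a) //; apply: ler_piMr; first by rewrite ltW // divr_gt0.
  by rewrite lerBlDr lerDl exprn_ge0 // invr_ge0.
have yC n m x : N x < dl -> N (y (m + n)%N x - y n x) <= d / 2 * 2^-1 ^+ n.
  move=> xdl.
  suff : N (y (m + n)%N x - y n x) <= d / 2 * (2^-1 ^+ n - 2^-1 ^+ (m + n)).
    move/le_trans; apply; apply: ler_wpM2l; first by rewrite ltW // divr_gt0.
    by rewrite lerBlDr lerDl exprn_ge0 // invr_ge0.
  elim: m => [|m ih]; first by rewrite add0n !subrr N0 mulr0.
  rewrite (le_trans (NB3 (y (m + n)%N x) _ _)) //.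
  have [_ h] := yd (m + n)%N x xdl; rewrite addSn.
  rewrite (le_trans (lerD h ih)) // exprSr.
  by apply: le_of_eq; field.
have /choice[phi phiP] : forall x, exists l, N x < dl -> seqlim (fun n => y n x) l.
  move=> x; have [xdl|xdl] := ltP (N x) dl; last by exists 0.
  have [l lP] : exists l, seqlim (fun n => y n x) l; last by exists l.
  apply: complex_cauchy => e e0.
  have [n nP] : exists n, d / 2 * 2^-1 ^+ n <= e.
    apply: contrapT => /forallNP H; have : e <= 0; last lra.
    apply: (@geo_null _ _ (d / 2)) => n; have := H n => /negP; rewrite -ltNge; exact: ltW.
  exists n => k nk; rewrite (le_trans _ nP) // -(subnK nk); exact: yC.
have unif n x : N x < dl -> N (y n x - phi x) <= d / 2 * 2^-1 ^+ n.
  move=> xdl; apply/ler_addgt0Pr => e /(phiP x xdl)[k kP].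
  rewrite (le_trans (NB3 (y (k + n)%N x) _ _)) // lerD //; last by apply: kP; rewrite leq_addr.
  by rewrite NBC; exact: yC.
have xd (x : V) : N x < dl -> N x < d by rewrite !lt_min => /andP[/andP[]].
have phid x : N x < dl -> N (phi x) <= d / 2.
  by move=> xdl; apply: seqlim_le (phiP x xdl) _ => n; case: (yd n x xdl).
have dd (z : C) : N z <= d / 2 -> N z < d by move=> zd; lra.
have fix_phi x : N x < dl -> T x (phi x) = phi x.
  move=> xdl; apply: N_sub_le0.
  apply: (@geo_null _ _ d) => n.
  rewrite (le_trans (NB3 (y n.+1 x) _ _)) //.
  have h1 := unif n.+1 x xdl; have h2 := unif n x xdl.
  have [yn _] := yd n x xdl.
  have h3 := Tc x (phi x) (y n x) (xd x xdl) (dd _ (phid x xdl)) (dd _ yn).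
  rewrite exprSr yS in h1; rewrite yS.
  have p0 : 0 <= (2^-1 : R) ^+ n by rewrite exprn_ge0 // invr_ge0.
  have p1 : 0 <= d * 2^-1 ^+ n by rewrite mulr_ge0 // ltW.
  rewrite (NBC (phi x)) in h3; lra.
have zero x z : N x < dl -> N z < d -> F (x, z) = 0 <-> z = phi x.
  move=> xdl zd; split=> [Fz|->].
    have Tz : T x z = z by rewrite /T Fz mulr0 subr0.
    have := Tc x z (phi x) (xd x xdl) zd (dd _ (phid x xdl)).
    rewrite Tz fix_phi // => H; apply/eqP; rewrite -subr_eq0; apply/eqP/N_eq0/eqP.
    rewrite eq_le N_ge0 andbT; lra.
  have := fix_phi x xdl; rewrite /T => /eqP; rewrite subr_eq addrC -subr_eq subrr eq_sym.
  by rewrite mulf_eq0 invr_eq0 (negbTE c0) => /eqP.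
exists phi; split.
- by apply/esym/zero; rewrite ?N0.
- apply/near0E; exists dl => // x xdl.
  suff [+ _] : bhol phi 0 dl (d / 2) by move=> /(_ x xdl); rewrite add0r.
  apply: (@hol_lim _ _ y) => [n|e e0].
    split=> h hd; rewrite add0r; last by case: (yd n h hd).
    elim: n => [|n ih]; first exact: hol_cst.
    apply: (@holB _ _ _ (y n)) => //; apply: holM; first exact: hol_cst.
    apply: (hol_comp (f := fun x => (x, y n x) : (V * C)%type)).
      by apply: hol_pair => //; exact: hol_id.
    case: Fb => Fh _; have := Fh (h, y n h); rewrite add0r; apply.
    have [yn _] := yd n h hd; have := Npair_lt (xd h hd) (dd _ yn).
    move/lt_trans; apply; rewrite /d; lra.
  have [n nP] : exists n, d / 2 * 2^-1 ^+ n <= e.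
    apply: contrapT => /forallNP H; have : e <= 0; last lra.
    apply: (@geo_null _ _ (d / 2)) => n; have := H n => /negP; rewrite -ltNge; exact: ltW.
  exists n => k nk h hd; rewrite add0r (le_trans _ nP) // (le_trans (unif k h hd)) //.
  apply: ler_wpM2l; first by rewrite ltW // divr_gt0.
  by rewrite ler_wiXn2l // ?invr_ge0 // invf_le1 // ler1n.
apply/near0E; exists (Num.min dl d); first by rewrite lt_min dl0.
move=> [x z] xz; apply: zero.
  by rewrite (le_lt_trans (Nfst (x, z))) // (lt_le_trans xz) // ge_min lexx.
by rewrite (le_lt_trans (Nsnd (x, z))) // (lt_le_trans xz) // ge_min lexx orbT.
Qed.

End ImplicitFunction.

(** * Germs tangent to the identity that preserve a function *)

Section Lipschitz.
Variables (R : realType) (V : normedModType R[i]).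
Local Notation C := (R[i]).
Implicit Types (f : V -> C) (p h : V).

Lemma bhol_diff f p h (r B : R) : 0 < r -> bhol f p r B -> N h <= r / 8 ->
  N (f (p + h) - f p) <= 16 * B / r * N h.
Proof.
move=> r0 fb hr; have [l lP] : hol f p.
  by case: fb => /(_ 0) + _; rewrite N0 addr0; apply.
by case: (bhol_expand r0 fb lP hr).
Qed.

Lemma bhol_lip f (r B : R) p (p' : V) : 0 < r -> bhol f 0 r B -> N p < r / 32 -> N p' < r / 32 ->
  N (f p' - f p) <= 32 * B / r * N (p' - p).
Proof.
move=> r0 fb pr pr'; have r2 : 0 < r / 2 by rewrite divr_gt0.
have fp : bhol f p (r / 2) B.
  have := bhol_sub p fb; rewrite add0r; apply: bhol_shrink; lra.
have h : N (p' - p) <= r / 2 / 8 by rewrite (le_trans (NB _ _)) //; lra.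
have := bhol_diff r2 fp h; rewrite [p + _]addrC subrK => H; rewrite (le_trans H) //.
by apply: le_of_eq; field; rewrite gt_eqF.
Qed.

(** A function of quadratic size on a ball of radius 9 s has gradient O(s) on the ball of
    radius s, by Cauchy's estimate on balls of radius 8 s. *)
Lemma quad_lip f (r A s : R) p (p' : V) : 0 <= A -> 0 < s -> 9 * s < r ->
  (forall h, N h < r -> hol f h) -> (forall h, N h < r -> N (f h) <= A * N h ^+ 2) ->
  N p <= s -> N (p' - p) <= s -> N (f p' - f p) <= 162 * A * s * N (p' - p).
Proof.
move=> A0 s0 sr fh fA ps pps.
have lt h : N h < 8 * s -> N (p + h) < 9 * s.
  by move=> hs; rewrite (le_lt_trans (ND _ _)) //; lra.
have fp : bhol f p (8 * s) (A * (9 * s) ^+ 2).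
  split=> h /lt hs; first by apply: fh; lra.
  rewrite (le_trans (fA _ _)) //; first lra.
  by rewrite ler_wpM2l // lerXn2r ?nnegrE ?N_ge0 ?mulr_ge0 // ltW.
have s8 : 0 < 8 * s by rewrite mulr_gt0.
have h : N (p' - p) <= 8 * s / 8 by lra.
have := bhol_diff s8 fp h; rewrite [p + _]addrC subrK => H; rewrite (le_trans H) //.
by apply: le_of_eq; field; rewrite gt_eqF.
Qed.

End Lipschitz.

Section Invariant.
Variables (R : realType).
Local Notation C := (R[i]).

Lemma pow1_bound (a : C) (s : R) n : N a <= s -> s <= 1 ->
  N ((1 + a) ^+ n - 1) <= 2 ^+ n * s.
Proof.
move=> as_ s1; have s0 : 0 <= s := le_trans (N_ge0 _) as_.
suff : N ((1 + a) ^+ n - 1) <= (2 ^+ n - 1) * s.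
  by move/le_trans; apply; rewrite ler_wpM2r // lerBlDr lerDl.
elim: n => [|n ih]; first by rewrite !expr0 !subrr N0 mul0r.
rewrite (_ : _ - _ = (1 + a) * ((1 + a) ^+ n - 1) + a); last by rewrite exprS; ring.
have a2 : N (1 + a) <= 2 by rewrite (le_trans (ND _ _)) // N1; lra.
rewrite (le_trans (ND _ _)) // NM.
have := ler_pM (N_ge0 _) (N_ge0 _) a2 ih; rewrite exprS; lra.
Qed.

Lemma pow_bound (a : C) (s : R) n : N a <= s -> s <= 1 -> N ((1 + a) ^+ n) <= 2 ^+ n.
Proof.
move=> as_ s1; rewrite NX lerXn2r ?nnegrE ?N_ge0 // (le_trans (ND _ _)) // N1; lra.
Qed.

Lemma pow2_bound (a : C) n : N a <= 1 ->
  N ((1 + a) ^+ n - 1 - n%:R * a) <= 2 ^+ n * n%:R * N a ^+ 2.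
Proof.
move=> a1; elim: n => [|n ih].
  by rewrite !expr0 mul0r subrr subr0 N0 mulr0 mul0r.
rewrite (_ : _ - _ = (1 + a) * ((1 + a) ^+ n - 1 - n%:R * a) + n%:R * a ^+ 2); last first.
  by rewrite exprS -[n.+1]addn1 natrD; ring.
have a2 : N (1 + a) <= 2 by rewrite (le_trans (ND _ _)) // N1; lra.
rewrite (le_trans (ND _ _)) // NM (NM n%:R) NX.
have Nn : N (n%:R : C) = n%:R by rewrite -(rmorph_nat (real_complex R)) NC ger0_norm.
rewrite Nn; have := ler_pM (N_ge0 _) (N_ge0 _) a2 ih.
have : n%:R * N a ^+ 2 <= 2 ^+ n.+1 * N a ^+ 2.
  rewrite ler_wpM2r ?sqr_ge0 // -natrX ler_nat ltnW // (ltn_trans (ltnSn n)) // ltn_expl //.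
have -> : (2 : R) ^+ n.+1 = 2 * 2 ^+ n by rewrite exprS.
have -> : (n.+1%:R : R) = n%:R + 1 by rewrite -addn1 natrD.
lra.
Qed.

(** Let q(z) = c z^a + E(z) with c nonzero, a > 0, E(z) = O(z^(a+1)), and let f(z) = z + h with
    h nonzero. Then (z + h)^a - z^a has size at least |z|^(a-1) |h| / 2, since h = O(z^2), while
    E changes by at most a constant times |z|^a |h|. For small z the two cannot compensate each
    other in q(z + h) = q(z). *)
Lemma fixed_of_invariant (q f : C -> C) (A r : R) : 0 < r -> q 0 = 0 ->
  (\forall z \near (0 : C), hol q z) -> ~ (\forall z \near (0 : C), q z = 0) ->
  (forall z, N z < r -> N (f z - z) <= A * N z ^+ 2) ->
  (forall z, N z < r -> q (f z) = q z) ->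
  \forall z \near (0 : C), f z = z.
Proof.
move=> r0 q0 qn qnn fA qf.
have q0h : hol q 0 by have /near0E[d d0 dP] := qn; apply: dP; rewrite N0.
have [s [B [s0 qb]]] := hol_bhol q0h qn; have B0 := bhol_ge0 s0 qb.
have qh z : N z < s -> hol q z by move=> zs; case: qb => /(_ z zs); rewrite add0r.
have qB z : N z < s -> N (q z) <= B by move=> zs; case: qb => _ /(_ z zs); rewrite add0r.
have [c _ cE] := taylor s0 qh qB.
have ex : exists k, c k != 0.
  apply: contrapT => /forallNP c0; apply: qnn; apply/near0E.
  exists (s / 8) => [|z zs]; first by rewrite divr_gt0.
  apply: N_le0; apply: (@geo_null _ _ (4 * B)) => n.
  have := cE n z (ltW zs); rewrite big1 => [|j _]; last first.
    by have /negP := c0 j; rewrite negbK => /eqP ->; rewrite mulr0.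
  rewrite subr0 => H; rewrite (le_trans H) // ler_wpM2l ?mulr_ge0 //.
  rewrite lerXn2r ?nnegrE ?divr_ge0 ?N_ge0 ?(ltW s0) //.
  rewrite ler_pdivrMr ?divr_gt0 //; lra.
have [a ca amin] := ex_minnP ex.
have Nca := N_gt0 ca.
have a_gt0 : (0 < a)%N.
  rewrite lt0n; apply: contraNneq ca => a0; rewrite a0.
  have := cE 1%N 0; rewrite N0 mul0r expr1 mulr0 big_ord1 expr0 mul1r q0 sub0r NN.
  move=> H; apply/eqP/N_eq0/eqP; rewrite eq_le N_ge0 andbT; apply: H.
  by rewrite divr_ge0 // ltW.
pose E z := q z - z ^+ a * c a.
pose K := 4 * B / (s / 4) ^+ a.+1.
have K0 : 0 <= K by rewrite divr_ge0 ?mulr_ge0 // exprn_ge0 // divr_ge0 // ltW.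
have EK z : N z <= s / 8 -> N (E z) <= K * N z ^+ a.+1.
  move=> zs; have := cE a.+1 z zs; rewrite big_ord_recr /= big1 => [|j _]; last first.
    suff /eqP -> : c j == 0 by rewrite mulr0.
    by apply: contraT => /amin; rewrite leqNgt ltn_ord.
  rewrite add0r => H; rewrite (le_trans H) // /K [in leLHS]expr_div_n.
  by apply: le_of_eq; ring.
have Eh z : N z < s -> hol E z.
  move=> zs; apply: holB; first exact: qh.
  by apply: holM; [apply: holX; exact: hol_id|exact: hol_cst].
pose K2 := 16 * K * 2 ^+ a.+1.
have K20 : 0 <= K2.
  by apply: mulr_ge0; [exact: mulr_ge0|exact: exprn_ge0].
have lipE z h : N z <= s / 16 -> 0 < N z -> N h <= N z / 8 ->
    N (E (z + h) - E z) <= K2 * N z ^+ a * N h.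
  move=> zs z0 hz.
  have lt k : N k < N z -> N (z + k) <= 2 * N z.
    by move=> kz; rewrite (le_trans (ND _ _)) //; lra.
  have bE : bhol E z (N z) (K * (2 * N z) ^+ a.+1).
    split=> k /lt kz; first by apply: Eh; lra.
    rewrite (le_trans (EK _ _)) //; first lra.
    by rewrite ler_wpM2l // lerXn2r ?nnegrE ?N_ge0 // mulr_ge0 // N_ge0.
  have := bhol_diff z0 bE hz => H; rewrite (le_trans H) // exprMn [N z ^+ a.+1]exprSr /K2.
  by apply: le_of_eq; field; rewrite gt_eqF.
pose A' := Num.max A 1; have A0 : 0 < A' by rewrite lt_max ltr01 orbT.
have fA' z : N z < r -> N (f z - z) <= A' * N z ^+ 2.
  by move=> /fA /le_trans; apply; rewrite ler_wpM2r ?sqr_ge0 // le_max lexx.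
pose b : R := 2 ^+ a * a%:R.
have b0 : 0 < b by apply: mulr_gt0; rewrite ?exprn_gt0 ?ltr0n.
pose d := Num.min (Num.min r (s / 16))
   (Num.min (1 / (8 * A')) (Num.min (1 / (2 * b * A')) (N (c a) / (2 * (K2 + 1))))).
have K21 : 0 < K2 + 1 by rewrite ltr_wpDl.
have t1 : 0 < 1 / (8 * A') by rewrite divr_gt0 // mulr_gt0.
have bA : 0 < 2 * b * A' by rewrite mulr_gt0 // mulr_gt0.
have t2 : 0 < 1 / (2 * b * A') by rewrite divr_gt0.
have t3 : 0 < N (c a) / (2 * (K2 + 1)) by rewrite divr_gt0 // mulr_gt0.
have t4 : 0 < s / 16 by rewrite divr_gt0.
have d0 : 0 < d by rewrite !lt_min r0 t1 t2 t3 t4.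
apply/near0E; exists d => // z; rewrite !lt_min => /andP[/andP[zr zs] /and3P[z1 z2 z3]].
have [->|z0] := eqVneq z 0.
  apply: N_sub_le0.
  by have := fA' 0; rewrite N0 expr0n mulr0; apply.
have Nz := N_gt0 z0.
apply/eqP; apply: contraT => fz; have h0 : 0 < N (f z - z) by rewrite N_gt0 // subr_eq0.
set h := f z - z in h0.
have fzE : f z = z + h by rewrite /h addrC subrK.
pose al := h / z.
have hal : h = z * al by rewrite /al mulrC divfK.
have zA : N z * A' < 1 / 8.
  move: z1; rewrite ltr_pdivlMr ?mulr_gt0 //; lra.
have Nal : N al <= N z * A'.
  rewrite /al NM NV ler_pdivrMr // (le_trans (fA' _ zr)) // expr2.
  by apply: le_of_eq; ring.
have al8 : N al <= 1 / 8 by rewrite (le_trans Nal) // ltW.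
have hz : N h <= N z / 8.
  by rewrite hal NM; have := ler_wpM2l (ltW Nz) al8; lra.
(* with h = z * al, compare (1 + al)^a - 1 with a * al *)
have key : N z ^+ a * (N al / 2) <= N ((z + h) ^+ a - z ^+ a).
  rewrite hal (_ : _ - _ = z ^+ a * ((1 + al) ^+ a - 1)); last first.
    by rewrite (_ : z + z * al = z * (1 + al)); [rewrite exprMn; ring|ring].
  rewrite NM NX ler_wpM2l ?exprn_ge0 ?N_ge0 //.
  have al1 : N al <= 1 by lra.
  have := pow2_bound a al1; rewrite -/b => H.
  have : N (a%:R * al) <= N ((1 + al) ^+ a - 1) + b * N al ^+ 2.
    rewrite (le_trans (NleD _ ((1 + al) ^+ a - 1))) // addrC lerD2l NBC //.
  have Na : N (a%:R : C) = a%:R by rewrite -(rmorph_nat (real_complex R)) NC ger0_norm.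
  rewrite NM Na.
  have : 1 * N al <= a%:R * N al by rewrite ler_wpM2r ?N_ge0 // ler1n.
  have : b * N al ^+ 2 <= 1 / 2 * N al.
    rewrite expr2 mulrA ler_wpM2r ?N_ge0 //.
    have : N z * (2 * b * A') < 1 by rewrite -ltr_pdivlMr.
    have := ler_wpM2l (ltW b0) Nal; lra.
  lra.
have Ediff : N (E (z + h) - E z) = N (c a) * N ((z + h) ^+ a - z ^+ a).
  rewrite -NM -NN; congr N; rewrite /E -fzE qf //; ring.
have := lipE z h (ltW zs) Nz hz; rewrite Ediff => H1.
have H2 : N (c a) * (N z ^+ a * (N al / 2)) <= K2 * N z ^+ a * N h.
  by rewrite (le_trans _ H1) // ler_wpM2l // N_ge0.
have al0 : 0 < N al.
  by rewrite /al NM NV divr_gt0.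
have Nh : N h = N z * N al by rewrite hal NM.
have P0 : 0 < N z ^+ a * N al by rewrite mulr_gt0 // exprn_gt0.
have : N (c a) / 2 <= K2 * N z.
  rewrite Nh in H2; rewrite -(ler_pM2r P0); lra.
have : N z * (2 * (K2 + 1)) < N (c a) by rewrite -ltr_pdivlMr // mulr_gt0.
lra.
Qed.

End Invariant.

(** * Normalized families of curves *)

Section Asymptotics.
Variable R : realType.
Local Notation C := (R[i]).

Lemma hol_lip0 (V : normedModType C) (f : V -> C) : (\forall p \near (0 : V), hol f p) ->
  exists r L : R, [/\ 0 < r, 0 < L, forall p, N p < r -> hol f p &
    forall p p', N p < r -> N p' < r -> N (f p' - f p) <= L * N (p' - p)].
Proof.
move=> fn; have f0 : hol f 0 by have /near0E[d d0 dP] := fn; apply: dP; rewrite N0.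
have [r [B [r0 fb]]] := hol_bhol f0 fn; have B0 := bhol_ge0 r0 fb.
exists (r / 32), (32 * B / r + 1); split.
- by rewrite divr_gt0.
- by rewrite ltr_wpDl // divr_ge0 ?mulr_ge0 // ltW.
- by move=> p pr; case: fb => /(_ p) + _; rewrite add0r; apply; lra.
move=> p p' pr pr'; rewrite (le_trans (bhol_lip r0 fb pr pr')) //.
by rewrite ler_wpM2r ?N_ge0 // lerDl.
Qed.

Variables (D : (C * C) * C -> C) (c : C * C -> C) (q : C -> C) (m b : nat).
Variables (r K K' Bq : R).
Hypotheses (K0 : 0 <= K) (K'0 : 0 <= K') (Bq0 : 0 <= Bq).
Hypothesis Dc : forall z x t, N z < r -> N x < r -> N t < r ->
  N (D ((z, x), t) - t ^+ m * c (z, x)) <= K * N t ^+ m.+1.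
Hypothesis cq : forall z x, N z < r -> N x < r -> N (c (z, x) - x ^+ b * q z) <= K' * N x ^+ b.+1.
Hypothesis qB : forall z, N z < r -> N (q z) <= Bq.

(** At parameters x close to e and t close to e^(b+1), with relative errors O(e), the function D
    equals its leading term t^m x^b q(z) up to a relative error O(e). *)
Lemma D_asymp (e A : R) z x t : 0 < e -> e <= 1 -> 0 <= A -> A * e <= 1 -> 2 * e < r ->
  N z < r -> N (x - e%:C) <= A * e * e -> N (t - (e ^+ b.+1)%:C) <= A * e * e ^+ b.+1 ->
  N (D ((z, x), t) - ((e ^+ b.+1) ^+ m * e ^+ b)%:C * q z) <=
    (2 * 2 ^+ m * K + 2 ^+ m * (2 * 2 ^+ b * K') + (2 ^+ m * 2 ^+ b + 2 ^+ b) * A * Bq) *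
    (e * ((e ^+ b.+1) ^+ m * e ^+ b)).
Proof.
move=> e0 e1 A0 Ae er zr xe te; set tau := e ^+ b.+1 in te *.
have tau0 : 0 < tau by rewrite exprn_gt0.
have tau1 : tau <= e by rewrite /tau exprS ler_piMr ?exprn_ile1 // ltW.
have eC : e%:C != 0 :> C by rewrite fmorph_eq0 gt_eqF.
have tC : tau%:C != 0 :> C by rewrite fmorph_eq0 gt_eqF.
pose be := (x - e%:C) / e%:C; pose al := (t - tau%:C) / tau%:C.
have xE : x = e%:C * (1 + be) by rewrite /be; field.
have tE : t = tau%:C * (1 + al) by rewrite /al; field.
have Nbe : N be <= A * e by rewrite NM NV NC (gtr0_norm e0) ler_pdivrMr.
have Nal : N al <= A * e by rewrite NM NV NC (gtr0_norm tau0) ler_pdivrMr.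
have N1a (a : C) : N a <= A * e -> N (1 + a) <= 2.
  by move=> ae; rewrite (le_trans (ND _ _)) // N1; lra.
have Nx : N x <= 2 * e.
  by rewrite xE NM NC (gtr0_norm e0) mulrC; apply: ler_wpM2r; [exact: ltW|exact: N1a].
have Nt : N t <= 2 * tau.
  by rewrite tE NM NC (gtr0_norm tau0) mulrC; apply: ler_wpM2r; [exact: ltW|exact: N1a].
have xr : N x < r := le_lt_trans Nx er.
have tr : N t < r by apply: (le_lt_trans Nt); lra.
set U := tau ^+ m * e ^+ b.
have U0 : 0 <= U by rewrite mulr_ge0 // exprn_ge0 // ltW.
rewrite (_ : _ - _ = (D ((z, x), t) - t ^+ m * c (z, x)) +
   (t ^+ m * (c (z, x) - x ^+ b * q z) + (t ^+ m * x ^+ b - U%:C) * q z)); last by ring.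
have b1 : N (D ((z, x), t) - t ^+ m * c (z, x)) <= 2 * 2 ^+ m * K * (e * U).
  rewrite (le_trans (Dc zr xr tr)) //.
  have : N t ^+ m.+1 <= (2 * tau) ^+ m.+1.
    by rewrite lerXn2r ?nnegrE ?N_ge0 // mulr_ge0 // ltW.
  move=> /(ler_wpM2l K0) /le_trans; apply.
  by rewrite exprMn !exprS -/tau /U; apply: le_of_eq; rewrite /tau exprS; ring.
have b2 : N (t ^+ m * (c (z, x) - x ^+ b * q z)) <= 2 ^+ m * (2 * 2 ^+ b * K') * (e * U).
  rewrite NM NX.
  have h1 : N t ^+ m <= (2 * tau) ^+ m.
    by rewrite lerXn2r ?nnegrE ?N_ge0 // mulr_ge0 // ltW.
  have h2 : N (c (z, x) - x ^+ b * q z) <= K' * (2 * e) ^+ b.+1.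
    rewrite (le_trans (cq zr xr)) // ler_wpM2l // lerXn2r ?nnegrE ?N_ge0 //.
    by rewrite mulr_ge0 // ltW.
  rewrite (le_trans (ler_pM _ _ h1 h2)) ?exprn_ge0 ?N_ge0 //.
  by rewrite !exprMn !exprS /U; apply: le_of_eq; ring.
have b3 : N ((t ^+ m * x ^+ b - U%:C) * q z) <= (2 ^+ m * 2 ^+ b + 2 ^+ b) * A * Bq * (e * U).
  rewrite NM.
  have UE : U%:C = tau%:C ^+ m * e%:C ^+ b :> C by rewrite rmorphM !rmorphXn.
  rewrite (_ : t ^+ m * x ^+ b - U%:C = U%:C * (((1 + al) ^+ m - 1) * (1 + be) ^+ b +
     ((1 + be) ^+ b - 1))); last by rewrite UE xE tE !exprMn; ring.
  rewrite NM NC (ger0_norm U0).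
  have h : N (((1 + al) ^+ m - 1) * (1 + be) ^+ b + ((1 + be) ^+ b - 1)) <=
      (2 ^+ m * 2 ^+ b + 2 ^+ b) * (A * e).
    rewrite (le_trans (ND _ _)) // NM.
    have := pow1_bound b Nbe Ae.
    have := ler_pM (N_ge0 _) (N_ge0 _) (pow1_bound m Nal Ae) (pow_bound b Nbe Ae).
    lra.
  have := ler_pM (mulr_ge0 U0 (N_ge0 _)) (N_ge0 _) (ler_wpM2l U0 h) (qB zr).
  by move=> /le_trans; apply; apply: le_of_eq; ring.
have := ND (D ((z, x), t) - t ^+ m * c (z, x))
   (t ^+ m * (c (z, x) - x ^+ b * q z) + (t ^+ m * x ^+ b - U%:C) * q z).
have := ND (t ^+ m * (c (z, x) - x ^+ b * q z)) ((t ^+ m * x ^+ b - U%:C) * q z).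
lra.
Qed.

(** For t of size tau = e^(b+1) and x of size tau^2, both t and x^b are O(e * e^b); so D is
    negligible against its leading term at x = e, t = tau. *)
Lemma D_small (e A : R) z x t : (0 < b)%N -> 0 < e -> e <= 1 -> A * e <= 1 -> 2 * e < r ->
  N z < r -> N x <= A * (e ^+ b.+1) ^+ 2 -> N t <= 2 * e ^+ b.+1 ->
  N (D ((z, x), t)) <= 2 ^+ m * (2 * K + Bq + K') * (e * ((e ^+ b.+1) ^+ m * e ^+ b)).
Proof.
move=> b0 e0 e1 Ae er zr xt tt; set tau := e ^+ b.+1 in xt tt *.
have tau0 : 0 < tau by rewrite exprn_gt0.
have tau1 : tau <= e by rewrite /tau exprS ler_piMr ?exprn_ile1 // ltW.
have A1 : N x <= tau.
  rewrite (le_trans xt) // expr2 mulrA.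
  rewrite -[leRHS]mul1r ler_wpM2r ?(ltW tau0) //.
  have [A0|A0] := leP 0 A; first by rewrite (le_trans _ Ae) // ler_wpM2l.
  by rewrite (le_trans _ ler01) // nmulr_rle0 // ltW.
have x1 : N x <= 1 by lra.
have xr : N x < r by lra.
have tr : N t < r by lra.
have TM : N t ^+ m <= 2 ^+ m * tau ^+ m.
  by rewrite -exprMn lerXn2r ?nnegrE ?N_ge0 // mulr_ge0 // ltW.
have tb : tau = e * e ^+ b by rewrite /tau exprS.
have xb : N x ^+ b <= tau.
  rewrite (le_trans _ A1) // -(prednK b0) exprS ler_piMr ?N_ge0 //.
  by rewrite exprn_ile1 ?N_ge0.
have xb1 : N x ^+ b.+1 <= tau.
  by rewrite (le_trans _ A1) // exprS ler_piMr ?N_ge0 // exprn_ile1 ?N_ge0.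
have cb : N (c (z, x)) <= (Bq + K') * tau.
  rewrite (le_trans (NleD _ (x ^+ b * q z))) // mulrDl addrC lerD //.
    by rewrite NM NX mulrC ler_pM ?exprn_ge0 ?N_ge0 // qB.
  by rewrite (le_trans (cq zr xr)) // ler_wpM2l.
rewrite (le_trans (NleD _ (t ^+ m * c (z, x)))) //.
have h1 : N (D ((z, x), t) - t ^+ m * c (z, x)) <= K * (2 ^+ m * tau ^+ m * (2 * tau)).
  rewrite (le_trans (Dc zr xr tr)) // ler_wpM2l // exprSr.
  by rewrite ler_pM ?exprn_ge0 ?N_ge0.
have h2 : N (t ^+ m * c (z, x)) <= 2 ^+ m * tau ^+ m * ((Bq + K') * tau).
  by rewrite NM NX ler_pM ?exprn_ge0 ?N_ge0.
rewrite (le_trans (lerD h1 h2)) //; apply: le_of_eq.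
by move: (tau ^+ m) => T; rewrite tb; ring.
Qed.

End Asymptotics.

Section Core.
Variable R : realType.
Local Notation C := (R[i]).
(** The curves w = Q(z, x, t) are normalized on z = 0 and on x = 0, and (F, G) maps the curve with
    parameters (x, t) into the curve with parameters (k, l). Write D = Q - t; its leading term is
    t^m x^b q(z). Put x = e and t = e^(b+1), so that t is much smaller than x. The invariance
    equation at (z, x, t) reads
      G(z, t + D(z, x, t)) = l + D(f, k, l),   f = F(z, Q(z, x, t)).
    Replacing z by 0, x by 0, or both, gives three more equations, which eliminate l and the
    terms G(z, t), G(0, t). There remains D(z, x, t) = D(f, k, l) up to values of D which are small
    because their first argument is close to 0 or their second is O(t^2), and up to the second-order
    part of G. In leading order this is q(z) = q(F(z, 0)), with an error O(e). *)
Lemma normalized_core (Q D : (C * C) * C -> C) (F G k l c : C * C -> C) (q : C -> C) (m b : nat)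
    (r L A K K' Bq : R) :
  0 < r -> 0 <= L -> 1 <= A -> 0 <= K -> 0 <= K' -> 0 <= Bq ->
  (forall p, D p = Q p - p.2) ->
  (forall x t, N x < r -> N t < r -> Q ((0, x), t) = t) ->
  (forall z t, N z < r -> N t < r -> Q ((z, 0), t) = t) ->
  (forall p, N p < r -> N (F p - p.1) <= A * N p ^+ 2) ->
  (forall p, N p < r -> N (k p - p.1) <= A * N p ^+ 2) ->
  (forall p, N p < r -> N (l p - p.2) <= A * N p ^+ 2) ->
  (forall z x t, N z < r -> N x < r -> N t < r ->
    G (z, Q ((z, x), t)) = Q ((F (z, Q ((z, x), t)), k (x, t)), l (x, t))) ->
  (forall p p', N p < r -> N p' < r -> N (D p' - D p) <= L * N (p' - p)) ->
  (forall p p', N p < r -> N p' < r -> N (F p' - F p) <= L * N (p' - p)) ->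
  (forall z z', N z < r -> N z' < r -> N (q z' - q z) <= L * N (z' - z)) ->
  (forall p, N p < r -> hol l p) ->
  (forall p, N p < r -> hol G p) ->
  (forall z x t, N z < r -> N x < r -> N t < r ->
    N (D ((z, x), t) - t ^+ m * c (z, x)) <= K * N t ^+ m.+1) ->
  (forall z x, N z < r -> N x < r -> N (c (z, x) - x ^+ b * q z) <= K' * N x ^+ b.+1) ->
  (forall z, N z < r -> N (q z) <= Bq) ->
  (0 < b)%N -> q 0 = 0 ->
  exists2 rho : R, 0 < rho & forall z, N z < rho -> q (F (z, 0)) = q z /\ G (z, 0) = 0.
Proof.
move=> r0 L0 A1 K0 K'0 Bq0 DE Q0 Qx tF tk tl eqn LD LF Lq hl hG Dc cq qB b_gt0 q00.
have A0 : 0 < A.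
  exact: lt_le_trans A1.
pose rho := Num.min (r / 8) (1 / A).
have rho0 : 0 < rho.
  by rewrite lt_min !divr_gt0.
have rho_r : rho <= r / 8.
  by rewrite ge_min lexx.
have sqA (V : normedModType C) (p : V) : N p < rho -> A * N p ^+ 2 <= N p.
  move=> pr; rewrite expr2 mulrA ler_piMl ?N_ge0 //.
  by rewrite mulrC -ler_pdivlMr // (le_trans (ltW pr)) // ge_min lexx orbT.
have F2 p : N p < rho -> N (F p) <= 2 * N p.
  move=> pr; have pr' : N p < r by move: rho_r r0; lra.
  have := tF _ pr'; have := sqA _ _ pr; have := NleD (F p) p.1; have := Nfst p; lra.
have k2 p : N p < rho -> N (k p) <= 2 * N p.
  move=> pr; have pr' : N p < r by move: rho_r r0; lra.
  have := tk _ pr'; have := sqA _ _ pr; have := NleD (k p) p.1; have := Nfst p; lra.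
have l2 p : N p < rho -> N (l p) <= 2 * N p.
  move=> pr; have pr' : N p < r by move: rho_r r0; lra.
  have := tl _ pr'; have := sqA _ _ pr; have := NleD (l p) p.2; have := Nsnd p; lra.
have sub_r (a : R) : a < rho -> a < r.
  by move: rho_r r0; lra.
have F2r p : N p < rho -> N (F p) < r.
  by move=> pr; have := F2 _ pr; move: rho_r r0 pr; lra.
have k2r p : N p < rho -> N (k p) < r.
  by move=> pr; have := k2 _ pr; move: rho_r r0 pr; lra.
have l2r p : N p < rho -> N (l p) < r.
  by move=> pr; have := l2 _ pr; move: rho_r r0 pr; lra.
have F00 : F 0 = 0.
  by apply: N_le0; rewrite (le_trans (F2 _ _)) ?N0 ?mulr0.
have k00 : k 0 = 0.
  by apply: N_le0; rewrite (le_trans (k2 _ _)) ?N0 ?mulr0.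
have l00 : l 0 = 0.
  by apply: N_le0; rewrite (le_trans (l2 _ _)) ?N0 ?mulr0.
have zr : N (0 : C) < r.
  by rewrite N0.
have lx0 x : N x < rho -> l (x, 0) = 0.
  move=> xr; have xr' : N x < r := sub_r _ xr.
  have x0 : N ((x, 0) : C * C) = N x by rewrite Npair N0 max_l ?N_ge0.
  have kr : N (k (x, 0)) < r by apply: k2r; rewrite x0.
  have lr : N (l (x, 0)) < r by apply: l2r; rewrite x0.
  have e1 := eqn _ _ _ zr xr' zr; rewrite (Q0 _ _ xr' zr) -[(0, 0) : C * C]/(0 : C * C) F00 in e1.
  have e2 := eqn _ _ _ zr zr zr; rewrite (Q0 _ _ zr zr) -[(0, 0) : C * C]/(0 : C * C) F00 k00 l00 in e2.
  by rewrite (Q0 _ _ zr zr) in e2; rewrite e2 Q0 in e1.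
have G_z0 z : N z < rho -> G (z, 0) = 0.
  move=> zrho; have zr' : N z < r := sub_r _ zrho.
  have x0 : N ((z, 0) : C * C) = N z by rewrite Npair N0 max_l ?N_ge0.
  have := eqn _ _ _ zr' zr zr; rewrite (Qx _ _ zr' zr) -[(0, 0) : C * C]/(0 : C * C) k00 l00 => ->.
  by rewrite Qx //; apply: F2r; rewrite x0.
pose A3 := A * (1 + L).
have A30 : 0 <= A3.
  by rewrite mulr_ge0 ?(ltW A0) // addr_ge0.
have Gz z w : N z < rho -> N w < rho -> N (G (z, w) - w) <= A3 * N w ^+ 2.
  move=> zrho wrho; have zr' : N z < r := sub_r _ zrho.
  have wr : N w < r := sub_r _ wrho.
  have w0 : N ((0, w) : C * C) = N w by rewrite Npair N0 max_r ?N_ge0.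
  have := eqn _ _ _ zr' zr wr; rewrite (Qx _ _ zr' wr) => ->.
  set f := F (z, w); set kk := k (0, w); set ll := l (0, w).
  have fr : N f < r by apply: F2r; exact: Npair_lt.
  have kr : N kk < r by apply: k2r; rewrite w0.
  have lr : N ll < r by apply: l2r; rewrite w0.
  rewrite (_ : Q _ - w = (ll - w) + (D ((f, kk), ll) - D ((f, 0), ll))); last first.
    by rewrite !DE /= (Qx _ _ fr lr); ring.
  have := tl (0, w); rewrite w0 => /(_ wr) /= h1.
  have := tk (0, w); rewrite w0 => /(_ wr) /=; rewrite subr0 => h2.
  have h3 := LD _ _ (Npair_lt (Npair_lt fr zr) lr) (Npair_lt (Npair_lt fr kr) lr).
  rewrite (_ : (f, kk, ll) - (f, 0, ll) = (0, kk, 0)) in h3; last first.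
    by rewrite -[LHS]/(f - f, kk - 0, ll - ll) !subrr subr0.
  rewrite !Npair !N0 max_l ?le_max ?N_ge0 ?orbT // max_r ?N_ge0 // in h3.
  rewrite (le_trans (ND _ _)) // (le_trans (lerD h1 h3)) //.
  have := ler_wpM2l L0 h2; rewrite /A3 -/kk; lra.
have invariant_q : forall z, N z < rho -> q (F (z, 0)) = q z.
  move=> z zrho; have zr' : N z < r := sub_r _ zrho.
  pose A2 := 162 * A; have A20 : 0 <= A2 by rewrite mulr_ge0 // ltW.
  have [W2 W2E] : {W2 | W2 = 2 * 2 ^+ m * K + 2 ^+ m * (2 * 2 ^+ b * K') +
      (2 ^+ m * 2 ^+ b + 2 ^+ b) * A2 * Bq} by eexists.
  have p2 n : 0 <= (2 : R) ^+ n by rewrite exprn_ge0.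
  have W20 : 0 <= W2.
    rewrite W2E; apply: addr_ge0; first apply: addr_ge0.
    - by apply: mulr_ge0 => //; apply: mulr_ge0.
    - by apply: mulr_ge0 => //; apply: mulr_ge0 => //; apply: mulr_ge0.
    by apply: mulr_ge0 => //; apply: mulr_ge0 => //; apply: addr_ge0 => //; apply: mulr_ge0.
  have [W3 W3E] : {W3 | W3 = 2 ^+ m * (2 * K + Bq + K')} by eexists.
  pose M := Bq + W2; have M0 : 0 <= M by rewrite addr_ge0.
  pose S := 1 + M; have S1 : 1 <= S by rewrite lerDl.
  have S0 : 0 < S by rewrite (lt_le_trans ltr01).
  pose dl := Num.min 1 (Num.min (rho / (9 * S)) (1 / A2)).
  have A2p : 0 < A2 by rewrite mulr_gt0.
  have dl0 : 0 < dl by rewrite !lt_min ltr01 !divr_gt0 // mulr_gt0.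
  pose Kt := 3 * W2 + L * (L * S) + L * 2 + 2 * W3 + 162 * A3 * S * M.
  apply/esym/eqP; rewrite -subr_eq0; apply/eqP/N_eq0/eqP; rewrite eq_le N_ge0 andbT.
  apply: (@le_of_scale _ _ Kt dl) => // e e0; rewrite !lt_min => /and3P[e1 es ea].
  have {}e1 := ltW e1.
  have {}es : e * (9 * S) < rho by rewrite -ltr_pdivlMr // mulr_gt0.
  have {}ea : e * A2 <= 1 by rewrite -ler_pdivlMr // ltW.
  set tau := e ^+ b.+1.
  have tau0 : 0 < tau by rewrite exprn_gt0.
  have tau1 : tau <= e by rewrite /tau exprS ler_piMr ?exprn_ile1 // ltW.
  pose U := tau ^+ m * e ^+ b; have U0 : 0 < U by rewrite mulr_gt0 ?exprn_gt0.
  have Ue : U <= e.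
    rewrite /U -(prednK b_gt0) exprS mulrCA ler_piMr ?(ltW e0) //.
    by rewrite mulr_ile1 ?exprn_ge0 ?exprn_ile1 ?(ltW tau0) ?(ltW e0) // (le_trans tau1).
  pose x : C := e%:C; pose t : C := tau%:C.
  have Nx : N x = e by rewrite NC gtr0_norm.
  have Nt : N t = tau by rewrite NC gtr0_norm.
  have eS : e <= e * S by rewrite ler_peMr // ltW.
  have eS0 : 0 < e * S by rewrite mulr_gt0.
  have erho : 9 * e < rho by clear -es eS; lra.
  have e2r : 2 * e < r by clear -erho e0 rho_r r0; lra.
  have er : e < r by clear -e2r e0; lra.
  have xr : N x < r by rewrite Nx.
  have tr : N t < r by rewrite Nt; exact: le_lt_trans er.
  have ea' : A2 * e <= 1 by rewrite mulrC.
  pose Dasymp := D_asymp K0 K'0 Dc cq qB e0 e1 A20 ea' e2r.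
  have xx0 : N (x - e%:C) <= A2 * e * e by rewrite subrr N0 !mulr_ge0 // ltW.
  have tt0 : N (t - (e ^+ b.+1)%:C) <= A2 * e * e ^+ b.+1.
    by rewrite subrr N0 !mulr_ge0 ?exprn_ge0 // ltW.
  have eU0 : 0 < e * U by rewrite mulr_gt0.
  have DP := Dasymp z x t zr' xx0 tt0; rewrite -/U -W2E in DP.
  have eUU : e * U <= U by rewrite ler_piMl ?(ltW U0).
  have DPM : N (D ((z, x), t)) <= M * U.
    rewrite (le_trans (NleD _ (U%:C * q z))) // NM NC (gtr0_norm U0).
    have := ler_wpM2l W20 eUU; have := ler_wpM2l (ltW U0) (qB _ zr').
    rewrite /M; clear -DP; lra.
  set P := D ((z, x), t) in DP DPM.
  pose Qv := Q ((z, x), t).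
  have QvE : Qv = t + P by rewrite /P DE /= addrC subrK.
  have MUe : M * U <= M * e by rewrite ler_wpM2l.
  have NQv : N Qv <= e * S.
    rewrite QvE (le_trans (ND _ _)) // Nt /S; clear -MUe DPM tau1; lra.
  have Qvrho : N Qv < rho by clear -NQv es eS0; lra.
  have zQ : N ((z, Qv) : C * C) < rho by exact: Npair_lt.
  pose f := F (z, Qv); pose f0 := F (z, 0); pose f1 := F (0, t).
  have fr : N f < r by exact: F2r.
  have z0rho : N ((z, 0) : C * C) < rho by rewrite Npair N0 max_l ?N_ge0.
  have f0r : N f0 < r by exact: F2r.
  have N0t : N ((0, t) : C * C) = tau by rewrite Npair N0 max_r ?N_ge0.
  have trho : tau < rho by apply: le_lt_trans tau1 _; clear -erho e0; lra.
  have f1t : N f1 <= 2 * tau by have := F2 (0, t); rewrite N0t; apply.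
  have f1r : N f1 < r by apply: F2r; rewrite N0t.
  have Nxt : N ((x, t) : C * C) = e by rewrite Npair Nx Nt max_l.
  have xtr : N ((x, t) : C * C) < r by rewrite Nxt.
  have ffr : N (f - f0) <= L * (e * S).
    have := LF (z, 0) (z, Qv); rewrite (_ : (z, Qv) - (z, 0) = (0, Qv)); last first.
      by rewrite -[LHS]/(z - z, Qv - 0) subrr subr0.
    rewrite [N (0, Qv)]Npair N0 max_r ?N_ge0 // => H.
    by rewrite (le_trans (H (sub_r _ z0rho) (sub_r _ zQ))) // ler_wpM2l.
  pose kk := k (x, t); pose ll := l (x, t); pose x0 := k (0, t); pose t0 := l (0, t).
  have kk1 : N (kk - e%:C) <= A2 * e * e.
    have := tk _ xtr; rewrite Nxt /= -/kk => h; rewrite (le_trans h) // /A2 expr2.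
    have : 0 <= A * (e * e) by rewrite !mulr_ge0 // ltW.
    clear; lra.
  have ll1 : N (ll - (e ^+ b.+1)%:C) <= A2 * e * e ^+ b.+1.
    have hE p : N p < r -> hol (fun p => l p - p.2) p.
      by move=> pr; apply: holB; [exact: hl|apply: hol_snd; exact: hol_id].
    have r9 : 9 * e < r := sub_r _ erho.
    have Nx0 : N ((x, 0) : C * C) <= e by rewrite Npair N0 max_l ?N_ge0 ?Nx.
    have dd : ((x, t) : C * C) - (x, 0) = (0, t) by rewrite -[LHS]/(x - x, t - 0) subrr subr0.
    have := quad_lip (p' := (x, t)) (ltW A0) e0 r9 hE tl Nx0.
    rewrite dd N0t => /(_ tau1) /=.
    rewrite lx0 ?Nx; last by clear -erho e0; lra.
    by rewrite !subr0 -/ll -/tau /A2.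
  have x01 : N x0 <= A2 * tau ^+ 2.
    have := tk (0, t); rewrite N0t => /(_ _) /=; rewrite subr0 -/x0 => h.
    rewrite (le_trans (h _)) //; first by rewrite -Nt.
    by rewrite ler_wpM2r ?sqr_ge0 // /A2; clear -A0; lra.
  have t01 : N t0 <= 2 * tau by have := l2 (0, t); rewrite N0t; apply.
  have f2r : N (F (z, t)) < r.
    have zt : N ((z, t) : C * C) < rho by apply: Npair_lt; rewrite ?Nt.
    exact: F2r.
  have D1 := Dasymp f kk ll fr kk1 ll1; rewrite -/U -W2E in D1.
  have D2 := Dasymp f1 kk ll f1r kk1 ll1; rewrite -/U -W2E in D2.
  pose Dsm := D_small K0 K'0 Dc cq qB b_gt0 e0 e1 ea' e2r.
  have D3 := Dsm f1 x0 t0 f1r x01 t01; rewrite -/U -W3E in D3.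
  have D4 := Dsm (F (z, t)) x0 t0 f2r x01 t01; rewrite -/U -W3E in D4.
  (* the second-order part of w |-> G(z, w) *)
  pose E w := G (z, w) - w.
  have E5 : N (E Qv - E t) <= 162 * A3 * (e * S) * (M * U).
    have hE w : N w < rho -> hol E w.
      move=> wr; apply: holB; last exact: hol_id.
      apply: (hol_comp (f := fun w : C => (z, w) : C * C)).
        by apply: hol_pair; [exact: hol_cst|exact: hol_id].
      by apply: hG; exact: sub_r _ (Npair_lt zrho wr).
    have s9 : 9 * (e * S) < rho by clear -es; lra.
    have tS : N t <= e * S by rewrite Nt; exact: le_trans tau1 eS.
    have QP : Qv - t = P by rewrite QvE addrC addKr.
    have PS : N (Qv - t) <= e * S by rewrite QP /S; clear -MUe DPM e0; lra.
    have := quad_lip A30 eS0 s9 hE (fun w => Gz z w zrho) tS PS.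
    move/le_trans; apply; rewrite QP ler_wpM2l //.
    by apply: mulr_ge0; [exact: mulr_ge0|exact: ltW].
  have eq1 : G (z, Qv) = ll + D ((f, kk), ll).
    by rewrite eqn // -/Qv -/f -/kk -/ll DE /= addrC subrK.
  have eq2 : G (z, t) = t0 + D ((F (z, t), x0), t0).
    have := eqn _ _ _ zr' zr tr; rewrite (Qx _ _ zr' tr) => ->.
    by rewrite DE /= addrC subrK.
  have eq3 : G (0, t) = ll + D ((f1, kk), ll).
    have := eqn _ _ _ zr xr tr; rewrite (Q0 _ _ xr tr) => ->.
    by rewrite DE /= addrC subrK.
  have eq4 : G (0, t) = t0 + D ((f1, x0), t0).
    have := eqn _ _ _ zr zr tr; rewrite (Q0 _ _ zr tr) => ->.
    by rewrite DE /= addrC subrK.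
  have lE : ll - t0 = D ((f1, x0), t0) - D ((f1, kk), ll).
    have : ll + D ((f1, kk), ll) = t0 + D ((f1, x0), t0) by rewrite -eq3.
    move=> h; have e2 : ll = t0 + D ((f1, x0), t0) - D ((f1, kk), ll).
      by rewrite -h addrK.
    by rewrite {1}e2; ring.
  have PE : P = ll + D ((f, kk), ll) - (t0 + D ((F (z, t), x0), t0)) - (E Qv - E t).
    by rewrite -eq1 -eq2 /E QvE; ring.
  (* U = t^m x^b; each summand on the right is O(e * U) *)
  have main : U%:C * (q z - q f0) = - (P - U%:C * q z) + (D ((f, kk), ll) - U%:C * q f)
     + U%:C * (q f - q f0) - (D ((f1, kk), ll) - U%:C * q f1) - U%:C * (q f1 - q 0)
     + D ((f1, x0), t0) - D ((F (z, t), x0), t0) - (E Qv - E t).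
    rewrite q00 {1}PE.
    rewrite (_ : ll + D ((f, kk), ll) - (t0 + D ((F (z, t), x0), t0)) =
      (ll - t0) + D ((f, kk), ll) - D ((F (z, t), x0), t0)); last by ring.
    by rewrite lE; ring.
  have n1 : N (U%:C * (q f - q f0)) <= L * (L * S) * (e * U).
    rewrite NM NC (gtr0_norm U0).
    have := ler_wpM2l (ltW U0) (Lq _ _ f0r fr); have := ler_wpM2l L0 ffr => h1 h2.
    have := ler_wpM2l (ltW U0) h1; clear -h2; lra.
  have n2 : N (U%:C * (q f1 - q 0)) <= L * 2 * (e * U).
    rewrite NM NC (gtr0_norm U0).
    have := Lq _ _ zr f1r; rewrite [f1 - 0]subr0 => h1.
    have h2 : L * N f1 <= L * (2 * e) by rewrite ler_wpM2l //; clear -f1t tau1; lra.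
    have := ler_wpM2l (ltW U0) (le_trans h1 h2); clear; lra.
  have tri (a1 a2 a3 a4 a5 a6 a7 a8 : C) :
      N (- a1 + a2 + a3 - a4 - a5 + a6 - a7 - a8) <=
      N a1 + N a2 + N a3 + N a4 + N a5 + N a6 + N a7 + N a8.
    by rewrite -[in leRHS](NN a1); do 6! (rewrite (le_trans (NB _ _)) ?lerD2r // ||
      rewrite (le_trans (ND _ _)) ?lerD2r //); rewrite (le_trans (ND _ _)).
  have := tri (P - U%:C * q z) (D ((f, kk), ll) - U%:C * q f) (U%:C * (q f - q f0))
    (D ((f1, kk), ll) - U%:C * q f1) (U%:C * (q f1 - q 0)) (D ((f1, x0), t0))
    (D ((F (z, t), x0), t0)) (E Qv - E t).
  rewrite -main NM NC (gtr0_norm U0) => H.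
  have : U * N (q z - q f0) <= Kt * (e * U).
    by apply: (le_trans H); rewrite /Kt; clear -DP D1 D2 D3 D4 E5 n1 n2; lra.
  move=> H2; rewrite -(ler_pM2l U0) (le_trans H2) //.
  by apply: le_of_eq; ring.
exists rho => // z zrho; split; [exact: invariant_q|exact: G_z0].
Qed.

End Core.

Section Normalized.
Variable R : realType.
Local Notation C := (R[i]).

(** The integers m and b are the lowest orders of Q - t in t and then in x. As Q - t vanishes for
    z = 0 and for x = 0, so does its leading coefficient; hence q(0) = 0 and b > 0. *)
Theorem normalized_fixed (Q : (C * C) * C -> C) (F G k l : C * C -> C) :
  (\forall p \near (0 : ((C * C) * C)%type), hol Q p) ->
  (\forall p \near (0 : (C * C)%type), hol F p) ->
  (\forall p \near (0 : (C * C)%type), hol G p) ->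
  (\forall p \near (0 : (C * C)%type), hol l p) ->
  (\forall p \near (0 : (C * C)%type), Q ((0, p.1), p.2) = p.2) ->
  (\forall p \near (0 : (C * C)%type), Q ((p.1, 0), p.2) = p.2) ->
  (exists A : R, \forall p \near (0 : (C * C)%type),
     [/\ N (F p - p.1) <= A * N p ^+ 2, N (k p - p.1) <= A * N p ^+ 2 &
         N (l p - p.2) <= A * N p ^+ 2]) ->
  (\forall p \near (0 : ((C * C) * C)%type),
     G (p.1.1, Q p) = Q ((F (p.1.1, Q p), k (p.1.2, p.2)), l (p.1.2, p.2))) ->
  ~ (\forall p \near (0 : ((C * C) * C)%type), Q p = p.2) ->
  \forall z \near (0 : C), F (z, 0) = z /\ G (z, 0) = 0.
Proof.
move=> hQ hF hG hl Q0 Qx [A tA] eqn nd.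
pose D (p : (C * C) * C) := Q p - p.2.
have hD : \forall p \near (0 : ((C * C) * C)%type), hol D p.
  apply: filterS hQ => p hp; apply: holB => //.
  by apply: hol_snd; exact: hol_id.
have [D0|[m [c [hc cn [K [d1 [K0 d10 Dc]]]]]]] := lowest_order (near_hol0 hD) hD.
  by exfalso; apply: nd; apply: filterS D0 => p /eqP; rewrite subr_eq0 => /eqP.
have [//|[b [q [hq qn [K' [d2 [K'0 d20 cq]]]]]]] := lowest_order (near_hol0 hc) hc.
have [rD [LD [rD0 LD0 _ lipD]]] := hol_lip0 hD.
have [rF [LF [rF0 LF0 _ lipF]]] := hol_lip0 hF.
have [rq [Lq [rq0 Lq0 _ lipq]]] := hol_lip0 hq.
have /near0E[rl rl0 {}hl] := hl; have /near0E[rG rG0 {}hG] := hG.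
have /near0E[r1 r10 {}Q0] := Q0; have /near0E[r2 r20 {}Qx] := Qx.
have /near0E[r3 r30 {}tA] := tA; have /near0E[r4 r40 {}eqn] := eqn.
pose r := Num.min (Num.min (Num.min d1 d2) (Num.min rD rF))
  (Num.min (Num.min (Num.min rq rl) (Num.min rG r1)) (Num.min (Num.min r2 r3) r4)).
have r0 : 0 < r by rewrite !lt_min d10 d20 rD0 rF0 rq0 rl0 rG0 r10 r20 r30 r40.
have rP (a : R) : a < r -> [/\ [/\ a < d1, a < d2, a < rD & a < rF],
    [/\ a < rq, a < rl, a < rG & a < r1] & [/\ a < r2, a < r3 & a < r4]].
  rewrite !lt_min => /andP[/andP[/andP[? ?] /andP[? ?]]].
  by move=> /andP[/andP[/andP[? ?] /andP[? ?]] /andP[/andP[? ?] ?]].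
have Dx x t : N x < r -> N t < r -> D ((0, x), t) = 0.
  move=> xr tr; have /rP[_ [_ _ _ h] _] := Npair_lt xr tr.
  by rewrite /D (Q0 (x, t)) // subrr.
have Dz z t : N z < r -> N t < r -> D ((z, 0), t) = 0.
  move=> zr tr; have /rP[_ _ [h _ _]] := Npair_lt zr tr.
  by rewrite /D (Qx (z, t)) // subrr.
have Dc' z x t : N z < r -> N x < r -> N t < r ->
    N (D ((z, x), t) - t ^+ m * c (z, x)) <= K * N t ^+ m.+1.
  move=> zr xr /rP[[td _ _ _] _ _]; apply: Dc => //.
  by have /rP[[]] := Npair_lt zr xr.
have cq' z x : N z < r -> N x < r -> N (c (z, x) - x ^+ b * q z) <= K' * N x ^+ b.+1.
  by move=> /rP[[_ zd _ _] _ _] /rP[[_ xd _ _] _ _]; exact: cq.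
have z0r : N (0 : C) < r by rewrite N0.
have c0 z x : N z < r -> N x < r ->
    (forall t, N t < r -> D ((z, x), t) = 0) -> c (z, x) = 0.
  move=> zr xr Dt; apply: N_le0.
  apply: (@le_of_scale _ _ K r) => // s s0 sr.
  have Ns : N (s%:C : C) = s by rewrite NC gtr0_norm.
  have := Dc' z x s%:C zr xr; rewrite Ns => /(_ sr).
  rewrite Dt ?Ns // sub0r NN NM NX Ns exprSr mulrCA.
  by rewrite ler_pM2l // exprn_gt0.
have q0 : q 0 = 0.
  apply: N_le0.
  apply: (@le_of_scale _ _ K' r) => // s s0 sr.
  have Ns : N (s%:C : C) = s by rewrite NC gtr0_norm.
  have := cq' 0 s%:C z0r; rewrite Ns => /(_ sr).
  rewrite c0 ?Ns // => [|t tr]; last by apply: Dx; rewrite ?Ns.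
  by rewrite sub0r NN NM NX Ns exprSr mulrCA ler_pM2l // exprn_gt0.
have b_gt0 : (0 < b)%N.
  rewrite lt0n; apply/eqP => b0; apply: qn; apply/near0E; exists r => // z zr.
  have := cq' z 0 zr z0r; rewrite c0 // => [|t tr]; last exact: Dz.
  rewrite b0 expr0 mul1r sub0r NN N0 expr1 mulr0 => h.
  by apply/N_eq0/eqP; rewrite eq_le N_ge0 h.
pose A' := Num.max 1 A; have A1 : 1 <= A' by rewrite le_max lexx.
have AA (x : R) (y : C * C) : x <= A * N y ^+ 2 -> x <= A' * N y ^+ 2.
  by move=> /le_trans; apply; rewrite ler_wpM2r ?sqr_ge0 // le_max lexx orbT.
pose L := LD + LF + Lq.
have LDL : LD <= L by rewrite /L -addrA lerDl addr_ge0 // ltW.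
have LFL : LF <= L by rewrite /L addrAC lerDr addr_ge0 // ltW.
have LqL : Lq <= L by rewrite /L lerDr addr_ge0 // ltW.
have [|||||||||||||||||||||||rho rho0 H] := @normalized_core R Q D F G k l c q m b r L A' K K' (Lq * r).
all: (try by []); (try exact: ltW).
- by rewrite !addr_ge0 // ltW.
- by rewrite mulr_ge0 // ltW.
- by move=> x t xr tr; have /rP[_ [_ _ _ h] _] := Npair_lt xr tr; exact: (Q0 (x, t)).
- by move=> z t zr tr; have /rP[_ _ [h _ _]] := Npair_lt zr tr; exact: (Qx (z, t)).
- by move=> p /rP[_ _ [_ /tA[h _ _] _]]; exact: AA.
- by move=> p /rP[_ _ [_ /tA[_ h _] _]]; exact: AA.
- by move=> p /rP[_ _ [_ /tA[_ _ h] _]]; exact: AA.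
- move=> z x t zr xr tr; have /rP[_ _ [_ _ h]] := Npair_lt (Npair_lt zr xr) tr.
  exact: (eqn ((z, x), t)).
- move=> p p' /rP[[_ _ h _] _ _] /rP[[_ _ h' _] _ _].
  by rewrite (le_trans (lipD p p' h h')) // ler_wpM2r ?N_ge0.
- move=> p p' /rP[[_ _ _ h] _ _] /rP[[_ _ _ h'] _ _].
  by rewrite (le_trans (lipF p p' h h')) // ler_wpM2r ?N_ge0.
- move=> p p' /rP[_ [h _ _ _] _] /rP[_ [h' _ _ _] _].
  by rewrite (le_trans (lipq p p' h h')) // ler_wpM2r ?N_ge0.
- by move=> p /rP[_ [_ h _ _] _]; exact: hl.
- by move=> p /rP[_ [_ _ h _] _]; exact: hG.
- move=> z zr; have /rP[_ [h _ _ _] _] := zr; have /rP[_ [h0 _ _ _] _] := z0r.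
  have := lipq 0 z h0 h; rewrite q0 !subr0 => h1; rewrite (le_trans h1) //.
  by rewrite ler_wpM2l // ltW.
have := @fixed_of_invariant R q (fun z => F (z, 0)) A (Num.min r rho) _ q0 hq qn _ _.
have Nz (z : C) : N ((z, 0) : C * C) = N z by rewrite Npair N0 max_l ?N_ge0.
rewrite lt_min r0 rho0 => /(_ isT) fx.
have {}fx : \forall z \near (0 : C), F (z, 0) = z.
  apply: fx => z; rewrite lt_min => /andP[zr zrho]; last by case: (H z zrho).
  by have := tA (z, 0); rewrite Nz => h; have /rP[_ _ [_ /h[]]] := zr.
have /near0E[s s0 sP] := fx; apply/near0E; exists (Num.min s rho); first by rewrite lt_min s0.
move=> z; rewrite lt_min => /andP[zs zrho]; split; first exact: sP.
by case: (H z zrho).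
Qed.

End Normalized.

(** * Germs of maps that vanish at the origin *)

Section Small.
Variable R : realType.
Local Notation C := (R[i]).

(** Convergence to 0 at 0 in terms of radii: germs are composed by applying one such property to
    another. *)
Definition small (V W : normedModType C) (g : V -> W) := forall e : R, 0 < e ->
  exists2 d : R, 0 < d & forall v, N v < d -> N (g v) < e.

Section Lemmas.
Variables V W U : normedModType C.

Lemma small_hol (g : V -> W) : hol g 0 -> g 0 = 0 -> small g.
Proof.
move=> hg g0 e /(hol_cont hg)[d d0 dP]; exists d => // v /dP.
by rewrite add0r g0 subr0.
Qed.

Lemma small_near_hol (g : V -> W) : (\forall v \near (0 : V), hol g v) -> g 0 = 0 -> small g.
Proof. by move=> /near_hol0; exact: small_hol. Qed.

Lemma small_comp (f : V -> W) (g : W -> U) : small f -> small g -> small (fun v => g (f v)).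
Proof. by move=> sf sg e /sg[d /sf[d' d'0 d'P] dP]; exists d' => // v /d'P /dP. Qed.

Lemma small_pair (f : V -> W) (g : V -> U) : small f -> small g ->
  small (fun v => (f v, g v) : (W * U)%type).
Proof.
move=> sf sg e e0; have [d d0 dP] := sf e e0; have [d' d'0 d'P] := sg e e0.
exists (Num.min d d') => [|v]; first by rewrite lt_min d0.
by rewrite lt_min => /andP[/dP a /d'P b]; exact: Npair_lt.
Qed.

Lemma small_fst (f : V -> (W * U)%type) : small f -> small (fun v => (f v).1).
Proof. by move=> sf e /sf[d d0 dP]; exists d => // v /dP; apply: le_lt_trans; exact: Nfst. Qed.

Lemma small_snd (f : V -> (W * U)%type) : small f -> small (fun v => (f v).2).
Proof. by move=> sf e /sf[d d0 dP]; exists d => // v /dP; apply: le_lt_trans; exact: Nsnd. Qed.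

Lemma small_id : small (@id V).
Proof. by move=> e e0; exists e. Qed.

Lemma small0 : small (fun _ : V => 0 : W).
Proof. by move=> e e0; exists 1 => // v _; rewrite N0. Qed.

Lemma near_small (g : V -> W) (P : set W) : small g -> (\forall w \near (0 : W), P w) ->
  \forall v \near (0 : V), P (g v).
Proof.
move=> sg /near0E[d /sg[d' d'0 d'P] dP]; apply/near0E; exists d' => // v /d'P; exact: dP.
Qed.

Lemma near_hol_comp (f : V -> W) (g : W -> U) : small f ->
  (\forall v \near (0 : V), hol f v) -> (\forall w \near (0 : W), hol g w) ->
  \forall v \near (0 : V), hol (fun v => g (f v)) v.
Proof.
by move=> sf hf /(near_small sf); apply: filterS2 hf => v; exact: hol_comp.
Qed.

End Lemmas.

Lemma smallD (V W : normedModType C) (f g : V -> W) :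
  small f -> small g -> small (fun v => f v + g v).
Proof.
move=> sf sg e e0; have e2 : 0 < e / 2 by rewrite divr_gt0.
have [d d0 dP] := sf _ e2; have [d' d'0 d'P] := sg _ e2.
exists (Num.min d d') => [|v]; first by rewrite lt_min d0.
rewrite lt_min => /andP[/dP a /d'P b].
by rewrite (le_lt_trans (ND _ _)) // (splitr e) ltrD.
Qed.

Lemma smallZ (V W : normedModType C) (a : C) (f : V -> W) : small f -> small (fun v => a *: f v).
Proof.
move=> sf e e0; have a1 : 0 < N a + 1 by rewrite ltr_wpDl ?N_ge0.
have [d d0 dP] := sf _ (divr_gt0 e0 a1); exists d => // v /dP.
rewrite ltr_pdivlMr // NZ; apply: le_lt_trans.
by rewrite mulrC ler_wpM2l ?N_ge0 // lerDl.
Qed.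

Definition cj (p : C * C) : C * C := (conjc p.1, conjc p.2).

Lemma cjK : involutive cj.
Proof. by case=> a b; rewrite /cj /= !conjcK. Qed.

Lemma N_cj p : N (cj p) = N p.
Proof. by case: p => a b; rewrite /cj !Npair !Nconj. Qed.

Lemma cjD p q : cj (p + q) = cj p + cj q.
Proof. by rewrite /cj /= !rmorphD. Qed.

Lemma cjZ a p : cj (a *: p) = conjc a *: cj p.
Proof.
by rewrite /cj /= -[a *: p.1]/(a * p.1) -[a *: p.2]/(a * p.2) !rmorphM.
Qed.

Lemma cj0 : cj 0 = 0.
Proof. by apply: N_eq0; rewrite N_cj N0. Qed.

Lemma small_cj (V : normedModType C) (f : V -> (C * C)%type) : small f -> small (fun v => cj (f v)).
Proof.
move=> sf; apply: (small_comp sf) => e e0.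
by exists e; [exact: e0|move=> v ve; rewrite N_cj; exact: ve].
Qed.

(** Three applications of the identity principle in one variable, one coordinate at a time. *)
Lemma identity3 (f : (C * C) * C -> C) (d : R) : 0 < d ->
  (\forall p \near (0 : ((C * C) * C)%type), hol f p) ->
  (forall a b s : R, `|a| < d -> `|b| < d -> `|s| < d ->
     f ((a%:C, b%:C), s%:C) = 0) ->
  \forall p \near (0 : ((C * C) * C)%type), f p = 0.
Proof.
move=> d0 hf f0; have [r [B [r0 fb]]] := hol_bhol (near_hol0 hf) hf.
have fh p : N p < r -> hol f p by move=> pr; case: fb => /(_ p pr); rewrite add0r.
have fB p : N p < r -> N (f p) <= B by move=> pr; case: fb => _ /(_ p pr); rewrite add0r.
pose s := Num.min d (r / 8).
have s0 : 0 < s by rewrite lt_min d0 divr_gt0.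
have sr (x : R) : x < s -> x < d /\ x < r.
  by rewrite lt_min => /andP[? ?]; split=> //; lra.
have sC (x : R) : 0 < x -> x < s -> `|x| < d /\ N (x%:C : C) < r.
  by move=> x0 /sr[xd xr]; rewrite NC gtr0_norm.
have r8 (z : C) : N z < s -> N z <= r / 8 by rewrite lt_min => /andP[_ /ltW].
have real_r (x : R) : `|x| < s -> N (x%:C : C) < r by rewrite NC => /sr[].
have step1 (a b : R) (t : C) : `|a| < s -> `|b| < s -> N t < s -> f ((a%:C, b%:C), t) = 0.
  move=> as_ bs ts.
  apply: (@taylor_null _ (fun t => f ((a%:C, b%:C), t)) r B d) => //; last exact: r8.
  - move=> z zr; apply: (hol_comp (f := fun t : C => ((a%:C, b%:C), t) : C * C * C)).
      by apply: hol_pair; [exact: hol_cst|exact: hol_id].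
    by apply: fh; apply: Npair_lt => //; apply: Npair_lt; exact: real_r.
  - by move=> z zr; apply: fB; apply: Npair_lt => //; apply: Npair_lt; exact: real_r.
  - move=> x x0 xd; apply: f0; last by rewrite gtr0_norm.
      by case: (sr _ as_).
    by case: (sr _ bs).
have step2 (a : R) (y t : C) : `|a| < s -> N y < s -> N t < s -> f ((a%:C, y), t) = 0.
  move=> as_ ys ts.
  apply: (@taylor_null _ (fun y => f ((a%:C, y), t)) r B s) => //; last exact: r8.
  - move=> z zr; apply: (hol_comp (f := fun y : C => ((a%:C, y), t) : C * C * C)).
      apply: hol_pair; last exact: hol_cst.
      by apply: hol_pair; [exact: hol_cst|exact: hol_id].
    apply: fh; apply: Npair_lt; last by case: (sr _ ts).
    by apply: Npair_lt => //; exact: real_r.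
  - move=> z zr; apply: fB; apply: Npair_lt; last by case: (sr _ ts).
    by apply: Npair_lt => //; exact: real_r.
  - by move=> x x0 xs; apply: step1 => //; rewrite gtr0_norm.
apply/near0E; exists s => // -[[z y] t] h.
have ts : N t < s := le_lt_trans (Nsnd ((z, y), t)) h.
have zy := le_lt_trans (Nfst ((z, y), t)) h.
have zs : N z < s := le_lt_trans (Nfst (z, y)) zy.
have ys : N y < s := le_lt_trans (Nsnd (z, y)) zy.
apply: (@taylor_null _ (fun z => f ((z, y), t)) r B s) => //; last exact: r8.
- move=> x xr; apply: (hol_comp (f := fun z : C => ((z, y), t) : C * C * C)).
    apply: hol_pair; last exact: hol_cst.
    by apply: hol_pair; [exact: hol_id|exact: hol_cst].
  apply: fh; apply: Npair_lt; last by case: (sr _ ts).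
  by apply: Npair_lt => //; case: (sr _ ys).
- move=> x xr; apply: fB; apply: Npair_lt; last by case: (sr _ ts).
  by apply: Npair_lt => //; case: (sr _ ys).
- by move=> x x0 xs; apply: step2 => //; rewrite gtr0_norm.
Qed.

End Small.

(** * Segre varieties as graphs *)

Section Conjugate.
Variable R : realType.
Local Notation C := (R[i]).

(** The antiholomorphic involution for which the reality of rho becomes a symmetry of its
    complexification. *)
Definition swapcj (p : (C * C) * (C * C)) : (C * C) * (C * C) := (cj p.2, cj p.1).

Lemma N_swapcj p : N (swapcj p) = N p.
Proof.
case: p => a b; rewrite /swapcj [LHS]Npair [RHS]Npair /= maxC.
by rewrite -(N_cj a) -(N_cj b).
Qed.

Lemma swapcjD p q : swapcj (p + q) = swapcj p + swapcj q.
Proof. by rewrite /swapcj /= !cjD. Qed.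

Lemma swapcjZ a p : swapcj (a *: p) = conjc a *: swapcj p.
Proof. by rewrite /swapcj /= !cjZ. Qed.

Lemma swapcj0 : swapcj 0 = 0.
Proof. by apply: N_eq0; rewrite N_swapcj N0. Qed.

End Conjugate.

Section Segre.
Variable R : realType.
Local Notation C := (R[i]).
Local Notation C2' := ((C * C)%type).
Local Notation C3' := ((C * C * C)%type).

Variables (P : C2' * C2' -> C) (L : C2' * C2' -> C).
Hypothesis P0 : P 0 = 0.
Hypothesis hP : \forall p \near (0 : (C2' * C2')%type), hol P p.
Hypothesis realP : \forall p \near (0 : (C2' * C2')%type),
  (P p)^* = P (swapcj p).
Hypothesis derP : is_der P 0 L.
Hypothesis Liy : L ((0, 'i%C), (0, - 'i%C)) != 0.

(** Differentiate the reality of P; the derivative is unique. *)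
Lemma L_conj x y : conjc (L (x, y)) = L (cj y, cj x).
Proof.
have d2 : is_der (fun p => (P (swapcj p))^*) 0 (fun h => (L (swapcj h))^*).
  apply: (is_der_conj (d := conjc)); [exact: swapcjD|exact: swapcjZ|exact: N_swapcj|
    exact: (rmorphD conjc)|exact: (rmorphM conjc)|exact: Nconj|].
  by rewrite swapcj0.
have d3 : is_der P 0 (fun h => (L (swapcj h))^*).
  by apply: is_der_near d2; apply: filterS realP => p pP; rewrite -pP conjcK.
have := is_der_uniq derP d3 (x, y) => ->.
by rewrite conjcK.
Qed.

Let e1 : C2' * C2' := ((0, 1), (0, 0)).
Let e2 : C2' * C2' := ((0, 0), (0, 1)).

Let linL : forall (a : C) u v, L (a *: u + v) = a *: L u + L v.
Proof. by case: derP. Qed.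

Let Lsplit : L ((0, 'i%C), (0, - 'i%C)) = 'i%C * L e1 - 'i%C * L e2.
Proof.
rewrite -[_ * L e1]/('i%C *: L e1) -[_ * L e2]/('i%C *: L e2) -!(linZ linL) -(linB linL).
congr L; rewrite /e1 /e2 -[RHS]/(('i%C *: 0 - 'i%C *: 0, 'i%C *: 1 - 'i%C *: 0),
  ('i%C *: 0 - 'i%C *: 0, 'i%C *: 0 - 'i%C *: 1)) !scaler0 !subr0 sub0r.
by rewrite -[_ *: 1]/(_ * 1) mulr1.
Qed.

(** The two partial derivatives are conjugate. If one of them vanished, so would both, and with
    them the value of L in Liy. *)
Lemma L_neq0 : L e1 != 0 /\ L e2 != 0.
Proof.
have E : (L e1)^* = L e2.
  by rewrite L_conj /cj /= oppr0.
suff h : L e1 != 0 by split=> //; rewrite -E conjc_eq0.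
apply: contraNneq Liy => l0.
by rewrite Lsplit -E l0 conjc0 mulr0 subr0.
Qed.

(** Both partial derivatives of P in the second coordinates are nonzero, so P = 0 can be solved
    for w in terms of (z, x, tau) and for tau in terms of (z, w, x). *)
Lemma graphs : exists Q S : C3' -> C,
  [/\ Q 0 = 0 /\ S 0 = 0,
      \forall p \near (0 : C3'), hol Q p, \forall p \near (0 : C3'), hol S p,
      \forall p \near (0 : (C2' * C2')%type), P p = 0 <-> p.1.2 = Q ((p.1.1, p.2.1), p.2.2) &
      \forall p \near (0 : (C2' * C2')%type), P p = 0 <-> p.2.2 = S (p.1, p.2.1)].
Proof.
have [l1n l2n] := L_neq0.
pose f (p : C3' * C) : C2' * C2' := ((p.1.1.1, p.2), (p.1.1.2, p.1.2)).
pose g (p : C3' * C) : C2' * C2' := (p.1.1, (p.1.2, p.2)).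
have idh (p : C3' * C) : hol id p := hol_id p.
have fh p : hol f p.
  by apply: hol_pair; apply: hol_pair; repeat first [exact: idh|apply: hol_fst|apply: hol_snd].
have gh p : hol g p.
  by apply: hol_pair; [|apply: hol_pair]; repeat first [exact: idh|apply: hol_fst|apply: hol_snd].
have f0 : f 0 = 0 by [].
have g0 : g 0 = 0 by [].
have sf : small f by apply: small_hol (fh 0) f0.
have sg : small g by apply: small_hol (gh 0) g0.
have linf : is_der f 0 f.
  apply: (@lin_is_der _ _ _ f _ 0 1) => [a u v|v]; first by [].
  rewrite mul1r; apply: Npair_le; apply: Npair_le.
  - by rewrite (le_trans (Nfst v.1.1)) // (le_trans (Nfst v.1)) // Nfst.
  - exact: Nsnd.
  - by rewrite (le_trans (Nsnd v.1.1)) // (le_trans (Nfst v.1)) // Nfst.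
  - by rewrite (le_trans (Nsnd v.1)) // Nfst.
have ling : is_der g 0 g.
  apply: (@lin_is_der _ _ _ g _ 0 1) => [a u v|v]; first by [].
  rewrite mul1r; apply: Npair_le; last apply: Npair_le.
  - by rewrite (le_trans (Nfst v.1)) // Nfst.
  - by rewrite (le_trans (Nsnd v.1)) // Nfst.
  - exact: Nsnd.
have hPf : \forall p \near (0 : (C3' * C)%type), hol (fun p => P (f p)) p.
  by apply: near_hol_comp hP => //; apply/near0E; exists 1.
have hPg : \forall p \near (0 : (C3' * C)%type), hol (fun p => P (g p)) p.
  by apply: near_hol_comp hP => //; apply/near0E; exists 1.
have dPf : is_der (fun p => P (f p)) 0 (fun h => L (f h)).
  by apply: is_der_comp linf _; rewrite f0.
have dPg : is_der (fun p => P (g p)) 0 (fun h => L (g h)).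
  by apply: is_der_comp ling _; rewrite g0.
have [|Q [Q0 hQ QP]] := implicit_function _ hPf dPf l1n; first by rewrite f0.
have [|S [S0 hS SP]] := implicit_function _ hPg dPg l2n; first by rewrite g0.
exists Q, S; split=> //.
  pose f' (p : C2' * C2') : C3' * C := (((p.1.1, p.2.1), p.2.2), p.1.2).
  have sf' : small f'.
    apply: small_hol => //; apply: hol_pair; [apply: hol_pair; [apply: hol_pair|]|];
      by repeat first [exact: hol_id|apply: hol_fst|apply: hol_snd].
  by have := near_small sf' QP; apply: filterS => -[[z w] [x t]].
pose g' (p : C2' * C2') : C3' * C := ((p.1, p.2.1), p.2.2).
have sg' : small g'.
  apply: small_hol => //; apply: hol_pair; [apply: hol_pair|];
    by repeat first [exact: hol_id|apply: hol_fst|apply: hol_snd].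
by have := near_small sg' SP; apply: filterS => -[[z w] [x t]].
Qed.

End Segre.

(** * Complexified invariance *)

Ltac hol_tuple := repeat match goal with
  | |- hol (fun x => (_, _)) _ => apply: hol_pair
  | |- hol (fun x => _ + _) _ => apply: holD
  | |- hol (fun x => - _) _ => apply: holN
  | |- hol (fun x => _ * _) _ => apply: holM
  | |- hol (fun x => fst _) _ => apply: hol_fst
  | |- hol (fun x => snd _) _ => apply: hol_snd
  | |- hol fst _ => apply: hol_fst; exact: hol_id
  | |- hol snd _ => apply: hol_snd; exact: hol_id
  | |- hol (fun x => x) _ => exact: hol_id
  | |- hol (fun x => ?c) _ => exact: hol_cst
  end.

Section Complexify.
Variable R : realType.
Local Notation C := (R[i]).
Local Notation C2' := ((C * C)%type).
Local Notation C3' := ((C * C * C)%type).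

Definition Hbar (H : C2' -> C2') (y : C2') : C2' := cj (H (cj y)).

Lemma conj_addi (a b : C) : (a + 'i%C * b)^* = a^* + - ('i%C * b^*).
Proof.
case: a b => [a1 a2] [b1 b2]; apply/eqP; rewrite eq_complex /=.
by apply/andP; split; apply/eqP; ring.
Qed.

Lemma conj_subi (a b : C) : (a + - ('i%C * b))^* = a^* + 'i%C * b^*.
Proof.
case: a b => [a1 a2] [b1 b2]; apply/eqP; rewrite eq_complex /=.
by apply/andP; split; apply/eqP; ring.
Qed.

Lemma hol_Hbar (H : C2' -> C2') y : hol H (cj y) -> hol (Hbar H) y.
Proof.
move=> [L HL]; eexists; apply: is_der_conj HL;
  by [exact: cjD|exact: cjZ|exact: N_cj|exact: cjD|exact: cjZ|exact: N_cj].
Qed.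

Lemma near_cj (P : set C2') : (\forall y \near (0 : C2'), P y) ->
  \forall y \near (0 : C2'), P (cj y).
Proof. exact: near_small (small_cj (@small_id R _)). Qed.

Variables (P : C2' * C2' -> C) (L : C2' * C2' -> C).
Hypothesis P0 : P 0 = 0.
Hypothesis hP : \forall p \near (0 : (C2' * C2')%type), hol P p.
Hypothesis realP : \forall p \near (0 : (C2' * C2')%type), (P p)^* = P (swapcj p).
Hypothesis derP : is_der P 0 L.
Hypothesis Liy : L ((0, 'i%C), (0, - 'i%C)) != 0.

Variable H : C2' -> C2'.
Hypothesis H0 : H 0 = 0.
Hypothesis hH : \forall x \near (0 : C2'), hol H x.
Hypothesis presH : \forall x \near (0 : C2'), P (x, cj x) = 0 -> P (H x, cj (H x)) = 0.

Lemma near_hol_Hbar : \forall y \near (0 : C2'), hol (Hbar H) y.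
Proof. by apply: filterS (near_cj hH) => y; exact: hol_Hbar. Qed.

Lemma Hbar0 : Hbar H 0 = 0.
Proof. by rewrite /Hbar cj0 H0 cj0. Qed.

(** In the coordinates (z, x, s, y) with w = s + 'i y and tau = s - 'i y, the set P = 0 is a graph
    y = phi(z, x, s). By reality of P its points over x = conj z and s real are the points
    (p, conj p) with p on the real hypersurface, where the claim is the hypothesis on H. These
    parameters are the image of the real points of C^3 under a linear isomorphism, so the
    identity principle in three variables applies. *)
Theorem complexified_invariance :
  \forall p \near (0 : (C2' * C2')%type), P p = 0 -> P (H p.1, Hbar H p.2) = 0.
Proof.
pose f (p : C3' * C) : C2' * C2' :=
  ((p.1.1.1, p.1.2 + 'i%C * p.2), (p.1.1.2, p.1.2 + - ('i%C * p.2))).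
have fh p : hol f p by rewrite /f; hol_tuple.
have flin (a : C) u v : f (a *: u + v) = a *: f u + f v.
  rewrite /f /=; congr ((_, _), (_, _)).
    rewrite -[LHS]/(a * u.1.2 + v.1.2 + 'i%C * (a * u.2 + v.2)).
    by rewrite -[RHS]/(a * (u.1.2 + 'i%C * u.2) + (v.1.2 + 'i%C * v.2)); ring.
  rewrite -[LHS]/(a * u.1.2 + v.1.2 - 'i%C * (a * u.2 + v.2)).
  by rewrite -[RHS]/(a * (u.1.2 - 'i%C * u.2) + (v.1.2 - 'i%C * v.2)); ring.
have f0 : f 0 = 0 := lin0 flin.
have fder : is_der f 0 f.
  apply: (@lin_is_der _ _ _ f flin 0 2) => v.
  have v1 : N v.1.2 <= N v by rewrite (le_trans (Nsnd v.1)) // Nfst.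
  have v2 : N v.2 <= N v := Nsnd v.
  have v3 : N v.1.1 <= N v by rewrite (le_trans (Nfst v.1)) // Nfst.
  have v0 := N_ge0 v; apply: Npair_le; apply: Npair_le.
  - by rewrite (le_trans (Nfst v.1.1)) //; lra.
  - by rewrite (le_trans (ND _ _)) // NM Ni; lra.
  - by rewrite (le_trans (Nsnd v.1.1)) //; lra.
  - by rewrite (le_trans (NB _ _)) // NM Ni; lra.
have sf : small f by apply: small_hol (fh 0) f0.
have hPf : \forall p \near (0 : (C3' * C)%type), hol (fun p => P (f p)) p.
  by apply: near_hol_comp hP => //; apply/near0E; exists 1.
have dPf : is_der (fun p => P (f p)) 0 (fun h => L (f h)).
  by apply: is_der_comp fder _; rewrite f0.
have f01 : L (f (0, 1)) != 0.
  by rewrite (_ : f (0, 1) = ((0, 'i%C), (0, - 'i%C))) // /f /= mulr1 !add0r.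
have [|phi [phi0 hphi phiP]] := implicit_function _ hPf dPf f01; first by rewrite f0.
have sphi := small_near_hol hphi phi0.
pose gr (q : C3') : C3' * C := (q, phi q).
have sgr : small gr by apply: small_pair; [exact: small_id|exact: sphi].
have zgr : \forall q \near (0 : C3'), P (f (gr q)) = 0.
  by have := near_small sgr phiP; apply: filterS => q /= ->.
have sfgr : small (fun q => f (gr q)) by exact: small_comp sgr sf.
(* by reality of P, phi commutes with the conjugation sg of the parameters *)
pose sg (q : C3') : C3' := ((q.1.2^*, q.1.1^*), q.2^*).
have Nsg q : N (sg q) = N q.
  by case: q => [[a b] c]; rewrite /sg /= !Npair !Nconj [Num.max (N b) _]maxC.
have ssg : small sg.
  by move=> e e0; exists e; [exact: e0|move=> v ve; rewrite Nsg; exact: ve].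
have fsw q y : swapcj (f (q, y)) = f (sg q, y^*).
  case: q => [[a b] c]; rewrite /swapcj /f /cj /sg /=.
  by rewrite conj_addi conj_subi.
have phisg : \forall q \near (0 : C3'), phi (sg q) = (phi q)^*.
  have n1 := near_small sfgr realP.
  have s2 : small (fun q => (sg q, (phi q)^*) : C3' * C).
    apply: small_pair => // e /sphi[d d0 dP]; exists d => // v /dP.
    by rewrite Nconj.
  have n2 := near_small s2 phiP.
  apply: filterS3 zgr n1 n2 => q Pq r1 r2; apply/esym/r2.
  by rewrite -fsw -r1 Pq rmorph0.
pose X q := (f (gr q)).1; pose Y q := (f (gr q)).2.
have sX : small X by exact: small_fst.
have sY : small Y by exact: small_snd.
pose Psi q := P (H (X q), Hbar H (Y q)).
have Psi_real : \forall q \near (0 : C3'), sg q = q -> Psi q = 0.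
  have n1 := near_small sX presH.
  apply: filterS3 zgr n1 phisg => q Pq pq + sq; rewrite sq => pr.
  have YX : Y q = cj (X q).
    rewrite /Y /X /gr.
    have := fsw q (phi q); rewrite sq -pr => /(congr1 snd) <-.
    by rewrite /swapcj /= .
  rewrite /Psi YX /Hbar cjK; apply: pq.
  by rewrite -YX -Pq /X /Y; case: (f (gr q)).
have sH : small H := small_near_hol hH H0.
have sHb : small (Hbar H) := small_near_hol near_hol_Hbar Hbar0.
have hgr : \forall q \near (0 : C3'), hol gr q.
  by apply: filterS hphi => q hq; apply: hol_pair => //; exact: hol_id.
have hfgr : \forall q \near (0 : C3'), hol (fun q => f (gr q)) q.
  by apply: filterS hgr => q hq; exact: hol_comp hq (fh _).
have hX : \forall q \near (0 : C3'), hol X q.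
  by apply: filterS hfgr => q; exact: hol_fst.
have hY : \forall q \near (0 : C3'), hol Y q.
  by apply: filterS hfgr => q; exact: hol_snd.
have hPsi : \forall q \near (0 : C3'), hol Psi q.
  apply: (near_hol_comp (f := fun q => (H (X q), Hbar H (Y q)) : C2' * C2')) hP.
    by apply: small_pair; [exact: small_comp sX sH|exact: small_comp sY sHb].
  have a1 := near_hol_comp sX hX hH; have a2 := near_hol_comp sY hY near_hol_Hbar.
  by apply: filterS2 a1 a2 => q; exact: hol_pair.
(* m maps the real points of C^3 to the fixed points of sg *)
pose m (q : C3') : C3' := ((q.1.1 + 'i%C * q.1.2, q.1.1 + - ('i%C * q.1.2)), q.2).
have mh q : hol m q by rewrite /m; hol_tuple.
have m0 : m 0 = 0.
  by rewrite /m -[RHS]/(0, 0, 0) /= mulr0 oppr0 addr0.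
have sm : small m := small_hol (mh 0) m0.
have Psi_m : \forall q \near (0 : C3'), Psi (m q) = 0.
  have /near0E[d d0 dP] := near_small sm Psi_real.
  apply: (identity3 d0).
    by apply: near_hol_comp hPsi => //; apply/near0E; exists 1.
  move=> a b s ad bd sd; apply: dP.
    by apply: Npair_lt; [apply: Npair_lt|]; rewrite NC.
  rewrite -[LHS]/((a%:C + - ('i%C * b%:C))^*, (a%:C + 'i%C * b%:C)^*, (s%:C)^*).
  by rewrite conj_subi conj_addi; congr ((_ + 'i%C * _, _ + - ('i%C * _)), _); exact: conjc_real.
pose mi (q : C3') : C3' := ((2^-1 * (q.1.1 + q.1.2), 2^-1 * - 'i%C * (q.1.1 + - q.1.2)), q.2).
have mih q : hol mi q by rewrite /mi; hol_tuple.
have mi0 : mi 0 = 0 by rewrite /mi /= oppr0 addr0 !mulr0.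
have ii := mul_ii R.
have two : (2 : C) != 0 by rewrite pnatr_eq0.
have miK q : m (mi q) = q.
  case: q => [[a b] c]; rewrite /m /mi /=; congr ((_, _), _).
    transitivity (2^-1 * (a + b) - ('i%C * 'i%C) * 2^-1 * (a - b)); first by ring.
    by rewrite ii; field.
  transitivity (2^-1 * (a + b) + ('i%C * 'i%C) * 2^-1 * (a - b)); first by ring.
  by rewrite ii; field.
have Psi0 : \forall q \near (0 : C3'), Psi q = 0.
  have := near_small (small_hol (mih 0) mi0) Psi_m.
  by apply: filterS => q; rewrite miK.
pose t (p : C2' * C2') : C3' * C :=
  (((p.1.1, p.2.1), 2^-1 * (p.1.2 + p.2.2)), 2^-1 * - 'i%C * (p.1.2 + - p.2.2)).
have th p : hol t p by rewrite /t; hol_tuple.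
have t0 : t 0 = 0 by rewrite /t /= oppr0 addr0 !mulr0.
have tK p : f (t p) = p.
  case: p => [[z w] [x s]]; rewrite /f /t /=; congr ((_, _), (_, _)).
    transitivity (2^-1 * (w + s) - ('i%C * 'i%C) * 2^-1 * (w - s)); first by ring.
    by rewrite ii; field.
  transitivity (2^-1 * (w + s) + ('i%C * 'i%C) * 2^-1 * (w - s)); first by ring.
  by rewrite ii; field.
have st := small_hol (th 0) t0.
have n1 := near_small st phiP.
have n2 := near_small (small_fst st) Psi0.
apply: filterS2 n1 n2 => p [+ _] P2 Pp; rewrite tK => /(_ Pp) e.
have gt : gr (t p).1 = t p by rewrite /gr -e; case: (t p).
by move: P2; rewrite /Psi /X /Y gt tK.
Qed.

End Complexify.

(** * Dichotomy: fixed Segre variety or foliation *)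

Section NearHol.
Variable R : realType.
Local Notation C := (R[i]).

Definition nhol (V W : normedModType C) (f : V -> W) := \forall p \near (0 : V), hol f p.

Section Lemmas.
Variables V W U : normedModType C.

Lemma nearI0 (A B : V -> Prop) : (\forall p \near 0, A p) -> (\forall p \near 0, B p) ->
  \forall p \near 0, A p /\ B p.
Proof. by move=> a b; apply: filterS2 a b. Qed.

Lemma nhol_all (f : V -> W) : (forall p, hol f p) -> nhol f.
Proof. by move=> fh; apply/near0E; exists 1. Qed.

Lemma nhol_pair (f : V -> W) (g : V -> U) : nhol f -> nhol g ->
  nhol (fun p => (f p, g p) : (W * U)%type).
Proof. by move=> hf hg; apply: filterS2 hf hg => p; exact: hol_pair. Qed.

Lemma nhol_fst (f : V -> (W * U)%type) : nhol f -> nhol (fun p => (f p).1).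
Proof. by apply: filterS => p; exact: hol_fst. Qed.

Lemma nhol_snd (f : V -> (W * U)%type) : nhol f -> nhol (fun p => (f p).2).
Proof. by apply: filterS => p; exact: hol_snd. Qed.

Lemma nholD (f g : V -> W) : nhol f -> nhol g -> nhol (fun p => f p + g p).
Proof. by move=> hf hg; apply: filterS2 hf hg => p; exact: holD. Qed.

Lemma nhol_id : nhol (@id V).
Proof. by apply/near0E; exists 1 => // p _; exact: hol_id. Qed.

Lemma nhol_cst (c : W) : nhol (fun _ : V => c).
Proof. by apply: nhol_all => p; exact: hol_cst. Qed.

Lemma nhol_comp (f : V -> W) (g : W -> U) : nhol g -> small f -> nhol f ->
  nhol (fun p => g (f p)).
Proof. by move=> hg sf hf; exact: near_hol_comp. Qed.

End Lemmas.
End NearHol.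

Ltac small_t := repeat match goal with
  | |- small (fun x => (_, _)) => apply: small_pair
  | |- small (fun x => _ + _) => apply: smallD
  | |- small (fun x => fst _) => apply: small_fst
  | |- small (fun x => snd _) => apply: small_snd
  | |- small fst => apply: small_fst; exact: small_id
  | |- small snd => apply: small_snd; exact: small_id
  | |- small (fun x => x) => exact: small_id
  | |- small (fun x => 0) => exact: small0
  | H : small ?f |- small ?f => exact: H
  | H : small ?f |- small (fun x => ?f _) => apply: (small_comp _ H)
  | |- small (fun x => cj _) => apply: small_cj
  | |- small cj => apply: small_cj; exact: small_id
  end.

Ltac nhol_t := repeat match goal with
  | |- nhol (fun x => (_, _)) => apply: nhol_pair
  | |- nhol (fun x => _ + _) => apply: nholD
  | |- nhol (fun x => fst _) => apply: nhol_fst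
  | |- nhol (fun x => snd _) => apply: nhol_snd
  | |- nhol fst => apply: nhol_fst; exact: nhol_id
  | |- nhol snd => apply: nhol_snd; exact: nhol_id
  | |- nhol (fun x => x) => exact: nhol_id
  | |- nhol (fun x => ?c) => exact: nhol_cst
  | H : nhol ?f |- nhol ?f => exact: H
  | H : nhol ?f |- nhol (fun x => ?f _) => apply: (nhol_comp H); [small_t|]
  end.

Section Dichotomy.
Variable R : realType.
Local Notation C := (R[i]).
Local Notation C2' := ((C * C)%type).
Local Notation C3' := ((C * C * C)%type).

(** Let w = Q(z, x, tau) and tau = S(z, w, x) describe P = 0. The new second coordinate of (z, w)
    is u(z, w) = Q(0, 0, S(z, w, 0)): the height over z = 0 of the Segre curve with x = 0 through
    (z, w). Its inverse for fixed z is K. The parameter tau of a Segre curve is replaced by the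
    height t = T(x, tau) at which the curve meets z = 0. In these coordinates the family Qt is
    normalized and normalized_fixed applies, unless Qt = t; then the Segre curves are the level
    sets of u, and g moves a point along its level set. *)
Theorem fixed_or_foliated (P L : C2' * C2' -> C) (H : C2' -> C2') (A : R) :
  P 0 = 0 -> nhol P ->
  (\forall p \near (0 : (C2' * C2')%type), (P p)^* = P (swapcj p)) ->
  is_der P 0 L -> L ((0, 'i%C), (0, - 'i%C)) != 0 ->
  H 0 = 0 -> nhol H ->
  (\forall x \near (0 : C2'), N (H x - x) <= A * N x ^+ 2) ->
  (\forall x \near (0 : C2'), P (x, cj x) = 0 -> P (H x, cj (H x)) = 0) ->
  (\forall x \near (0 : C2'), P (x, 0) = 0 -> H x = x) \/
  exists g : C2' * C -> C2', [/\ nhol g,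
    \forall q \near (0 : C2'), g (q, 0) = q,
    forall p, (g p).1 = p.1.1 + p.2 &
    \forall p \near (0 : (C2' * C)%type), P (p.1, cj p.1) = 0 -> P (g p, cj (g p)) = 0].
Proof.
move=> P0 hP realP derP Liy H0 hH tH presH.
have inv := complexified_invariance P0 hP realP derP Liy H0 hH presH.
have [Q [S [[Q0 S0] hQ hS QP SP]]] := graphs P0 hP realP derP Liy.
have {}hQ : nhol Q by []. have {}hS : nhol S by [].
have sQ : small Q := small_near_hol hQ Q0.
have sS : small S := small_near_hol hS S0.
have sH : small H := small_near_hol hH H0.
have hHb : nhol (Hbar H) := near_hol_Hbar hH.
have sHb : small (Hbar H) := small_near_hol hHb (Hbar0 H0).
have QS : \forall p \near (0 : C3'), S ((p.1.1, Q p), p.1.2) = p.2.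
  have s : small (fun p : C3' => ((p.1.1, Q p), (p.1.2, p.2)) : C2' * C2') by small_t.
  apply: filterS2 (near_small s QP) (near_small s SP) => -[[z x] t] /= [_ a] [b _].
  exact/esym/b/a.
have SQ : \forall p \near (0 : C3'), Q ((p.1.1, p.2), S p) = p.1.2.
  have s : small (fun p : C3' => (p.1, (p.2, S p)) : C2' * C2') by small_t.
  apply: filterS2 (near_small s QP) (near_small s SP) => -[[z w] x] /= [a _] [_ b].
  exact/esym/a/b.
pose u (y : C2') := Q ((0, 0), S (y, 0)).
pose K (p : C2') := Q ((p.1, 0), S ((0, p.2), 0)).
pose T (y : C2') := Q ((0, y.1), y.2).
pose Qt (p : C3') := u (p.1.1, Q (p.1, S ((0, p.2), p.1.2))).
have hu : nhol u by rewrite /u; nhol_t.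
have hK : nhol K by rewrite /K; nhol_t.
have hT : nhol T by rewrite /T; nhol_t.
have u00 : u 0 = 0 by rewrite /u S0 Q0.
have K00 : K 0 = 0 by rewrite /K S0 Q0.
have T00 : T 0 = 0 by rewrite /T Q0.
have su : small u := small_near_hol hu u00.
have sK : small K := small_near_hol hK K00.
have sT : small T := small_near_hol hT T00.
have hQt : nhol Qt by rewrite /Qt; nhol_t.
have sQt : small Qt by rewrite /Qt; small_t.
have uK : \forall p \near (0 : C2'), u (p.1, K p) = p.2.
  have s1 : small (fun p : C2' => ((p.1, 0), S ((0, p.2), 0)) : C3') by small_t.
  have s2 : small (fun p : C2' => ((0, p.2), 0) : C3') by small_t.
  apply: filterS2 (near_small s1 QS) (near_small s2 SQ) => -[z t] /= a b.
  by rewrite /u /K /= a b.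
have Ku : \forall y \near (0 : C2'), K (y.1, u y) = y.2.
  have s1 : small (fun y : C2' => ((0, 0), S (y, 0)) : C3') by small_t.
  have s2 : small (fun y : C2' => (y, 0) : C3') by small_t.
  apply: filterS2 (near_small s1 QS) (near_small s2 SQ) => -[z w] /= a b.
  by rewrite /K /u /= a b.
have TS : \forall p \near (0 : C2'), T (p.1, S ((0, p.2), p.1)) = p.2.
  have s1 : small (fun p : C2' => ((0, p.2), p.1) : C3') by small_t.
  by apply: filterS (near_small s1 SQ) => -[x t].
have u0t : \forall p \near (0 : C2'), u (0, p.2) = p.2.
  have s2 : small (fun p : C2' => ((0, p.2), 0) : C3') by small_t.
  by apply: filterS (near_small s2 SQ) => -[x t].
have Qt0 : \forall p \near (0 : C2'), Qt ((0, p.1), p.2) = p.2.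
  by apply: filterS2 TS u0t => -[x t] /= a b; rewrite /Qt /= -[Q _]/(T (x, S ((0, t), x))) a b.
have Qtx : \forall p \near (0 : C2'), Qt ((p.1, 0), p.2) = p.2 by exact: uK.
pose y (p : C2') : C2' := (p.1, S ((0, p.2), p.1)).
have hy : nhol y by rewrite /y; nhol_t.
have y0 : y 0 = 0 by rewrite /y S0.
have sy : small y := small_near_hol hy y0.
pose X (p : C2') : C2' := (p.1, K p).
have hX : nhol X by rewrite /X; nhol_t.
have sX : small X by rewrite /X; small_t.
have [flat|nflat] := pselect (\forall p \near (0 : C3'), Qt p = p.2); last left; [right|].
  have fol : \forall p \near (0 : (C2' * C2')%type), P p = 0 <-> u p.1 = T p.2.
    have s1 : small (fun p : C2' * C2' => ((0, p.2.1), p.2.2) : C3') by small_t.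
    have s2 : small (fun p : C2' * C2' => ((p.1.1, p.2.1), T p.2) : C3') by small_t.
    have s3 : small (fun p : C2' * C2' => (p.1.1, Q ((p.1.1, p.2.1), p.2.2)) : C2') by small_t.
    have s4 : small (fun p : C2' * C2' => p.1) by small_t.
    have n1 := nearI0 (near_small s1 QS) (near_small s2 flat).
    have n2 := nearI0 (near_small s3 Ku) (near_small s4 Ku).
    apply: filterS3 QP n1 n2 => -[[z w] [x t]] /= qp [qs fl] [k1 k2].
    have uw : u (z, Q ((z, x), t)) = T (x, t).
      by move: fl; rewrite /Qt /= -[T (x, t)]/(Q ((0, x), t)) qs.
    split=> [/qp ->//|e]; apply/qp.
    by rewrite -k2 e -uw k1.
  pose g (p : C2' * C) : C2' := (p.1.1 + p.2, K (p.1.1 + p.2, u p.1)).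
  have sg : small g by rewrite /g; small_t.
  exists g; split=> //.
  - by rewrite /g; nhol_t.
  - by apply: filterS Ku => -[z w] /= e; rewrite /g /= addr0 e.
  have s1 : small (fun p : C2' * C => (p.1, cj p.1) : C2' * C2') by small_t.
  have s2 : small (fun p : C2' * C => (g p, cj p.1) : C2' * C2') by small_t.
  have s3 : small (fun p : C2' * C => (p.1, cj (g p)) : C2' * C2') by small_t.
  have s4 : small (fun p : C2' * C => (g p, cj (g p)) : C2' * C2') by small_t.
  have s5 : small (fun p : C2' * C => (p.1.1 + p.2, u p.1) : C2') by small_t.
  have n1 := nearI0 (near_small s1 fol) (near_small s2 fol).
  have n2 := nearI0 (near_small s3 fol) (near_small s4 fol).
  have n3 := nearI0 (near_small s2 realP) (near_small s5 uK).
  apply: filterS3 n1 n2 n3 => p [f1 f2] [f3 f4] [r k] /= /f1 e1.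
  have ug : u (g p) = u p.1 by exact: k.
  have /f2 e2 : u (g p) = T (cj p.1) by rewrite ug.
  have e3 : P (p.1, cj (g p)) = 0.
    move: r; rewrite e2 /swapcj /= cjK => <-.
    by rewrite -[LHS]/(conjc 0) conjc0.
  by apply/f4; rewrite ug; apply/f3.
have [rK [LK [rK0 LK0 _ lipK]]] := hol_lip0 hK.
have hs : nhol (fun p : C2' => S ((0, p.2), p.1)) by nhol_t.
have [rS [LS [rS0 LS0 _ lipS]]] := hol_lip0 hs.
have [rT [LT [rT0 LT0 _ lipT]]] := hol_lip0 hT.
have tang : exists A' : R, \forall p \near (0 : C2'),
   [/\ N ((H (X p)).1 - p.1) <= A' * N p ^+ 2,
       N ((Hbar H (y p)).1 - p.1) <= A' * N p ^+ 2 &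
       N (T (Hbar H (y p)) - p.2) <= A' * N p ^+ 2].
  pose A1 := Num.max A 0; have A10 : 0 <= A1 by rewrite le_max lexx orbT.
  have {}tH : \forall x \near (0 : C2'), N (H x - x) <= A1 * N x ^+ 2.
    apply: filterS tH => x /le_trans; apply; rewrite ler_wpM2r ?sqr_ge0 //.
    by rewrite le_max lexx.
  exists (A1 * (1 + LK) ^+ 2 + (1 + LT) * (A1 * (1 + LS) ^+ 2)).
  have c0 : 0 <= A1 * (1 + LK) ^+ 2.
    by rewrite mulr_ge0 // sqr_ge0.
  have c1 : 0 <= A1 * (1 + LS) ^+ 2 by rewrite mulr_ge0 // sqr_ge0.
  have c2 : 0 <= LT * (A1 * (1 + LS) ^+ 2) by rewrite mulr_ge0 // ltW.
  have scy : small (fun p => cj (y p)) by small_t.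
  have n1 := nearI0 (near_small sX tH) (near_small scy tH).
  have nK : \forall p \near (0 : C2'), N p < rK by apply/near0E; exists rK.
  have nS : \forall p \near (0 : C2'), N p < rS by apply/near0E; exists rS.
  have nT : \forall p \near (0 : C2'), N p < rT by apply/near0E; exists rT.
  have sHy : small (fun p => Hbar H (y p)) by small_t.
  have n2 := nearI0 (near_small sy nT) (near_small sHy nT).
  have n3 := nearI0 (nearI0 nK nS) TS.
  apply: filterS3 n1 n2 n3 => p [t1 t2] [yT HyT] [[pK pS] Ty].
  have b1 : N (X p) <= (1 + LK) * N p.
    have := lipK 0 p; rewrite !N0 K00 !subr0 => /(_ rK0 pK) h.
    apply: Npair_le; first by rewrite (le_trans (Nfst p)) // mulrDl mul1r lerDl mulr_ge0 ?N_ge0 // ltW.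
    by rewrite (le_trans h) // mulrDl mul1r lerDr N_ge0.
  have b2 : N (y p) <= (1 + LS) * N p.
    have := lipS 0 p; rewrite !N0 S0 !subr0 => /(_ rS0 pS) h.
    apply: Npair_le; first by rewrite (le_trans (Nfst p)) // mulrDl mul1r lerDl mulr_ge0 ?N_ge0 // ltW.
    by rewrite (le_trans h) // mulrDl mul1r lerDr N_ge0.
  have s1 : N (X p) ^+ 2 <= (1 + LK) ^+ 2 * N p ^+ 2.
    by rewrite -exprMn lerXn2r ?nnegrE ?N_ge0 // mulr_ge0 ?N_ge0 // addr_ge0 // ltW.
  have s2 : N (y p) ^+ 2 <= (1 + LS) ^+ 2 * N p ^+ 2.
    by rewrite -exprMn lerXn2r ?nnegrE ?N_ge0 // mulr_ge0 ?N_ge0 // addr_ge0 // ltW.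
  have h1 : N (H (X p) - X p) <= A1 * (1 + LK) ^+ 2 * N p ^+ 2.
    by apply: le_trans t1 _; rewrite -mulrA; exact: ler_wpM2l A10 _ _ s1.
  have h2 : N (Hbar H (y p) - y p) <= A1 * (1 + LS) ^+ 2 * N p ^+ 2.
    have -> : Hbar H (y p) - y p = cj (H (cj (y p)) - cj (y p)).
      by rewrite /Hbar -{2}[y p]cjK -scaleN1r -[X in _ = cj (_ + X)]scaleN1r cjD cjZ rmorphN rmorph1.
    rewrite N_cj; apply: le_trans t2 _; rewrite N_cj -mulrA.
    exact: ler_wpM2l A10 _ _ s2.
  have np := sqr_ge0 (N p); split.
  - apply: le_trans (Nfst (H (X p) - X p)) (le_trans h1 _); apply: (ler_wpM2r np).
    by rewrite lerDl mulrDl mul1r addr_ge0.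
  - apply: le_trans (Nfst (Hbar H (y p) - y p)) (le_trans h2 _); apply: (ler_wpM2r np).
    by rewrite mulrDl mul1r; move: c0 c1 c2; clear; lra.
  rewrite -{1}Ty; apply: le_trans (lipT _ _ yT HyT) (le_trans (ler_wpM2l (ltW LT0) h2) _).
  rewrite mulrA; apply: (ler_wpM2r np); rewrite mulrDl mul1r.
  by move: c0 c1 c2; clear; lra.
pose F p := (H (X p)).1; pose G p := u (H (X p)).
pose k p := (Hbar H (y p)).1; pose l p := T (Hbar H (y p)).
have hF : nhol F by rewrite /F; nhol_t.
have hG : nhol G by rewrite /G; nhol_t.
have hl : nhol l by rewrite /l; nhol_t.
have eqn : \forall p \near (0 : C3'),
    G (p.1.1, Qt p) = Qt ((F (p.1.1, Qt p), k (p.1.2, p.2)), l (p.1.2, p.2)).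
  pose Xp (p : C3') : C2' := (p.1.1, Q (p.1, S ((0, p.2), p.1.2))).
  pose Yp (p : C3') : C2' := y (p.1.2, p.2).
  have sXp : small Xp by rewrite /Xp; small_t.
  have sYp : small Yp by rewrite /Yp; small_t.
  have s1 : small (fun p => (Xp p, Yp p) : C2' * C2') by small_t.
  have s2 : small (fun p => (H (Xp p), Hbar H (Yp p)) : C2' * C2') by small_t.
  have s3 : small (fun p => ((0, (Hbar H (Yp p)).1), (Hbar H (Yp p)).2) : C3') by small_t.
  have n1 := nearI0 (near_small s1 QP) (near_small s1 inv).
  have n2 := nearI0 (near_small s2 QP) (near_small s3 QS).
  apply: filterS3 n1 n2 (near_small sXp Ku) => -[[z x] t] [q1 i1] [q2 q3] /= ku.
  have XE : X (z, Qt (z, x, t)) = Xp (z, x, t) by rewrite /X ku.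
  have PXY : P (Xp (z, x, t), Yp (z, x, t)) = 0 by apply/q1.
  have /q2 /= HX2 := i1 PXY.
  rewrite /G /F XE /k /l -[y (x, t)]/(Yp (z, x, t)) /Qt /=.
  by rewrite /T q3 -HX2; case: (H (Xp (z, x, t))).
have sz : small (fun x : C2' => x.1) by small_t.
have := normalized_fixed hQt hF hG hl Qt0 Qtx tang eqn nflat.
move=> /(near_small sz) fx.
have s5 : small (fun x : C2' => (x, 0) : C2' * C2') by small_t.
have s6 : small (fun x : C2' => (x.1, 0) : C2') by small_t.
have n2 := nearI0 (near_small s6 Ku) (near_small (small_comp s6 (small_comp sX sH)) Ku).
have n3 := nearI0 (near_small s6 uK) (near_small s5 QP).
apply: filterS3 fx n2 n3 => -[z w] /= [Fz Gz] [_ kH] [_ q] /q /= w0.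
have XE : X (z, 0) = (z, w) by rewrite /X /K /= S0 -w0.
have HX : (H (X (z, 0))).1 = z := Fz.
have H2 : (H (X (z, 0))).2 = w.
  by rewrite -kH -/(G (z, 0)) Gz HX -[K (z, 0)]/(X (z, 0)).2 XE.
rewrite XE in HX H2; move: HX H2.
by case: (H (z, w)) => z' w' /= -> ->.
Qed.

End Dichotomy.

(** * Complexification of real-analytic functions *)

Section Rows.
Variable R : realType.
Local Notation C := (R[i]).
Implicit Types v : C2 R.

Lemma ord2_ind (Q : 'I_2 -> Prop) : Q 0 -> Q 1 -> forall k, Q k.
Proof. by move=> q0 q1 [[|[|//]] kk]; [move: q0|move: q1]; congr Q; apply/val_inj. Qed.

Lemma sum_ord2 (V : nmodType) (F : 'I_2 -> V) : \sum_(k < 2) F k = F 0 + F 1.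
Proof. by rewrite !big_ord_recl big_ord0 addr0; congr (_ + F _); apply/val_inj. Qed.

Lemma row2E v : v = v 0 0 *: ebasis R 0 + v 0 1 *: ebasis R 1.
Proof. by apply/rowP; apply: ord2_ind; rewrite !mxE /= ?mulr1 ?mulr0 ?addr0 ?add0r. Qed.

Lemma Ncoord v (k : 'I_2) : N (v 0 k) <= N v.
Proof.
rewrite -lecR -!normE [leRHS]mx_normE.
have := le_bigmax (0%:nng : {nonneg C}) (fun i : 'I_1 * 'I_2 => `|v i.1 i.2|%:nng) (0, k).
by move/(_ erefl erefl).
Qed.

Lemma Nrow_le v (b : R) : 0 <= b -> (forall k, N (v 0 k) <= b) -> N v <= b.
Proof.
move=> b0 vb; have [->|v0] := eqVneq v 0; first by rewrite N0.
have /mx_norm_neq0[[i k] vE] : mx_norm v != 0 by rewrite -[mx_norm _]/(Num.norm v) normr_eq0.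
rewrite -lecR -normE -[Num.norm v]/(mx_norm v) vE /= normE lecR (ord1 i); exact: vb.
Qed.

Lemma hol_coord (V : normedModType C) (f : V -> C2 R) x k :
  hol f x -> hol (fun y => f y 0 k) x.
Proof.
move=> hf; apply: (hol_comp hf (g := fun v : C2 R => v 0 k)).
exists (fun v => v 0 k); apply: (@lin_is_der _ _ _ _ _ _ 1) => [a u v|v].
  by rewrite !mxE.
by rewrite mul1r Ncoord.
Qed.

Definition cjv v : C2 R := map_mx conjc v.

Lemma cjvK : involutive cjv.
Proof. by move=> v; apply/rowP => k; rewrite !mxE conjcK. Qed.

Lemma N_cjv v : N (cjv v) = N v.
Proof.
suff le u : N (cjv u) <= N u by apply/le_anti; rewrite le -{1}[v]cjvK le.
by apply: Nrow_le (N_ge0 _) _ => k; rewrite mxE Nconj Ncoord.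
Qed.

Lemma cjv0 : cjv (0 : C2 R) = 0.
Proof. by apply: N_eq0; rewrite N_cjv N0. Qed.

End Rows.

Section Series.
Variables (R : realType) (I : choiceType).
Local Notation C := (R[i]).

Lemma sumfE (V : zmodType) (x : I -> V) (J : {fset I}) : partial_sum x J = \sum_(i <- J) x i.
Proof. by rewrite /partial_sum [RHS]big_seq_fsetE. Qed.

(** Apply the Cauchy criterion to the positive terms and to the negative terms of a finite family
    outside J0. *)
Lemma tail_small (x : I -> R) (s : R) : partial_sum x @ totally --> s ->
  forall e : R, 0 < e -> exists J0 : {fset I}, forall J : {fset I},
    \sum_(i <- J | i \notin J0) `|x i| <= e.
Proof.
move=> xs e e0; have e4 : 0 < e / 4 by rewrite divr_gt0.
have FF := @totally_filter I.
have /cvgrPdist_lt/(_ _ e4)[J0 _ J0P] := xs.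
exists J0 => J.
have part (Q : pred I) : `|\sum_(i <- J | (i \notin J0) && Q i) x i| <= e / 2.
  pose K := [fset i in J | (i \notin J0) && Q i]%fset.
  have -> : \sum_(i <- J | (i \notin J0) && Q i) x i = \sum_(i <- K) x i.
    by rewrite big_fset.
  have -> : \sum_(i <- K) x i = (s - \sum_(i <- J0) x i) - (s - \sum_(i <- (J0 `|` K)%fset) x i).
    have -> : \sum_(i <- (J0 `|` K)%fset) x i = \sum_(i <- J0) x i + \sum_(i <- K) x i.
      rewrite (big_fsetID _ (mem J0)) /=; congr (_ + _); apply: eq_fbigl => i.
        by rewrite !inE /=; case: (i \in J0); rewrite ?andbF.
      by rewrite !inE /=; case: (i \in J0); rewrite /= ?andbF ?andbT.
    by ring.
  rewrite (le_trans (ler_normB _ _)) // (_ : e / 2 = e / 4 + e / 4); last by field.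
  have h1 := J0P J0 (fsubset_refl J0); have h2 := J0P (J0 `|` K)%fset (fsubsetUl _ _).
  by rewrite lerD // ltW // -sumfE.
rewrite (bigID (fun i => 0 <= x i)) /= (splitr e) lerD //.
  rewrite (eq_bigr x) => [|i /andP[_ /ger0_norm//]].
  by rewrite (le_trans (ler_norm _)) // part.
rewrite (eq_bigr (fun i => - x i)) => [|i /andP[_ h]]; last first.
  by rewrite ltr0_norm // ltNge.
by rewrite sumrN (le_trans (ler_norm _)) // normrN part.
Qed.

Lemma tail_le (V : normedModType C) (f : I -> V) (x : I -> R) (J0 J : {fset I}) (e : R) :
  (forall i, N (f i) <= `|x i|) -> (forall J : {fset I}, \sum_(i <- J | i \notin J0) `|x i| <= e) ->
  (J0 `<=` J)%fset -> N (\sum_(i <- J) f i - \sum_(i <- J0) f i) <= e.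
Proof.
move=> fx tl /fsubsetP J0J.
rewrite (bigID (mem J0)) /= (_ : \sum_(i <- J | i \in J0) f i = \sum_(i <- J0) f i); last first.
  transitivity (\sum_(i <- [fset i in J | i \in J0]%fset) f i); first by rewrite big_fset.
  by apply: eq_fbigl => i; rewrite !inE /=; apply/andP/idP => [[]//|h]; rewrite J0J.
rewrite [X in N X]addrC addKr (le_trans (Nsum _ _ _)) // (le_trans _ (tl J)) //.
by apply: ler_sum => i _; exact: fx.
Qed.

(** Convergence at one real point that dominates all other points gives tails that are small
    uniformly in p, so Weierstrass' theorem applies to a sequence of finite partial sums. *)
Lemma hol_series (V : normedModType C) (x : I -> R) (s r : R) (f : I -> V -> C) :
  partial_sum x @ totally --> s ->
  (forall i p, N p < r -> N (f i p) <= `|x i|) -> (forall i p, hol (f i) p) ->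
  exists F B, bhol F 0 r B /\ forall p, N p < r -> forall e : R, 0 < e ->
    exists J0 : {fset I}, forall J : {fset I}, (J0 `<=` J)%fset ->
      N (\sum_(i <- J) f i p - F p) <= e.
Proof.
move=> xs fx fh.
have h n : 0 < n.+1%:R^-1 :> R by rewrite invr_gt0.
have /choice[J JP] : forall n, exists J0 : {fset I}, forall J : {fset I},
    \sum_(i <- J | i \notin J0) `|x i| <= n.+1%:R^-1 by move=> n; exact: tail_small xs _ (h n).
pose S n p := \sum_(i <- J n) f i p.
have small_inv (e : R) : 0 < e -> exists n, n.+1%:R^-1 <= e.
  move=> e0; have e1 : 0 < e^-1 by rewrite invr_gt0.
  exists (Num.bound e^-1); rewrite -[leRHS]invrK lef_pV2 ?posrE // ltW //.
  by rewrite (lt_le_trans (archi_boundP (ltW e1))) // ler_nat.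
have decr n k : (n <= k)%N -> k.+1%:R^-1 <= n.+1%:R^-1 :> R.
  by move=> nk; rewrite lef_pV2 ?posrE // ler_nat.
have SS n m p : N p < r -> N (S m p - S n p) <= m.+1%:R^-1 + n.+1%:R^-1.
  move=> pr; pose K := (J n `|` J m)%fset.
  have t k : (J k `<=` K)%fset -> N (\sum_(i <- K) f i p - S k p) <= k.+1%:R^-1.
    by move=> kK; apply: tail_le kK => // i; exact: fx.
  rewrite (le_trans (NB3 (\sum_(i <- K) f i p) _ _)) // lerD //.
    by rewrite NBC t // fsubsetUr.
  by rewrite t // fsubsetUl.
have /choice[F FP] : forall p, exists l, N p < r -> seqlim (S^~ p) l.
  move=> p; have [pr|] := boolP (N p < r); last by exists 0.
  have [e e0|l lP] := @complex_cauchy _ (S^~ p); last by exists l.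
  have [n nP] := small_inv (e / 2) (divr_gt0 e0 (ltr0Sn _ 1)).
  exists n => k /decr nk; rewrite (le_trans (SS _ _ _ pr)) // (splitr e) lerD //.
  exact: le_trans nk nP.
have SF n p : N p < r -> N (S n p - F p) <= n.+1%:R^-1.
  move=> pr; apply/ler_addgt0Pr => e e0; have e2 : 0 < e / 2 by rewrite divr_gt0.
  have [n1 n1P] := FP p pr _ e2; have [n2 n2P] := small_inv _ e2.
  pose m := maxn n1 n2.
  rewrite (le_trans (NB3 (S m p) _ _)) // (splitr e) addrA lerD //; last first.
    by apply: n1P; rewrite leq_maxl.
  rewrite (le_trans (SS _ _ _ pr)) // lerD // (le_trans _ n2P) //.
  by apply: decr; rewrite leq_maxr.
exists F, (\sum_(i <- J 0%N) `|x i| + 1); split; last first.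
  move=> p pr e e0; have [n nP] := small_inv (e / 2) (divr_gt0 e0 (ltr0Sn _ 1)).
  exists (J n) => K nK; rewrite (le_trans (NB3 (S n p) _ _)) // (splitr e) lerD //.
    by apply: le_trans nP; apply: tail_le nK => // i; exact: fx.
  by rewrite (le_trans (SF _ _ pr)).
apply: (@hol_lim _ _ S) => [k|e /small_inv[n nP]]; last first.
  exists n => k /decr nk p pr; rewrite add0r (le_trans (SF _ _ pr)) //.
  exact: le_trans nk nP.
split=> p pr; first by apply: hol_sum => i; exact: fh.
rewrite add0r /S (le_trans (Nsum _ _ _)) // (bigID (mem (J 0%N))) /=.
rewrite lerD //; last first.
  rewrite (le_trans _ (le_trans (JP 0%N (J k)) _)) ?invr1 //.
  by apply: ler_sum => i _; exact: fx.
rewrite [leRHS](bigID (mem (J k))) /= ler_wpDr ?sumr_ge0 //.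
rewrite (le_trans (ler_sum _ (fun i _ => fx i p pr))) //.
have sw (A B : {fset I}) : \sum_(i <- A | i \in B) `|x i| =
    \sum_(i <- [fset i in A | i \in B]%fset) `|x i| by rewrite big_fset.
rewrite !sw; apply: le_of_eq; apply: eq_fbigl => i.
by rewrite !inE /= andbC.
Qed.

End Series.

Section Complexification.
Variable R : realType.
Local Notation C := (R[i]).
Implicit Types (rho : C2 R -> R) (q : C2 R) (a : real_exponent) (p : (C2 R * C2 R)%type).

(** The real monomial with Re z and Im z written as (z + conj z) / 2 and (z - conj z) / (2 'i),
    and conj z replaced by an independent variable. *)
Definition cmonomial a p : C :=
  \prod_(k < 2) (((p.1 0 k + p.2 0 k) / 2) ^+ a.1 k *
                 ((p.1 0 k - p.2 0 k) / (2 * 'i)) ^+ a.2 k).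

Lemma i2_neq0 : 2 * 'i%C != 0 :> C.
Proof. by rewrite mulf_neq0 ?pnatr_eq0 ?i_neq0. Qed.

Lemma cmonomial_real a (h : C2 R) : cmonomial a (h, cjv h) = (real_monomial a h)%:C.
Proof.
rewrite /cmonomial /real_monomial rmorph_prod /=; apply: eq_bigr => k _.
rewrite mxE rmorphM !rmorphXn /=; congr (_ ^+ _ * _ ^+ _).
  rewrite (_ : h 0 k + _ = (complex.Re (h 0 k))%:C * 2) ?mulfK ?pnatr_eq0 //.
  rewrite mulr_natr mulr2n; case: (h 0 k) => x y /=.
  by apply/eqP; rewrite eq_complex /= subrr addr0 !eqxx.
rewrite (_ : h 0 k - _ = (complex.Im (h 0 k))%:C * (2 * 'i%C)) ?mulfK ?i2_neq0 //.
rewrite mulrCA mulr_natl mulr2n; case: (h 0 k) => x y /=.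
apply/eqP; rewrite eq_complex /=; apply/andP; split; apply/eqP; ring.
Qed.

Lemma cmonomial_conj a p : (cmonomial a p)^* = cmonomial a (cjv p.2, cjv p.1).
Proof.
rewrite /cmonomial rmorph_prod /=; apply: eq_bigr => k _.
have cM (x y : C) : conjc (x * y) = conjc x * conjc y by exact: (rmorphM conjc).
have cX (x : C) n : conjc (x ^+ n) = conjc x ^+ n by exact: (rmorphXn conjc).
have cD (x y : C) : conjc (x + y) = conjc x + conjc y by exact: (rmorphD conjc).
have cB (x y : C) : conjc (x - y) = conjc x - conjc y by exact: (rmorphB conjc).
rewrite cM !cX !cM !conjc_inv cD cB cM conjc_nat conj_i !mxE.
congr (_ ^+ _ * _ ^+ _); first by rewrite addrC.
by rewrite mulrN invrN mulrN -mulNr opprB.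
Qed.

Lemma hol_cmonomial a p : hol (cmonomial a) p.
Proof.
apply: hol_prod => k.
apply: holM; apply: holX; apply: holM; try exact: hol_cst.
  by apply: holD; apply: hol_coord; [apply: hol_fst|apply: hol_snd]; exact: hol_id.
by apply: holB; apply: hol_coord; [apply: hol_fst|apply: hol_snd]; exact: hol_id.
Qed.

(** At the point with coordinates r +i* r every real monomial takes the largest value that its
    complexification can have in modulus on the ball of radius r. *)
Lemma N_cmonomial a p (r : R) : N p <= r ->
  N (cmonomial a p) <= real_monomial a (const_mx (r +i* r)).
Proof.
move=> pr; rewrite /cmonomial /real_monomial !big_ord_recl !big_ord0 !mulr1 !mxE /=.
have le k : N (p.1 0 k) <= r by rewrite (le_trans (Ncoord _ _)) // (le_trans (Nfst p)).
have le' k : N (p.2 0 k) <= r by rewrite (le_trans (Ncoord _ _)) // (le_trans (Nsnd p)).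
have N2 : N (2 : C) = 2 by rewrite (_ : (2 : C) = (2 : R)%:C) ?NC ?ger0_norm // rmorph_nat.
have b1 k n : N (((p.1 0 k + p.2 0 k) / 2) ^+ n) <= r ^+ n.
  rewrite NX lerXn2r ?nnegrE ?N_ge0 ?(le_trans (N_ge0 p)) // NM NV N2 ler_pdivrMr //.
  by rewrite mulr_natr mulr2n (le_trans (ND _ _)) // lerD.
have b2 k n : N (((p.1 0 k - p.2 0 k) / (2 * 'i%C)) ^+ n) <= r ^+ n.
  rewrite NX lerXn2r ?nnegrE ?N_ge0 ?(le_trans (N_ge0 p)) // NM NV NM Ni mulr1 N2 ler_pdivrMr //.
  by rewrite mulr_natr mulr2n (le_trans (NB _ _)) // lerD.
have r0 : 0 <= r := le_trans (N_ge0 p) pr.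
rewrite !NM !ler_pM ?mulr_ge0 ?N_ge0 //.
Qed.

Lemma real_monomial_ge0 a (r : R) : 0 <= r -> 0 <= real_monomial a (const_mx (r +i* r)).
Proof. by move=> r0; apply: prodr_ge0 => k _; rewrite mxE mulr_ge0 ?exprn_ge0. Qed.

(** Substitute complex monomials for the real ones. The unconditional convergence of the power
    series at the point with coordinates r +i* r controls the new series on the ball of radius r. *)
Theorem complexification rho q : real_analytic_at rho q ->
  exists P (r B : R), [/\ 0 < r, bhol P 0 r B,
    forall p, N p < r -> (P p)^* = P (cjv p.2, cjv p.1) &
    \forall h \near (0 : C2 R), P (h, cjv h) = (rho (q + h))%:C].
Proof.
move=> [c /near0E[r0 r00 cP]].
pose r := r0 / 4; have r_gt0 : 0 < r by rewrite divr_gt0.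
pose f a p := (c a)%:C * cmonomial a p.
have hr : N (const_mx (r +i* r) : C2 R) < r0.
  apply: (@le_lt_trans _ _ (r0 / 2)); last by move: r00; clear; lra.
  apply: Nrow_le => [|k]; first by rewrite divr_ge0 // ltW.
  rewrite mxE (le_trans (N_le_ReIm _)) //= (ger0_norm (ltW r_gt0)) /r.
  by move: r00; clear; lra.
have fx a p : N p < r -> N (f a p) <= `|c a * real_monomial a (const_mx (r +i* r))|.
  move=> pr; rewrite NM NC normrM ler_wpM2l // [leRHS]ger0_norm.
    exact/N_cmonomial/ltW.
  exact/real_monomial_ge0/ltW.
have fh a p : hol (f a) p by apply: holM; [exact: hol_cst|exact: hol_cmonomial].
have [P [B [PB PS]]] := hol_series (cP _ hr) fx fh.
pose lim (u : {fset real_exponent} -> C) (v : C) := forall e : R, 0 < e ->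
  exists J0 : {fset real_exponent}, forall J : {fset real_exponent}, (J0 `<=` J)%fset ->
    N (u J - v) <= e.
have lim_uniq u v w : lim u v -> lim u w -> v = w.
  move=> ul um; apply: N_sub_le0.
  apply/ler_addgt0Pr => e e0; rewrite add0r; have e2 : 0 < e / 2 by rewrite divr_gt0.
  have [J1 h1] := ul _ e2; have [J2 h2] := um _ e2.
  rewrite (le_trans (NB3 (u (J1 `|` J2)%fset) _ _)) // (splitr e) lerD //.
    by rewrite NBC h1 // fsubsetUl.
  by rewrite h2 // fsubsetUr.
exists P, r, B; split=> //.
  move=> p pr; have pr' : N ((cjv p.2, cjv p.1) : C2 R * C2 R) < r.
    by apply: Npair_lt; rewrite N_cjv (le_lt_trans _ pr) // ?Nfst ?Nsnd.
  apply: (lim_uniq (fun J => \sum_(a <- J) f a (cjv p.2, cjv p.1))) => [e e0|]; last exact: PS.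
  have [J0 JP] := PS p pr e e0; exists J0 => J /JP.
  rewrite -Nconj rmorphB rmorph_sum /=; congr (N (_ - _) <= _).
  apply: eq_bigr => a _; rewrite /f -cmonomial_conj.
  by apply: etrans (rmorphM conjc _ _) _; congr (_ * _); exact: conjc_real.
apply/near0E; exists r => // h hr'.
have pr : N ((h, cjv h) : C2 R * C2 R) < r by apply: Npair_lt; rewrite ?N_cjv.
apply: (lim_uniq (fun J => \sum_(a <- J) f a (h, cjv h))) => [|e e0]; first exact: PS.
have FF := @totally_filter real_exponent.
have /cP/cvgrPdist_lt/(_ _ e0)[J0 _ J0P] : N h < r0.
  by rewrite (lt_trans hr') // /r; move: r00; clear; lra.
exists J0 => J /J0P/ltW; rewrite sumfE -NC NBC rmorphB rmorph_sum /=.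
congr (N (_ - _) <= _); apply: eq_bigr => a _.
by rewrite /f cmonomial_real rmorphM.
Qed.

End Complexification.

(** * Levi form and holomorphic curves *)

Section Wirtinger.
Variable R : realType.
Local Notation C := (R[i]).
Local Notation C2C2 := ((C2 R * C2 R)%type).
Implicit Types (f : C2 R -> C) (P L : C2C2 -> C) (q v w : C2 R).

Section PairLinear.
Variables (V W : normedModType C) (L : (V * W)%type -> C).
Hypothesis lin : forall (a : C) x y, L (a *: x + y) = a *: L x + L y.

Lemma pairD (v : V) (w : W) : L (v, w) = L (v, 0) + L (0, w).
Proof. by rewrite -(linD lin); congr L; congr (_, _); rewrite /= ?addr0 ?add0r. Qed.

Lemma pairDl (u v : V) : L (u + v, 0) = L (u, 0) + L (v, 0).
Proof. by rewrite -(linD lin); congr L; congr (_, _); rewrite /= addr0. Qed.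

Lemma pairDr (u v : W) : L (0, u + v) = L (0, u) + L (0, v).
Proof. by rewrite -(linD lin); congr L; congr (_, _); rewrite /= addr0. Qed.

Lemma pairZl a (v : V) : L (a *: v, 0) = a * L (v, 0).
Proof. by rewrite -[RHS](linZ lin); congr L; congr (_, _); rewrite /= scaler0. Qed.

Lemma pairZr a (w : W) : L (0, a *: w) = a * L (0, w).
Proof. by rewrite -[RHS](linZ lin); congr L; congr (_, _); rewrite /= scaler0. Qed.

End PairLinear.

Lemma lin_coord L w : (forall (a : C) x y, L (a *: x + y) = a *: L x + L y) ->
  L (w, 0) = \sum_(k < 2) w 0 k * L (ebasis R k, 0) /\
  L (0, w) = \sum_(k < 2) w 0 k * L (0, ebasis R k).
Proof.
move=> l; rewrite [in LHS](row2E w) [in X in _ /\ X = _](row2E w) !sum_ord2.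
by rewrite (pairDl l) (pairDr l) !(pairZl l) !(pairZr l).
Qed.

Lemma is_der_shift (V W : normedModType C) (f : V -> W) x (L : V -> W) :
  is_der f x L -> is_der (fun y => f (x + y)) 0 L.
Proof.
move=> [l b d]; split=> // e /d[r r0 rP]; exists r => // h hr.
by rewrite add0r addr0 rP.
Qed.

Lemma derive1_rder (F : R -> C) (l : C) : rder F 0 l ->
  derive1 (fun t => complex.Re (F t)) 0 +i* derive1 (fun t => complex.Im (F t)) 0 = l.
Proof.
move=> Fl; have re (x : R) z : complex.Re (z - x%:C * l) = complex.Re z - x * complex.Re l.
  by case: z l {Fl} => a b [c d] /=; rewrite mul0r subr0.
have im (x : R) z : complex.Im (z - x%:C * l) = complex.Im z - x * complex.Im l.
  by case: z l {Fl re} => a b [c d] /=; rewrite mul0r addr0.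
have [d1 d2] : is_derive (0 : R) 1 (fun t => complex.Re (F t)) (complex.Re l) /\
    is_derive (0 : R) 1 (fun t => complex.Im (F t)) (complex.Im l).
  split; apply: real_is_derive => e /Fl[d d0 dP]; exists d => // h /dP; apply: le_trans.
    by rewrite -raddfB -re Re_le_N.
  by rewrite -raddfB -im Im_le_N.
by rewrite !derive1E !derive_val; case: l {Fl re im d1 d2}.
Qed.

Lemma cjvD v w : cjv (v + w) = cjv v + cjv w.
Proof. by apply/rowP => k; rewrite !mxE rmorphD. Qed.

Lemma cjvZ (a : C) v : cjv (a *: v) = conjc a *: cjv v.
Proof. by apply/rowP => k; rewrite !mxE; exact: (rmorphM conjc). Qed.

Lemma cjv_ebasis k : cjv (ebasis R k) = ebasis R k.
Proof. by apply/rowP => j; rewrite !mxE conjc_nat. Qed.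

(** The chain rule along the curve t |-> (t v, t conj v) of a real variable t. *)
Lemma rderiveC_hol f P L q v : (\forall h \near (0 : C2 R), f (q + h) = P (h, cjv h)) ->
  is_der P 0 L -> rderiveC f v q = L (v, cjv v).
Proof.
move=> /near0E[d d0 fP] [l [K K0 LK] PL].
apply: derive1_rder => e e0; have v1 : 0 < N v + 1 by rewrite ltr_wpDl ?N_ge0.
have [r r0 rP] := PL _ (divr_gt0 e0 v1).
exists (Num.min d r / (N v + 1)) => [|t].
  by rewrite divr_gt0 // lt_min d0.
rewrite ltr_pdivlMr // lt_min => /andP[td tr].
have tv (a : R) : `|t| * (N v + 1) < a -> N (t%:C *: v) < a.
  by move=> h; rewrite NZ NC (le_lt_trans _ h) // ler_wpM2l // lerDl.
have Np : N ((t%:C *: v, cjv (t%:C *: v)) : C2C2) = `|t| * N v.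
  by rewrite Npair N_cjv maxxx NZ NC.
have -> : t%:C * L (v, cjv v) = L (t%:C *: v, cjv (t%:C *: v)).
  rewrite cjvZ conjc_real -[RHS](congr1 L (_ : t%:C *: ((v, cjv v) : C2C2) = _)) //.
  by rewrite (linZ l).
have := rP (t%:C *: v, cjv (t%:C *: v)).
rewrite add0r scale0r !addr0 add0r Np fP ?tv // -[f q](congr1 f (addr0 q)) fP ?N0 //.
rewrite cjv0.
move=> H; apply: le_trans (H _) _.
  by rewrite (le_lt_trans _ tr) // ler_wpM2l // lerDl.
rewrite [leLHS](_ : _ = e * (`|t| * (N v / (N v + 1)))); last by ring.
rewrite ler_wpM2l ?(ltW e0) // ler_piMr //.
by rewrite ler_pdivrMr // mul1r lerDl.
Qed.

Lemma rderive_hol (rho : C2 R -> R) P L q v :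
  (\forall h \near (0 : C2 R), (rho (q + h))%:C = P (h, cjv h)) -> is_der P 0 L ->
  (rderive rho v q)%:C = L (v, cjv v).
Proof.
move=> rhoP PL; rewrite -(rderiveC_hol (f := fun z => (rho z)%:C) v rhoP PL) /rderiveC.
by congr (_ +i* _); rewrite /rderive /= derive1_cst.
Qed.

(** The Wirtinger derivatives are the partial derivatives of the complexification in z and in
    its conjugate variable. *)
Lemma dz_hol f P L q k : (\forall h \near (0 : C2 R), f (q + h) = P (h, cjv h)) ->
  is_der P 0 L -> dz k f q = L (ebasis R k, 0) /\ dzbar k f q = L (0, ebasis R k).
Proof.
move=> fP PL; have [l _ _] := PL; rewrite /dz /dzbar !(rderiveC_hol _ fP PL) cjvZ cjv_ebasis.
rewrite conj_i (pairD l (ebasis R k)) (pairD l ('i%C *: ebasis R k)) (pairZl l) (pairZr l).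
set x := L (_, _); set y := L (_, _).
have e : 'i%C * ('i%C * x + - 'i%C * y) = y - x :> C.
  by rewrite mulrDr mulNr mulrN !mulrA mul_ii; ring.
by split; rewrite e; field.
Qed.

(** If the linear part vanished, the value of the differential of rho on v would be the antilinear
    part b, and on 'i v it would be - 'i b. Both are real only if b = 0. *)
Lemma linear_part_neq0 L q (rho : C2 R -> R) v :
  (forall (a : C) x y, L (a *: x + y) = a *: L x + L y) ->
  (forall v, (rderive rho v q)%:C = L (v, cjv v)) -> rderive rho v q != 0 ->
  exists w, L (w, 0) != 0.
Proof.
move=> l rL rv; apply: contrapT => none.
have lw w : L (w, 0) = 0 by apply: contrapT => /eqP nw; apply: none; exists w.
have b0 := rL v; rewrite (pairD l) lw add0r in b0.
have := rL ('i%C *: v); rewrite cjvZ (pairD l) lw add0r (pairZr l) conj_i -b0.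
move=> /(congr1 (@complex.Im R)); move/eqP: rv; move: (rderive rho v q) => x x0 /= H.
by apply: x0; move: H; clear; lra.
Qed.

End Wirtinger.

Section LeviNull.
Variable R : realType.
Local Notation C := (R[i]).
Local Notation C2C2 := ((C2 R * C2 R)%type).

(** The points (s, conj s) are the images of the real points (a, b) under
    (a, b) |-> (a + 'i b, a - 'i b). *)
Lemma identity_conj (S : (C * C)%type -> C) : nhol S ->
  (\forall s \near (0 : C), S (s, s^*) = 0) -> \forall p \near (0 : (C * C)%type), S p = 0.
Proof.
move=> hS /near0E[d d0 S0].
pose u (p : (C * C * C)%type) : (C * C)%type := (p.1.1 + 'i%C *: p.1.2, p.1.1 + - 'i%C *: p.1.2).
have su : small u.
  by apply: small_pair; apply: smallD; [|apply: smallZ| |apply: smallZ];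
    [apply: small_fst|apply: small_snd|apply: small_fst|apply: small_snd];
    apply: small_fst; exact: small_id.
have hu : nhol u.
  apply: nhol_pair; apply: nholD; [| | |];
   by apply: nhol_all => p; [..]; try apply: holZ; hol_tuple.
have d2 : 0 < d / 2 by rewrite divr_gt0.
have := @identity3 R (fun p => S (u p)) _ d2 (nhol_comp hS su hu).
move=> H; have {H} Su : \forall p \near (0 : (C * C * C)%type), S (u p) = 0.
  apply: H => a b s ad bd _; rewrite /u /=.
  have -> : a%:C + - 'i%C *: b%:C = (a%:C + 'i%C *: b%:C)^*.
    by apply/eqP; rewrite eq_complex /=; apply/andP; split; apply/eqP; ring.
  apply: S0; rewrite (le_lt_trans (ND _ _)) // NZ Ni mul1r !NC.
  by move: ad bd; clear; lra.
pose v (p : (C * C)%type) : (C * C * C)%type :=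
  ((2^-1 *: (p.1 + p.2), (2 * 'i%C)^-1 *: (p.1 + -1 *: p.2)), 0).
have sv : small v.
  apply: small_pair; last exact: small0.
  apply: small_pair; apply: smallZ; apply: smallD.
  - exact/small_fst/small_id.
  - exact/small_snd/small_id.
  - exact/small_fst/small_id.
  - exact/smallZ/small_snd/small_id.
apply: filterS (near_small sv Su) => -[s e]; rewrite /u /v /= => {1}<-; congr S.
have i0 := i_neq0 R.
by congr (_, _); rewrite -![_ *: _]/(_ * _); field.
Qed.

(** Let S(s, e) = P(c(s), conj c(conj e)) with P the complexification of rho at q. It vanishes
    for e = conj s because the curve lies in the hypersurface, hence identically. Its derivative
    in e at e = 0 vanishes for all s; the derivative of that in s at s = 0 is the Levi form on w.
    The derivative in s alone says that w is annihilated by the complex-linear part of the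
    differential of rho. So is every complex tangent vector, because the differential kills it
    together with its multiples by 'i. In C^2 the annihilated vectors form the line spanned by w. *)
Theorem levi_null_of_curve (rho : C2 R -> R) (q w : C2 R) (c : C -> C2 R) (V : set (C2 R)) :
  local_defining_function rho V q ->
  nhol c -> c 0 = 0 -> is_der c 0 (fun s => s *: w) -> w != 0 ->
  (\forall s \near (0 : C), V (q + c s)) ->
  forall xi, complex_tangent_space rho q xi -> levi_form rho q xi = 0.
Proof.
move=> [an [v0 rv0] Vrho] hc c0 dc w0 cV.
have [P [r [B [r0 bP realP Prho]]]] := complexification an.
have hP : nhol P by apply/near0E; exists r => // h hr; have := bP.1 h hr; rewrite add0r.
have [L PL] := near_hol0 hP; have [l _ _] := PL.
pose f (z : C2 R) := (rho z)%:C : C.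
have fP : \forall h \near (0 : C2 R), f (q + h) = P (h, cjv h).
  by apply: filterS Prho => h ->.
have rL v : (rderive rho v q)%:C = L (v, cjv v) := rderive_hol v fP PL.
have sc : small c := small_near_hol hc c0.
have crho : \forall s \near (0 : C), P (c s, cjv (c s)) = 0.
  have Vr : \forall h \near (0 : C2 R), V (q + h) <-> rho (q + h) = 0.
    have [d d0 dP] := (nearE _ _).1 Vrho; apply/near0E; exists d => // h; exact: dP.
  apply: filterS3 (near_small sc Vr) cV (near_small sc Prho) => s Vs cs ->.
  by rewrite (Vs.1 cs).
pose cb (e : C) := cjv (c (conjc e)).
have cb0 : cb 0 = 0 by rewrite /cb conjc0 c0 cjv0.
have hcb : nhol cb.
  have sconj : small (conjc : C -> C) by move=> e e0; exists e => // z; rewrite Nconj.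
  apply: filterS (near_small sconj hc) => e [Lc cL].
  eexists; apply: is_der_conj cL => //.
  - exact: (rmorphD conjc).
  - exact: (rmorphM conjc).
  - exact: Nconj.
  - exact: cjvD.
  - exact: cjvZ.
  - exact: N_cjv.
have dcb : is_der cb 0 (fun e => e *: cjv w).
  have -> : (fun e : C => e *: cjv w) = (fun e => cjv (conjc e *: w)).
    by apply/funext => e; rewrite cjvZ conjcK.
  apply: (@is_der_conj R _ _ conjc (@cjv R) c 0 (fun s => s *: w)).
  - exact: (rmorphD conjc).
  - exact: (rmorphM conjc).
  - exact: Nconj.
  - exact: cjvD.
  - exact: cjvZ.
  - exact: N_cjv.
  by rewrite conjc0.
have scb : small cb := small_near_hol hcb cb0.
pose S (p : (C * C)%type) := P (c p.1, cb p.2).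
have S0 : \forall p \near (0 : (C * C)%type), S p = 0.
  apply: identity_conj.
    by rewrite /S; nhol_t.
  by apply: filterS crho => s; rewrite /S /cb /= conjcK.
have [r' r'0 S0'] := (near0E _).1 S0.
have de : \forall s \near (0 : C), forall L', is_der P (c s, 0) L' -> L' (0, cjv w) = 0.
  apply/near0E; exists r' => // s sr L' PL'.
  have d1 : is_der (fun e : C => S (s, e)) 0 (fun h => L' (0, h *: cjv w)).
    apply: (is_der_comp (f := fun e => (c s, cb e) : C2C2) (g := P)).
      by apply: is_der_pair dcb; exact: is_der_cst.
    by rewrite cb0.
  have d2 : is_der (fun e : C => S (s, e)) 0 (fun h => 0).
    apply: (is_der_near (f := fun=> 0)); last exact: is_der_cst.
    by apply/near0E; exists r' => // e er; rewrite S0' //; apply: Npair_lt.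
  by have := is_der_uniq d1 d2 1; rewrite scale1r.
have ds : L (w, 0) = 0.
  have d1 : is_der (fun s : C => S (s, 0)) 0 (fun h => L (h *: w, 0)).
    apply: (is_der_comp (f := fun s => (c s, cb 0) : C2C2) (g := P)).
      by apply: is_der_pair; [exact: dc|exact: is_der_cst].
    by rewrite cb0 c0.
  have d2 : is_der (fun s : C => S (s, 0)) 0 (fun h => 0).
    apply: (is_der_near (f := fun=> 0)); last exact: is_der_cst.
    by apply/near0E; exists r' => // s sr; rewrite S0' //; apply: Npair_lt; rewrite ?N0.
  by have := is_der_uniq d1 d2 1; rewrite scale1r.
(* G j is the derivative of P in the j-th conjugate variable *)
have /choice[G GP] j := bhol_dir (0, ebasis R j) r0 bP.
have r2 : 0 < r / 2 by rewrite divr_gt0.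
have hG j : nhol (G j).
  have [[B' bG] _] := GP j; apply/near0E; exists (r / 2) => // h hr.
  by have := bG.1 h hr; rewrite add0r.
have GE j p : N p < r / 2 -> forall L', is_der P p L' -> L' (0, ebasis R j) = G j p.
  by have [_ GP2] := GP j => /GP2; rewrite add0r.
have /choice[M GM] j := near_hol0 (hG j).
have near_r (x : R) : 0 < x -> \forall h \near (0 : C2 R), N h < x by move=> x0; apply/near0E; exists x.
have dzG j k : dz k (dzbar j f) q = M j (ebasis R k, 0).
  suff H : \forall h \near (0 : C2 R), dzbar j f (q + h) = G j (h, cjv h) by case: (dz_hol k H (GM j)).
  have /near0E[d d0 dP] := fP.
  apply/near0E; exists (Num.min (d / 2) (r / 2)) => [|h]; first by rewrite lt_min r2 divr_gt0.
  rewrite lt_min => /andP[hd hr].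
  have Nh : N ((h, cjv h) : C2C2) < r / 2 by apply: Npair_lt; rewrite ?N_cjv.
  have [L' PL'] : hol P (h, cjv h).
    have := bP.1 (h, cjv h); rewrite add0r; apply; rewrite (lt_trans Nh) //.
    by move: r0; clear; lra.
  rewrite -(GE j _ Nh L' PL').
  suff H : \forall h' \near (0 : C2 R), f ((q + h) + h') = P ((h, cjv h) + (h', cjv h')).
    by case: (dz_hol j H (is_der_shift PL')).
  apply/near0E; exists (d / 2) => [|h' hd']; first by rewrite divr_gt0.
  rewrite -addrA dP ?cjvD // (le_lt_trans (ND _ _)) //.
  by move: hd hd'; clear; lra.
(* M j is the derivative of G j at 0, and M j (xi, 0) its part in the variables z *)
have leviE (xi : C2 R) : levi_form rho q xi = \sum_(j < 2) conjc (xi 0 j) * M j (xi, 0).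
  rewrite /levi_form exchange_big /=; apply: eq_bigr => j _.
  have [lj _ _] := GM j; rewrite (lin_coord xi lj).1 mulr_sumr; apply: eq_bigr => k _.
  by rewrite dzG mulrC [M _ _ * _]mulrC.
have levi_w : levi_form rho q w = 0.
  rewrite leviE.
  have T0 : \forall s \near (0 : C), \sum_(j < 2) conjc (w 0 j) *: G j (c s, 0) = 0.
    have nr : \forall p \near (0 : C2C2), N p < r / 2 by apply/near0E; exists (r / 2).
    have s0 : small (fun s : C => (c s, 0) : C2C2) by apply: small_pair => //; exact: small0.
    apply: filterS2 (near_small s0 nr) de => s sr des.
    have [L' PL'] : hol P (c s, 0).
      have := bP.1 (c s, 0); rewrite add0r; apply; rewrite (lt_trans sr) //.
      by move: r0; clear; lra.
    have [l' _ _] := PL'.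
    rewrite -[RHS](des _ PL') (lin_coord (cjv w) l').2; apply: eq_bigr => j _.
    by rewrite (GE _ _ sr _ PL') mxE.
  have d1 : is_der (fun s : C => \sum_(j < 2) conjc (w 0 j) *: G j (c s, 0)) 0
     (fun h => \sum_(j < 2) conjc (w 0 j) *: M j (h *: w, 0)).
    have t j : is_der (fun s : C => conjc (w 0 j) *: G j (c s, 0)) 0
        (fun h => conjc (w 0 j) *: M j (h *: w, 0)).
      apply: is_derZ; apply: (is_der_comp (f := fun s => (c s, 0) : C2C2) (g := G j)).
        by apply: is_der_pair; [exact: dc|exact: is_der_cst].
      by rewrite c0; exact: GM.
    by have := is_derD (t 0) (t 1); congr is_der; apply/funext => s; rewrite sum_ord2.
  have d2 : is_der (fun s : C => \sum_(j < 2) conjc (w 0 j) *: G j (c s, 0)) 0 (fun h => 0).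
    apply: (is_der_near (f := fun=> 0)); last exact: is_der_cst.
    by apply: filterS T0 => s ->.
  by have := is_der_uniq d1 d2 1; rewrite scale1r.
move=> xi [t1 [eta t2 xiE]].
have i0 := i_neq0 R.
have eta0 : L (eta, 0) = 0.
  have := rL eta; rewrite [rderive _ _ _]t2 (pairD l) => /esym/eqP; rewrite addr_eq0 => /eqP ab.
  have := rL xi; rewrite [rderive _ _ _]t1 -xiE cjvZ (pairD l) (pairZl l) (pairZr l) conj_i mulNr.
  move=> /esym/subr0_eq/(mulfI i0) ba.
  by move/eqP: ab; rewrite -ba eq_sym eqNr => /eqP.
have L0 : (L (ebasis R 0, 0), L (ebasis R 1, 0)) <> 0.
  have [v Lv [e0 e1]] := linear_part_neq0 l rL rv0.
  by move: Lv; rewrite (lin_coord v l).1 sum_ord2 e0 e1 !mulr0 addr0 eqxx.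
have det : eta 0 0 * w 0 1 = eta 0 1 * w 0 0.
  have := eta0; rewrite (lin_coord eta l).1 sum_ord2 => h1.
  have := ds; rewrite (lin_coord w l).1 sum_ord2 => h2.
  move: L0 h1 h2; move: (L (ebasis R 0, 0)) (L (ebasis R 1, 0)) => x y xy h1 h2.
  have [x0|x0] := eqVneq x 0; last first.
    apply: (mulfI x0); apply/subr0_eq.
    transitivity (w 0 1 * (eta 0 0 * x + eta 0 1 * y) - eta 0 1 * (w 0 0 * x + w 0 1 * y)).
      by ring.
    by rewrite h1 h2 !mulr0 subrr.
  have [y0|y0] := eqVneq y 0; first by case: xy; rewrite x0 y0.
  apply: (mulfI y0); apply/subr0_eq.
  transitivity (eta 0 0 * (w 0 0 * x + w 0 1 * y) - w 0 0 * (eta 0 0 * x + eta 0 1 * y)).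
    by ring.
  by rewrite h1 h2 !mulr0 subrr.
have [a xiw] : exists a, xi = a *: w.
  have [w00|w00] := eqVneq (w 0 0) 0; last first.
    exists ('i%C * (eta 0 0 / w 0 0)); rewrite -xiE -scalerA; congr (_ *: _).
    apply/rowP; apply: ord2_ind; rewrite !mxE; first by rewrite divfK.
    by rewrite mulrAC det mulfK.
  have w01 : w 0 1 != 0.
    by apply: contra w0 => /eqP w01; apply/eqP/rowP; apply: ord2_ind; rewrite !mxE.
  exists ('i%C * (eta 0 1 / w 0 1)); rewrite -xiE -scalerA; congr (_ *: _).
  apply/rowP; apply: ord2_ind; rewrite !mxE; last by rewrite divfK.
  by rewrite mulrAC -det mulfK.
rewrite leviE xiw.
transitivity (conjc a * a * levi_form rho q w); last by rewrite levi_w mulr0.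
rewrite leviE mulr_sumr; apply: eq_bigr => j _; have [lj _ _] := GM j.
rewrite (pairZl lj) mxE (_ : conjc (a * w 0 j) = conjc a * conjc (w 0 j)); last exact: (rmorphM conjc).
by rewrite mulrACA.
Qed.


End LeviNull.

(** * Holomorphic maps of C^2 *)

Section Bridge.
Variable R : realType.
Local Notation C := (R[i]).

Lemma gt0C (e : C) : 0 < e -> exists2 x : R, 0 < x & e = x%:C.
Proof.
move=> e0; have eE : e = (complex.Re e)%:C := esym (RRe_real (gtr0_real e0)).
by exists (complex.Re e) => //; rewrite -ltcR -eE.
Qed.

Lemma differentiable_is_der (W : normedModType C) (f : C2 R -> W) x :
  differentiable f x -> is_der f x ('d f x).
Proof.
move=> df; have l : forall (a : C) (u v : C2 R), 'd f x (a *: u + v) = a *: 'd f x u + 'd f x v.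
  by move=> a u v; rewrite linearP.
split=> //.
  exists (N ('d f x (ebasis R 0)) + N ('d f x (ebasis R 1))); first by rewrite addr_ge0 ?N_ge0.
  move=> w; rewrite {1}(row2E w) linearD !linearZ /= (le_trans (ND _ _)) // !NZ mulrDl.
  by rewrite lerD // mulrC ler_wpM2l ?N_ge0 // Ncoord.
move=> e e0; have [_ /eqaddoP/(_ e%:C)] := (diff_locallyP _ _).1 df.
rewrite ltcR => /(_ e0)/near0E[d d0 dP]; exists d => // h /dP /=.
rewrite !normE -rmorphM lecR -[(_ - _) h]/(f (h + x) - (f x + 'd f x h)).
by rewrite [h + x]addrC opprD addrA.
Qed.

Lemma is_der_differentiable (V W : normedModType C) (f : V -> W) x (L : V -> W) :
  is_der f x L -> differentiable f x /\ 'd f x = L :> (V -> W).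
Proof.
move=> [l [K K0 LK] fL].
pose Ll : {linear V -> W} := HB.pack L (GRing.isLinear.Build C V W *:%R L l).
have Lc : continuous Ll.
  move=> v; apply/cvgrPdist_lt => _ /gt0C[e e0 ->].
  apply/nearE; exists (e / (K + 1)) => [|h hd]; first by rewrite divr_gt0 // ltr_wpDl.
  rewrite normE ltcR NBC /= -[_ - _](linB l) addrC addKr (le_lt_trans (LK _)) //.
  move: hd; rewrite ltr_pdivlMr ?ltr_wpDl // => hd; rewrite (le_lt_trans _ hd) //.
  by rewrite mulrC ler_wpM2l ?N_ge0 // lerDl.
have fe : f \o shift x = cst (f x) + Ll +o_ 0 id.
  apply/eqaddoP => _ /gt0C[e e0 ->]; apply/near0E.
  have [d d0 dP] := fL _ e0; exists d => // h /dP.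
  rewrite !normE -rmorphM lecR -[(_ - _) h]/(f (h + x) - (f x + L h)).
  by rewrite [h + x]addrC opprD addrA.
have dE := diff_unique Lc fe; split=> //.
by apply/diff_locallyP; rewrite dE.
Qed.

Lemma tangent_bound (H : C2 R -> C2 R) : tangent_to_identity0 H ->
  exists A : R, \forall z \near (0 : C2 R), N (H z - z) <= A * N z ^+ 2.
Proof.
move=> /eqO_exP[k k0 kP]; have [x x0 kE] := gt0C k0; exists x.
apply: filterS kP => z; rewrite kE normrX normr_id !normE.
by rewrite -rmorphXn -rmorphM lecR.
Qed.

Lemma frame (b : C2 R) : b != 0 -> exists (a : C2 R) (I : C2 R -> (C * C)%type),
  [/\ forall (t : C) u v, I (t *: u + v) = t *: I u + I v,
      exists2 K : R, 0 <= K & forall v, N (I v) <= K * N v,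
      forall p : C * C, I (p.1 *: a + p.2 *: b) = p &
      forall v, (I v).1 *: a + (I v).2 *: b = v].
Proof.
move=> b0.
have [a D0] : exists a : C2 R, a 0 0 * b 0 1 - a 0 1 * b 0 0 != 0.
  have [b00|b00] := eqVneq (b 0 0) 0; last first.
    by exists (ebasis R 1); rewrite !mxE /= mul0r sub0r mul1r oppr_eq0.
  have b01 : b 0 1 != 0.
    by apply: contra b0 => /eqP b01; apply/eqP/rowP; apply: ord2_ind; rewrite !mxE.
  by exists (ebasis R 0); rewrite !mxE /= mul0r subr0 mul1r.
pose D := a 0 0 * b 0 1 - a 0 1 * b 0 0.
exists a, (fun v => ((v 0 0 * b 0 1 - v 0 1 * b 0 0) / D, (a 0 0 * v 0 1 - a 0 1 * v 0 0) / D)).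
split.
- move=> t u v; rewrite [RHS]surjective_pairing; congr (_, _); rewrite !mxE /=.
    by rewrite -[X in _ = X + _]/(t * _); field.
  by rewrite -[X in _ = X + _]/(t * _); field.
- exists ((N (b 0 1) + N (b 0 0)) / N D + (N (a 0 0) + N (a 0 1)) / N D).
    by rewrite addr_ge0 // divr_ge0 ?addr_ge0 ?N_ge0.
  have bd (x y : C) (v : C2 R) : N ((v 0 0 * x - v 0 1 * y) / D) <= (N x + N y) / N D * N v.
    rewrite NM NV mulrAC ler_wpM2r ?invr_ge0 ?N_ge0 // (le_trans (NB _ _)) // !NM mulrDl.
    by rewrite lerD // mulrC ler_wpM2l ?N_ge0 ?Ncoord.
  have p1 (x y : C) (v : C2 R) : 0 <= (N x + N y) / N D * N v.
    by rewrite mulr_ge0 ?divr_ge0 ?addr_ge0 ?N_ge0.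
  move=> v; rewrite [leRHS]mulrDl; apply: Npair_le.
    by apply: le_trans (bd (b 0 1) (b 0 0) v) _; rewrite lerDl p1.
  rewrite [X in N X <= _](_ : _ = (v 0 0 * - a 0 1 - v 0 1 * - a 0 0) / D); last by congr (_ / _); ring.
  by apply: le_trans (bd (- a 0 1) (- a 0 0) v) _; rewrite !NN [N (a 0 1) + _]addrC lerDr p1.
- by case=> z w; congr (_, _); rewrite !mxE /= /D; field.
- by move=> v; apply/rowP; apply: ord2_ind; rewrite !mxE /= /D; field.
Qed.

End Bridge.

(** * The Segre variety of the origin is fixed *)

Section Main.
Variable R : realType.
Local Notation C := (R[i]).
Local Notation C2' := ((C * C)%type).
Local Notation C2C2 := ((C2 R * C2 R)%type).

(** Choose the second coordinate axis b with 'i b = v0 transversal to M, so that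
    fixed_or_foliated applies in the coordinates I. In the foliated case, through each point q
    of M near 0 there is a holomorphic curve in M whose first coordinate moves with speed 1;
    so levi_null_of_curve contradicts the assumption that M is not Levi-flat near 0. *)
Theorem fixes_segre_variety (H : C2 R -> C2 R) (M : set (C2 R)) (rho : C2 R -> R)
    (P : C2C2 -> C) (r : R) :
  H 0 = 0 -> nhol H -> tangent_to_identity0 H ->
  M 0 -> local_defining_function rho M 0 -> levi_nonflat0 M -> preserves_germ0 H M ->
  0 < r -> nhol P ->
  (forall p, N p < r -> conjc (P p) = P (cjv p.2, cjv p.1)) ->
  (\forall h \near (0 : C2 R), P (h, cjv h) = (rho h)%:C) ->
  \forall z \near (0 : C2 R), P (z, 0) = 0 -> H z = z.
Proof.
move=> H0 hH tanH M0 [an [v0 rv0] Mrho] nonflat pres r0 hP realP Prho.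
have sH : small H := small_near_hol hH H0.
have [L PL] := near_hol0 hP; have [l _ _] := PL.
have rhoP : \forall h \near (0 : C2 R), (rho (0 + h))%:C = P (h, cjv h).
  by apply: filterS Prho => h ->; rewrite add0r.
have rL v : (rderive rho v 0)%:C = L (v, cjv v) := rderive_hol v rhoP PL.
have P0 : P 0 = 0.
  have [d d0 dP] := (near0E _).1 Prho; have := dP 0; rewrite N0 => /(_ d0).
  rewrite cjv0 => ->; rewrite (_ : rho 0 = 0) //.
  by apply/(nbhs_singleton Mrho).
pose b := - 'i%C *: v0.
have ib : 'i%C *: b = v0.
  by rewrite /b scalerA mulrN mul_ii opprK scale1r.
have b0 : b != 0.
  apply: contraNneq rv0 => b0; apply/eqP/complexI.
  by rewrite rL -ib b0 scaler0 -[X in (_, X)](_ : 0 = _) ?(lin0 l) //; apply/rowP => k; rewrite !mxE conjc0.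
clearbody b; have [a [I [lI [K K0 KI] IK KI']]] := frame b0.
pose La (p : C2') := p.1 *: a + p.2 *: b.
pose Lb (p : C2') := p.1 *: cjv a + p.2 *: cjv b.
have IL p : I (La p) = p by exact: IK.
have LI v : La (I v) = v by exact: KI'.
have Lbcj p : Lb (cj p) = cjv (La p) by rewrite /La /Lb cjvD !cjvZ.
have Lacj p : La (cj p) = cjv (Lb p).
  by rewrite -[p in RHS]cjK Lbcj cjvK.
have lin_ab (x y : C2 R) : [/\ forall (t : C) (p q : C2'),
    (t *: p + q).1 *: x + (t *: p + q).2 *: y = t *: (p.1 *: x + p.2 *: y) + (q.1 *: x + q.2 *: y) &
    forall p : C2', N (p.1 *: x + p.2 *: y) <= (N x + N y) * N p].
  split=> [t p q|p].
    by rewrite /= -[t *: p.1]/(t * p.1) -[t *: p.2]/(t * p.2); apply/rowP => k; rewrite !mxE; ring.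
  rewrite (le_trans (ND _ _)) // !NZ mulrDl lerD // mulrC ler_wpM2l ?N_ge0 ?Nfst ?Nsnd //.
have [lLa bLa] := lin_ab a b; have [lLb bLb] := lin_ab (cjv a) (cjv b).
have dLa p : is_der La p La by exact: lin_is_der bLa.
have dLb p : is_der Lb p Lb by exact: lin_is_der bLb.
have dI v : is_der I v I by exact: lin_is_der KI.
have La0 : La 0 = 0 by exact: (lin0 lLa).
have Lb0 : Lb 0 = 0 by exact: (lin0 lLb).
have I0 : I 0 = 0 by exact: (lin0 lI).
have hLa : nhol La by apply: nhol_all => p; exists La.
have hLb : nhol Lb by apply: nhol_all => p; exists Lb.
have hI : nhol I by apply: nhol_all => p; exists I.
have sLa : small La := small_near_hol hLa La0.
have sLb : small Lb := small_near_hol hLb Lb0.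
have sI : small I := small_near_hol hI I0.
pose P' (p : C2' * C2') := P (La p.1, Lb p.2).
pose H' (x : C2') := I (H (La x)).
pose L' (p : C2' * C2') := L (La p.1, Lb p.2).
have hP' : nhol P' by rewrite /P'; nhol_t.
have hH' : nhol H' by rewrite /H'; nhol_t.
have P'0 : P' 0 = 0 by rewrite /P' La0 Lb0.
have H'0 : H' 0 = 0 by rewrite /H' La0 H0 I0.
have realP' : \forall p \near (0 : (C2' * C2')%type), (P' p)^* = P' (swapcj p).
  have s : small (fun p : C2' * C2' => (La p.1, Lb p.2) : C2C2) by small_t.
  have [d d0 dP] := s _ r0; apply/near0E; exists d => // p /dP/realP.
  by rewrite /P' /swapcj /= Lacj Lbcj.
have PL' : is_der P' 0 L'.
  apply: (is_der_comp (f := fun p : C2' * C2' => (La p.1, Lb p.2) : C2C2) (g := P)).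
    apply: is_der_pair.
      exact: (is_der_comp (is_der_fst 0) (dLa _)).
    exact: (is_der_comp (is_der_snd 0) (dLb _)).
  by rewrite /= La0 Lb0.
have L'n : L' ((0, 'i%C), (0, - 'i%C)) != 0.
  have -> : L' ((0, 'i%C), (0, - 'i%C)) = (rderive rho v0 0)%:C.
    rewrite rL /L' /La /Lb /= !scale0r !add0r -ib cjvZ.
    by rewrite conj_i.
  by apply: contra rv0 => /eqP/complexI/eqP.
have [A tH] := tangent_bound tanH.
have tH' : \forall x \near (0 : C2'), N (H' x - x) <= K * (`|A| * (N a + N b) ^+ 2) * N x ^+ 2.
  apply: filterS (near_small sLa tH) => x h.
  rewrite /H' -[X in _ - X]IL -(linB lI); apply: le_trans (KI _) _.
  rewrite -(mulrA K); apply: (ler_wpM2l K0); apply: le_trans h _; rewrite -(mulrA `|A|).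
  apply: (@le_trans _ _ (`|A| * N (La x) ^+ 2)); first by rewrite ler_wpM2r ?sqr_ge0 ?ler_norm.
  apply: (ler_wpM2l (normr_ge0 _)); rewrite -exprMn.
  by apply: lerXn2r (bLa x); rewrite nnegrE ?mulr_ge0 ?addr_ge0 ?N_ge0.
have zeroM : \forall x \near (0 : C2'), P' (x, cj x) = 0 <-> M (La x).
  apply: filterS2 (near_small sLa Prho) (near_small sLa Mrho) => x Px Mx.
  rewrite /P' /= Lbcj Px Mx; split=> [/complexI //|->//].
have presH' : \forall x \near (0 : C2'), P' (x, cj x) = 0 -> P' (H' x, cj (H' x)) = 0.
  have sH' : small H' := small_near_hol hH' H'0.
  apply: filterS3 zeroM (near_small sH' zeroM) (near_small sLa pres) => x e1 e2 pr.
  by move=> /e1/pr; rewrite -[H _]LI => /e2.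
have [fix_|[g [hg g0 g1 gP]]] := fixed_or_foliated P'0 hP' realP' PL' L'n H'0 hH' tH' presH'.
  apply: filterS (near_small sI fix_) => z h Pz.
  have := h; rewrite /P' /= Lb0 LI => /(_ Pz) /(congr1 La).
  by rewrite /H' LI LI.
exfalso; apply: nonflat.
have sg : small g by apply: small_near_hol hg _; exact: nbhs_singleton g0.
have sLg : small (fun p => La (g p)) by small_t.
have sp1 : small (fun p : C2' * C => p.1) by small_t.
(* both germs of conditions on (x, s) hold on one ball *)
have good : \forall p \near (0 : (C2' * C)%type), hol g p /\ (M (La p.1) -> M (La (g p))).
  have n1 := nearI0 (near_small sp1 zeroM) (near_small sg zeroM).
  by apply: filterS3 hg n1 gP => p hp [e1 e2] gp; split=> // /e1/gp/e2.
have [d d0 dP] := (near0E _).1 good; have [d' d'0 d'P] := (near0E _).1 g0.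
have dd : 0 < Num.min d d' by rewrite lt_min d0.
have [e e0 eP] := sI _ dd.
exists [set z : C2 R | N z < e]; split.
  split; last by rewrite /= N0.
  rewrite openE => z /= ze; apply/(nearE z _).2; exists (e - N z); first by rewrite subr_gt0.
  by move=> h hd /=; rewrite (le_lt_trans (ND _ _)) // addrC -ltrBrDr.
move=> q [Mq /= qe] rho' loc.
have := eP _ qe; rewrite lt_min => /andP[Iqd Iqd'].
have gq : g (I q, 0) = I q by exact: d'P.
pose c (s : C) := La (g (I q, s)) - q.
have c0 : c 0 = 0 by rewrite /c gq LI subrr.
have hgs s : N s < d -> hol g (I q, s).
  by move=> sd; apply: (dP (I q, s) (Npair_lt Iqd sd)).1.
have hc : nhol c.
  apply/near0E; exists d => // s sd; apply: holB; last exact: hol_cst.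
  apply: (hol_comp (f := fun s => g (I q, s))); last by eexists; exact: dLa.
  apply: (hol_comp (f := fun s => (I q, s) : C2' * C)); last exact: hgs.
  by apply: hol_pair; [exact: hol_cst|exact: hol_id].
have [Lc dc] := near_hol0 hc; have [lc _ _] := dc.
have dcE : is_der c 0 (fun s => s *: Lc 1).
  congr (is_der c 0): dc; apply/funext => s.
  by rewrite -(linZ lc); congr Lc; rewrite -[RHS]/(s * 1) mulr1.
apply: (levi_null_of_curve loc hc c0 dcE).
  have d1 : is_der (fun s => (I (c s)).1) 0 (fun s => (I (s *: Lc 1)).1).
    exact: (is_der_comp (is_der_comp dcE (dI _)) (is_der_fst _)).
  have d2 : is_der (fun s => (I (c s)).1) 0 (fun s => s).
    have -> : (fun s => (I (c s)).1) = id; last exact: is_der_id.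
    apply/funext => s; rewrite /c (linB lI) IL /= -[X in X - _]/((g (I q, s)).1) g1 /=.
    by rewrite addrC addKr.
  have := is_der_uniq d1 d2 1; rewrite scale1r; apply: contra_eqN => /eqP ->.
  by rewrite I0 /= eq_sym oner_eq0.
have sc : small c := small_near_hol hc c0.
have eq0 : 0 < e - N q by rewrite subr_gt0.
have [d2 d20 d2P] := sc _ eq0.
apply/near0E; exists (Num.min d d2) => [|s]; first by rewrite lt_min d0.
rewrite lt_min => /andP[sd sd2]; split; last first.
  by rewrite /= (le_lt_trans (ND _ _)) //; have := d2P _ sd2; rewrite ltrBrDl.
rewrite /c addrC subrK; apply: (dP (I q, s) (Npair_lt Iqd sd)).2.
by rewrite /= LI.
Qed.

End Main.

Theorem theorem1p6 (R : realType) (H : C2 R -> C2 R) (M : set (C2 R)) :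
  local_biholomorphism0 H ->
  tangent_to_identity0 H ->
  M 0 ->
  real_analytic_hypersurface M ->
  levi_nonflat0 M ->
  preserves_germ0 H M ->
  exists X : set (C2 R),
    complex_hypersurface0 X /\
    \forall z \near (0 : C2 R), X z -> H z = z.
Proof.
move=> [H0 difH _] tanH M0 hyp nonflat pres.
have [rho locM] := hyp 0 M0; have [an [v rv] _] := locM.
have [P [r [B [r0 bP realP rhoP]]]] := complexification an.
have hP : nhol P by apply/near0E; exists r => // p pr; have := bP.1 p pr; rewrite add0r.
have hH : nhol H by apply: filterS difH => z /differentiable_is_der ?; eexists; eauto.
have Prho : \forall h \near (0 : C2 R), P (h, cjv h) = (rho h)%:C.
  by apply: filterS rhoP => h ->; rewrite add0r.
exists [set z | P (z, 0) = 0]; split.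
  have [L PL] := near_hol0 hP; have [linL _ _] := PL.
  have rL w : (rderive rho w 0)%:C = L (w, cjv w).
    by apply: rderive_hol PL; apply: filterS rhoP.
  have hg : nhol (fun z : C2 R => P (z, 0)) by nhol_t.
  have dg : is_der (fun z : C2 R => P (z, 0)) 0 (fun h => L (h, 0)).
    apply: (is_der_comp (f := fun z : C2 R => (z, 0)) (g := P)) => //.
    by apply: is_der_pair; [exact: is_der_id|exact: is_der_cst].
  exists (fun z => P (z, 0)); split.
  - by apply: filterS hg => z [Lz /is_der_differentiable[]].
  - have [_ _ /nbhs_singleton[/(_ M0) rho0 _]] := locM.
    by have := nbhs_singleton Prho; rewrite cjv0 rho0.
  - by have [_ ->] := is_der_differentiable dg; exact: linear_part_neq0 linL rL rv.
  by apply/near0E; exists 1 => // z _; split.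
exact: fixes_segre_variety H0 hH tanH M0 locM nonflat pres r0 hP realP Prho.
Qed.
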